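(* Let $X_n$ be the size of a random catastrophe among all excursions with catastrophes of length $n$, with distribution $\Pr(X_n=k)=[z^nu^k]A(z,u)/[z^n]A(z,1)$ where $A(z,u)=E(z)+Q(z,u)D(z)^2E(z)$. Then $X_n$ admits a discrete limit distribution $\lim_{n\to\infty}\Pr(X_n=k)=[u^k]\,\omega(u)$, where $\omega(u)=Q(\rho_0,u)$ if $\rho_0\le\rho$, and, if $\rho_0$ does not exist, \[\omega(u)=\frac{\frac C\tau+\big(\frac C\tau D(\rho)^2+2\eta D(\rho)^3\big)Q(\rho,u)+\eta(u)D(\rho)^2}{\frac C\tau+\big(\frac C\tau D(\rho)^2+2\eta D(\rho)^3\big)Q(\rho,1)+\eta D(\rho)^2},\] with $C=\sqrt{2P(\tau)/P''(\tau)}$.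
   Context: Fix integers $c,d\ge1$ and non-negative real weights $p_{-c},\dots,p_d$ with $p_{-c}\neq0\neq p_d$; jump set $\mathcal J=\{i: p_i\neq0\}$, jump polynomial $P(u)=\sum_{i=-c}^dp_iu^i$. Standing assumption: $P$ is aperiodic (there are no integer $b$, integer $p\ge2$ and Laurent polynomial $H$ with $P(u)=u^bH(u^p)$). A catastrophe is a step from an altitude $h>0$ with $-h\notin\mathcal J$ directly to altitude $0$; its size is $h$ and its weight is $q>0$. Paths start at altitude $0$; each step is a jump $i\in\mathcal J$ (weight $p_i$) or a catastrophe; the weight of a path is the product of its step weights. Meanders never go below $0$; excursions are meanders ending at $0$. Let $M(z,u)=\sum m_{n,k}z^nu^k$, with $m_{n,k}$ the total weight of catastrophe-free meanders of length $n$ ending at altitude $k$; $M_k(z)=[u^k]M(z,u)$, $M(z)=M(z,1)$, $E(z)=M_0(z)$. Let $Q(z,u)=zq\big(M(z,u)-E(z)-\sum_{j>0,-j\in\mathcal J}u^jM_j(z)\big)$, $Q(z)=Q(z,1)$, $D(z)=1/(1-Q(z))$. Let $\tau>0$ be the minimal positive real solution of $P'(\tau)=0$ and $\rho=1/P(\tau)$. Let $\rho_0$ be the smallest positive real zero of $1-Q(z)$ satisfying $\rho_0\le\rho$, if it exists (''$\rho_0$ does not exist'' otherwise). For $0\le u\le 1$, $\eta(u)$ is defined by $Q(z,u)=Q(\rho,u)-\eta(u)\sqrt{1-z/\rho}+O(1-z/\rho)$ as $z\to\rho^-$, and $\eta=\eta(1)$. *)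

(* Defs.v *)
From Stdlib Require Import Reals Lra Lia ZArith List Bool.
From Coquelicot Require Import Coquelicot.
Import ListNotations.
Open Scope R_scope.
Open Scope bool_scope.

Definition Zrange (c d : nat) : list Z :=
  map (fun i => (Z.of_nat i - Z.of_nat c)%Z) (seq 0 (c + d + 1)).

(* jump set J = { i : p_i <> 0 } (as a list; p vanishes outside [-c,d]) *)
Definition jumps (c d : nat) (p : Z -> R) : list Z :=
  filter (fun i => if Req_EM_T (p i) 0 then false else true) (Zrange c d).

Definition Pfun (c d : nat) (p : Z -> R) (u : R) : R :=
  fold_right Rplus 0 (map (fun i => p i * powerRZ u i) (Zrange c d)).

(* Aperiodicity: there are no integer b, integer k >= 2 and Laurent polynomial H
   (finitely supported coefficient family h) with P(u) = u^b H(u^k), i.e.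
   (coefficientwise) p_i = h_((i-b)/k) if k | i-b, and p_i = 0 otherwise. *)
Definition aperiodic (p : Z -> R) : Prop :=
  ~ exists (b k : Z) (h : Z -> R),
      (2 <= k)%Z /\
      (exists N : Z, forall j, (N < Z.abs j)%Z -> h j = 0) /\
      (forall i : Z, p i = if Z.eqb ((i - b) mod k) 0 then h ((i - b) / k)%Z else 0).

Fixpoint walks (c d : nat) (p : Z -> R) (n : nat) : list (list Z) :=
  match n with
  | O => [ [] ]
  | S n' => flat_map (fun i => map (cons i) (walks c d p n')) (jumps c d p)
  end.

Fixpoint stays_nonneg (h : Z) (w : list Z) : bool :=
  match w with
  | [] => true
  | i :: w' => (0 <=? h + i)%Z && stays_nonneg (h + i) w'
  end.

Definition final_alt (w : list Z) : Z := fold_left Z.add w 0%Z.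

Definition weight (p : Z -> R) (w : list Z) : R :=
  fold_right (fun i acc => p i * acc) 1 w.

Definition mcoef (c d : nat) (p : Z -> R) (n k : nat) : R :=
  fold_right Rplus 0
    (map (weight p)
       (filter (fun w => stays_nonneg 0 w && Z.eqb (final_alt w) (Z.of_nat k))
          (walks c d p n))).

Definition conv (f g : nat -> R) (n : nat) : R :=
  sum_f_R0 (fun i => f i * g (n - i)%nat) n.

Definition Ec (c d : nat) (p : Z -> R) (n : nat) : R := mcoef c d p n 0.

(* [z^n u^k] Q(z,u), with
   Q(z,u) = z q ( M(z,u) - E(z) - sum_{j>0, -j in J} u^j M_j(z) ). *)
Definition Qc (c d : nat) (p : Z -> R) (q : R) (n k : nat) : R :=
  match n with
  | O => 0
  | S n' =>
      q * (mcoef c d p n' k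
           - (if Nat.eqb k 0 then mcoef c d p n' 0 else 0)
           - (if (0 <? k)%nat && (if Req_EM_T (p (- Z.of_nat k)%Z) 0 then false else true)
              then mcoef c d p n' k else 0))
  end.

(* [z^n] Q(z,u) as a polynomial in u; altitudes after n-1 steps are <= d*n,
   so the coefficients Qc n k vanish for k > d*n. *)
Definition Qnu (c d : nat) (p : Z -> R) (q : R) (n : nat) (u : R) : R :=
  sum_f_R0 (fun k => Qc c d p q n k * u ^ k) (d * n).

Definition Q1c (c d : nat) (p : Z -> R) (q : R) (n : nat) : R := Qnu c d p q n 1.

Fixpoint Qpowc (c d : nat) (p : Z -> R) (q : R) (r : nat) : nat -> R :=
  match r with
  | O => fun n => if Nat.eqb n 0 then 1 else 0
  | S r' => conv (Q1c c d p q) (Qpowc c d p q r')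
  end.

(* [z^n] D(z), D = 1/(1-Q) = sum_r Q^r  (Q has no constant term) *)
Definition Dc (c d : nat) (p : Z -> R) (q : R) (n : nat) : R :=
  sum_f_R0 (fun r => Qpowc c d p q r n) n.

Definition Ac (c d : nat) (p : Z -> R) (q : R) (n k : nat) : R :=
  (if Nat.eqb k 0 then Ec c d p n else 0)
  + conv (fun i => Qc c d p q i k)
         (conv (Dc c d p q) (conv (Dc c d p q) (Ec c d p))) n.

(* [z^n] A(z,1)  (Ac n k = 0 for k > d*n) *)
Definition A1c (c d : nat) (p : Z -> R) (q : R) (n : nat) : R :=
  sum_f_R0 (fun k => Ac c d p q n k) (d * n).

Definition PrX (c d : nat) (p : Z -> R) (q : R) (n k : nat) : R :=
  Ac c d p q n k / A1c c d p q n.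

Definition tau_spec (c d : nat) (p : Z -> R) (tau : R) : Prop :=
  0 < tau /\ Derive (Pfun c d p) tau = 0 /\
  (forall t, 0 < t < tau -> Derive (Pfun c d p) t <> 0).

Definition rho_of (c d : nat) (p : Z -> R) (tau : R) : R := / Pfun c d p tau.

(* r is the smallest positive real zero of 1 - Q(z), and r <= rho
   (Q(z) = sum_n [z^n]Q z^n converges at r with value 1). *)
Definition rho0_spec (c d : nat) (p : Z -> R) (q rho r : R) : Prop :=
  0 < r <= rho /\
  is_series (fun n => Q1c c d p q n * r ^ n) 1 /\
  (forall r', 0 < r' < r -> ~ is_series (fun n => Q1c c d p q n * r' ^ n) 1).

Definition Qval (c d : nat) (p : Z -> R) (q z u : R) : R :=
  Series (fun n => Qnu c d p q n u * z ^ n).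

(* eta(u), 0 <= u <= 1, defined by
   Q(z,u) = Q(rho,u) - eta(u) sqrt(1 - z/rho) + O(1 - z/rho)  as z -> rho^- *)
Definition eta_spec (c d : nat) (p : Z -> R) (q rho : R) (eta : R -> R) : Prop :=
  forall u, 0 <= u <= 1 ->
    exists Qr : R,
      is_series (fun n => Qnu c d p q n u * rho ^ n) Qr /\
      exists K delta : R, 0 < delta /\
        forall z, rho - delta < z < rho ->
          exists Qz : R,
            is_series (fun n => Qnu c d p q n u * z ^ n) Qz /\
            Rabs (Qz - Qr + eta u * sqrt (1 - z / rho)) <= K * (1 - z / rho).

Definition omega2 (c d : nat) (p : Z -> R) (q tau : R) (eta : R -> R) (u : R) : R :=
  let rho := rho_of c d p tau in
  let C := sqrt (2 * Pfun c d p tau / Derive_n (Pfun c d p) 2 tau) in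
  let Drho := / (1 - Qval c d p q rho 1) in
  let et := eta 1 in
  (C / tau + (C / tau * Drho ^ 2 + 2 * et * Drho ^ 3) * Qval c d p q rho u
     + eta u * Drho ^ 2)
  / (C / tau + (C / tau * Drho ^ 2 + 2 * et * Drho ^ 3) * Qval c d p q rho 1
     + et * Drho ^ 2).

(* Main.v *)
Require Import Defs.
From Stdlib Require Import Reals ZArith Lra Lia List Bool Ranalysis5.
From Coquelicot Require Import Coquelicot.
Import ListNotations.
Open Scope R_scope.

(* No complex analysis is used.  Tilting the jumps by tau, p_i -> p_i tau^i rho, turns them
   into a centred aperiodic law, for which Fourier inversion gives the local limit theorem
   P(S_n = k) ~ const n^(-1/2).  By Spitzer's identity
   M(z,v) = exp (sum_n z^n/n sum_(k>=0) P(S_n = k) v^k), and the real-variable calculus of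
   sequences of order n^(-3/2) (products, exponentials, 1/(1-Q) when Q < 1) yields
   n^(-3/2) asymptotics for M, E and Q at z = rho.

   If Q(rho) < 1 (which forces tau > 1), all coefficients of A(z,u) are of order
   rho^(-n) n^(-3/2); comparison with 1 - sqrt (1 - x) identifies the limiting constants with
   eta(u) and C/tau, and convergence for u in [0,tau), a neighbourhood of 1, gives the
   coefficientwise limit.

   If Q(rho_0) = 1, the coefficients d_n of D, scaled by rho_0^n, form a renewal sequence.
   From n d_n = (v * d)_n with v = (n q_n) * d and v -> v_oo > 0, the sequence D^2 satisfies
   n h_n = (2v * h)_n, so h is regularly varying and (f * h)_n / h_n -> sum f; this turns
   A = E + Q E D^2 into the limit Q(rho_0,u).  For rho_0 = rho the renewal sequence has
   infinite mean, but n q_n is half the tail of q asymptotically, whence v -> 1/2. *)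

(** * Sums and convolutions *)

(** What tilting can see depends on [tau]. At z = [rho] the variable u becomes v = u / [tau], and
    the geometric domination behind sums over altitudes works only for v < 1; it reaches u = 1
    exactly when [tau] > 1. For [tau] <= 1 the untilted law at u = 1 has nonnegative drift, so
    Q(z,1) diverges at R = 1/P(1) <= [rho]. Hence rho_0 exists and lies strictly below R, and the
    renewal weights decay geometrically: no asymptotics of Q at [rho] is required there. Without
    analyticity, coefficients cannot be read off the expansion that defines [eta]. The passage goes
    the other way: coefficient asymptotics come first, and an Abelian argument along real z then
    shows which value of [eta] they force. The Gaussian integral is never evaluated. Every local
    limit carries the factor [gauss_lim / PI], and so do the coefficients of 1 - sqrt (1 - x),
    because these are obtained from a lazy simple walk by the same local limit theorem. The factor
    cancels in the quotients, which leaves C/tau and [eta]. *)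

Lemma lim_eps (u : nat -> R) (l : R) :
  is_lim_seq u l <->
  forall e : R, 0 < e -> exists N, forall n, (N <= n)%nat -> Rabs (u n - l) < e.
Proof.
  rewrite <- is_lim_seq_spec; split.
  - intros H e He; exact (H (mkposreal e He)).
  - intros H [e He]; exact (H e He).
Qed.

Lemma lim_bounded (u : nat -> R) (l : R) :
  is_lim_seq u l -> exists K, 0 < K /\ forall n, Rabs (u n) <= K.
Proof.
  intros H; destruct (filterlim_bounded u) as [M HM].
  { exists l; exact H. }
  exists (Rabs M + 1); split; [pose proof (Rabs_pos M); lra|].
  intros n; specialize (HM n); unfold norm in HM; simpl in HM.
  unfold abs in HM; simpl in HM; pose proof (Rle_abs M); lra.
Qed.

Lemma lim_shift_down (u : nat -> R) (l : Rbar) (i : nat) :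
  is_lim_seq u l -> is_lim_seq (fun n => u (n - i)%nat) l.
Proof.
  intros H; apply (is_lim_seq_incr_n _ i).
  apply is_lim_seq_ext with u; [|exact H].
  intros n; f_equal; lia.
Qed.

Lemma sum_nonneg (f : nat -> R) n :
  (forall i, (i <= n)%nat -> 0 <= f i) -> 0 <= sum_f_R0 f n.
Proof.
  intros H; induction n as [|n IH]; simpl; [apply H; lia|].
  apply Rplus_le_le_0_compat; [apply IH; intros; apply H; lia|apply H; lia].
Qed.

Lemma sum_zero (f : nat -> R) n :
  (forall i, (i <= n)%nat -> f i = 0) -> sum_f_R0 f n = 0.
Proof.
  intros H; induction n as [|n IH]; simpl; [apply H; lia|].
  rewrite IH by (intros; apply H; lia); rewrite (H (S n)) by lia; ring.
Qed.

Lemma sum_scal_l (f : nat -> R) c n :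
  sum_f_R0 (fun i => c * f i) n = c * sum_f_R0 f n.
Proof.
  rewrite scal_sum; apply sum_eq; intros; ring.
Qed.

Lemma sum_le_extend (f : nat -> R) n m :
  (forall i, 0 <= f i) -> (n <= m)%nat -> sum_f_R0 f n <= sum_f_R0 f m.
Proof.
  intros Hf H; induction H; [lra|].
  simpl; specialize (Hf (S m)); lra.
Qed.

Lemma sum_extend_zero (f : nat -> R) n m :
  (forall i, (n < i)%nat -> f i = 0) -> (n <= m)%nat ->
  sum_f_R0 f m = sum_f_R0 f n.
Proof.
  intros Hf H; induction H; [reflexivity|].
  simpl; rewrite (Hf (S m)) by lia; lra.
Qed.

Lemma sum_term_le (f : nat -> R) i n :
  (forall j, 0 <= f j) -> (i <= n)%nat -> f i <= sum_f_R0 f n.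
Proof.
  intros Hf H; apply Rle_trans with (sum_f_R0 f i).
  - destruct i; simpl; [lra|]. pose proof (cond_pos_sum f i Hf); lra.
  - now apply sum_le_extend.
Qed.

Lemma sum_rev (f : nat -> R) n :
  sum_f_R0 (fun i => f (n - i)%nat) n = sum_f_R0 f n.
Proof.
  induction n as [|n IH]; [reflexivity|].
  rewrite decomp_sum by lia; simpl pred.
  change (fun i => f (S n - S i)%nat) with (fun i => f (n - i)%nat); rewrite IH.
  rewrite tech5, Nat.sub_0_r; ring.
Qed.

Lemma sum_abs (f : nat -> R) n :
  Rabs (sum_f_R0 f n) <= sum_f_R0 (fun i => Rabs (f i)) n.
Proof.
  induction n as [|n IH]; simpl; [lra|].
  eapply Rle_trans; [apply Rabs_triang|lra].
Qed.

Lemma sum_exchange (F : nat -> nat -> R) n m :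
  sum_f_R0 (fun i => sum_f_R0 (fun j => F i j) m) n
  = sum_f_R0 (fun j => sum_f_R0 (fun i => F i j) n) m.
Proof.
  induction n as [|n IH]; simpl; [reflexivity|].
  rewrite IH, <- plus_sum; reflexivity.
Qed.

Lemma series_lim (f : nat -> R) (l : R) :
  is_series f l <-> is_lim_seq (fun n => sum_f_R0 f n) l.
Proof.
  split; intros H.
  - apply is_lim_seq_ext with (sum_n f); [intros; apply sum_n_Reals|exact H].
  - apply is_lim_seq_ext with (v := sum_n f) in H; [exact H|].
    intros; symmetry; apply sum_n_Reals.
Qed.

Lemma sum_le_series (f : nat -> R) l n :
  (forall i, 0 <= f i) -> is_series f l -> sum_f_R0 f n <= l.
Proof.
  intros Hf H; apply series_lim in H.
  apply (is_lim_seq_incr_compare _ _ H).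
  intros k; simpl; specialize (Hf (S k)); lra.
Qed.

Lemma ex_series_bounded (f : nat -> R) B :
  (forall i, 0 <= f i) -> (forall n, sum_f_R0 f n <= B) ->
  exists l, is_series f l /\ l <= B.
Proof.
  intros Hf HB.
  destruct (ex_finite_lim_seq_incr (fun n => sum_f_R0 f n) B) as [l Hl].
  - intros n; simpl; specialize (Hf (S n)); lra.
  - exact HB.
  - exists l; split; [now apply series_lim|].
    apply (is_lim_seq_le _ (fun _ => B) l B HB Hl (is_lim_seq_const B)).
Qed.

Lemma lim_sum (F : nat -> nat -> R) (f : nat -> R) k :
  (forall i, is_lim_seq (fun n => F n i) (f i)) ->
  is_lim_seq (fun n => sum_f_R0 (F n) k) (sum_f_R0 f k).
Proof.
  intros H; induction k as [|k IH]; simpl; [apply H|].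
  now apply is_lim_seq_plus'.
Qed.

(** Dominated convergence for sums of growing length. The length [N] is left free because
    convolutions run up to n, whereas sums over altitudes run up to d n. *)
Lemma tannery (N : nat -> nat) (F : nat -> nat -> R) (f G : nat -> R) (l : R) :
  (forall n, (n <= N n)%nat) ->
  (forall i, is_lim_seq (fun n => F n i) (f i)) ->
  (forall n i, Rabs (F n i) <= G i) ->
  ex_series G -> is_series f l ->
  is_lim_seq (fun n => sum_f_R0 (F n) (N n)) l.
Proof.
  intros HN HF HG [SG HSG] Hf.
  assert (HG0 : forall i, 0 <= G i).
  { intros i; eapply Rle_trans; [apply Rabs_pos|apply (HG 0%nat)]. }
  apply lim_eps; intros e He.
  pose proof (proj1 (series_lim _ _) HSG) as HL.
  pose proof (proj1 (series_lim _ _) Hf) as HLf.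
  destruct (proj1 (lim_eps _ _) HL (e/4) ltac:(lra)) as [J1 HJ1].
  destruct (proj1 (lim_eps _ _) HLf (e/4) ltac:(lra)) as [J2 HJ2].
  set (J := (J1 + J2)%nat).
  specialize (HJ1 J ltac:(lia)). specialize (HJ2 J ltac:(lia)).
  destruct (proj1 (lim_eps _ _) (lim_sum F f J HF) (e/4) ltac:(lra)) as [M HM].
  exists (M + J)%nat; intros n Hn.
  specialize (HM n ltac:(lia)).
  assert (Ht : forall K, (J <= K)%nat ->
     Rabs (sum_f_R0 (F n) K - sum_f_R0 (F n) J) <= sum_f_R0 G K - sum_f_R0 G J).
  { intros K HK; induction HK as [|K HK IH].
    - rewrite Rminus_diag, Rabs_R0; lra.
    - simpl. replace (sum_f_R0 (F n) K + F n (S K) - sum_f_R0 (F n) J)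
        with ((sum_f_R0 (F n) K - sum_f_R0 (F n) J) + F n (S K)) by ring.
      eapply Rle_trans; [apply Rabs_triang|]. specialize (HG n (S K)); lra. }
  specialize (Ht (N n) ltac:(specialize (HN n); lia)).
  pose proof (sum_le_series G SG (N n) HG0 HSG).
  apply Rabs_def2 in HJ1.
  replace (sum_f_R0 (F n) (N n) - l) with
    ((sum_f_R0 (F n) (N n) - sum_f_R0 (F n) J)
     + (sum_f_R0 (F n) J - sum_f_R0 f J) + (sum_f_R0 f J - l)) by ring.
  eapply Rle_lt_trans; [apply Rabs_triang|].
  eapply Rle_lt_trans; [apply Rplus_le_compat_r, Rabs_triang|]. lra.
Qed.

(** The first J terms vanish because each single weight does; the others are at most e/2 times the
    total weight. *)
Lemma toeplitz (c : nat -> nat -> R) (u : nat -> R) :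
  (forall n i, 0 <= c n i) -> (forall n, sum_f_R0 (c n) n <= 1) ->
  (forall i, is_lim_seq (fun n => c n i) 0) -> is_lim_seq u 0 ->
  is_lim_seq (fun n => sum_f_R0 (fun i => c n i * u i) n) 0.
Proof.
  intros Hc H1 Hz Hu.
  apply lim_eps; intros e He.
  destruct (proj1 (lim_eps _ _) Hu (e/2) ltac:(lra)) as [J HJ].
  assert (HL : is_lim_seq (fun n => sum_f_R0 (fun i => c n i * Rabs (u i)) J) 0).
  { replace 0 with (sum_f_R0 (fun i => 0 * Rabs (u i)) J)
      by (apply sum_zero; intros; ring).
    apply lim_sum with (F := fun n i => c n i * Rabs (u i)).
    intros i; apply is_lim_seq_mult'; [apply Hz|apply is_lim_seq_const]. }
  destruct (proj1 (lim_eps _ _) HL (e/2) ltac:(lra)) as [M HM].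
  exists (M + J)%nat; intros n Hn. specialize (HM n ltac:(lia)).
  rewrite Rminus_0_r in *.
  eapply Rle_lt_trans; [apply sum_abs|].
  assert (Ht : forall K, (J <= K)%nat ->
    sum_f_R0 (fun i => Rabs (c n i * u i)) K
    <= sum_f_R0 (fun i => c n i * Rabs (u i)) J + e/2 * sum_f_R0 (c n) K).
  { intros K HK; induction HK as [|K HK IH].
    - assert (0 <= sum_f_R0 (c n) J) by (apply cond_pos_sum; auto).
      rewrite (sum_eq _ (fun i => c n i * Rabs (u i))).
      + nra.
      + intros; rewrite Rabs_mult, (Rabs_pos_eq (c n i)); auto.
    - simpl. rewrite Rabs_mult, (Rabs_pos_eq (c n (S K))) by auto.
      specialize (HJ (S K) ltac:(lia)). rewrite Rminus_0_r in HJ.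
      specialize (Hc n (S K)). nra. }
  specialize (Ht n ltac:(lia)).
  pose proof (Rle_abs (sum_f_R0 (fun i => c n i * Rabs (u i)) J)).
  specialize (H1 n). nra.
Qed.

Definition delta0 (n : nat) : R := if Nat.eqb n 0 then 1 else 0.

Lemma sum_delta0 n : sum_f_R0 delta0 n = 1.
Proof.
  destruct n; [reflexivity|]. rewrite decomp_sum by lia.
  rewrite sum_zero; [unfold delta0; simpl; ring|]. intros; reflexivity.
Qed.

Lemma series_delta0 : is_series delta0 1.
Proof.
  apply series_lim, is_lim_seq_ext with (fun _ => 1); [|apply is_lim_seq_const].
  intros; symmetry; apply sum_delta0.
Qed.

Lemma conv_S (f g : nat -> R) n :
  conv f g (S n) = f O * g (S n) + conv (fun i => f (S i)) g n.
Proof.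
  unfold conv; rewrite decomp_sum by lia; simpl pred; f_equal.
Qed.

Lemma conv_ext (f f' g g' : nat -> R) n :
  (forall i, (i <= n)%nat -> f i = f' i) -> (forall i, (i <= n)%nat -> g i = g' i) ->
  conv f g n = conv f' g' n.
Proof.
  intros Hf Hg; apply sum_eq; intros; rewrite Hf, Hg by lia; reflexivity.
Qed.

Lemma conv_comm (f g : nat -> R) n : conv f g n = conv g f n.
Proof.
  unfold conv; rewrite <- sum_rev; apply sum_eq; intros i Hi.
  replace (n - (n - i))%nat with i by lia; ring.
Qed.

Lemma conv_plus_l (f g h : nat -> R) n :
  conv (fun i => f i + g i) h n = conv f h n + conv g h n.
Proof. unfold conv; rewrite <- plus_sum; apply sum_eq; intros; ring. Qed.

Lemma conv_scal_l c (f h : nat -> R) n :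
  conv (fun i => c * f i) h n = c * conv f h n.
Proof. unfold conv; rewrite <- sum_scal_l; apply sum_eq; intros; ring. Qed.

Lemma conv_plus_r (f g h : nat -> R) n :
  conv h (fun i => f i + g i) n = conv h f n + conv h g n.
Proof. rewrite 3!(conv_comm h); apply conv_plus_l. Qed.

Lemma conv_assoc (f g h : nat -> R) n :
  conv (conv f g) h n = conv f (conv g h) n.
Proof.
  revert f; induction n as [|n IH]; intros f.
  - unfold conv; simpl; ring.
  - rewrite !conv_S.
    rewrite (conv_ext _ (fun i => f O * g (S i) + conv (fun j => f (S j)) g i) h h)
      by (intros; (apply conv_S || reflexivity)).
    rewrite conv_plus_l, IH, conv_scal_l.
    unfold conv at 1; simpl; ring.
Qed.

Lemma conv_delta_l (f : nat -> R) n : conv delta0 f n = f n.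
Proof.
  destruct n.
  - unfold conv, delta0; simpl; ring.
  - rewrite conv_S; unfold delta0 at 1; simpl.
    replace (conv (fun i => delta0 (S i)) f n) with 0; [ring|].
    symmetry; apply sum_zero; intros; unfold delta0; simpl; ring.
Qed.

Lemma conv_geom r (f g : nat -> R) n :
  conv (fun i => f i * r ^ i) (fun i => g i * r ^ i) n = conv f g n * r ^ n.
Proof.
  unfold conv; rewrite Rmult_comm, <- sum_scal_l; apply sum_eq; intros i Hi.
  replace (r ^ n) with (r ^ i * r ^ (n - i)) by (rewrite <- pow_add; f_equal; lia).
  ring.
Qed.

(** Leibniz rule for the operator z d/dz, which multiplies the n-th coefficient by n. *)
Lemma conv_deriv (f g : nat -> R) n :
  INR n * conv f g n
  = conv (fun i => INR i * f i) g n + conv f (fun i => INR i * g i) n.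
Proof.
  unfold conv; rewrite <- sum_scal_l, <- plus_sum; apply sum_eq; intros i Hi.
  rewrite minus_INR by lia; ring.
Qed.

Lemma conv_nonneg (f g : nat -> R) n :
  (forall i, 0 <= f i) -> (forall i, 0 <= g i) -> 0 <= conv f g n.
Proof.
  intros Hf Hg; apply cond_pos_sum; intros; apply Rmult_le_pos; auto.
Qed.

Lemma sum_conv (f g : nat -> R) N :
  sum_f_R0 (conv f g) N = sum_f_R0 (fun i => f i * sum_f_R0 g (N - i)) N.
Proof.
  induction N as [|N IH]; [unfold conv; simpl; ring|].
  rewrite tech5, IH; unfold conv.
  rewrite (tech5 (fun i => f i * g (S N - i)%nat)).
  rewrite (tech5 (fun i => f i * sum_f_R0 g (S N - i))).
  rewrite Nat.sub_diag, <- Rplus_assoc, <- plus_sum; f_equal.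
  apply sum_eq; intros i Hi.
  replace (S N - i)%nat with (S (N - i)) by lia. rewrite tech5; ring.
Qed.

Lemma sum_conv_le (f g : nat -> R) N :
  (forall i, 0 <= f i) -> (forall i, 0 <= g i) ->
  sum_f_R0 (conv f g) N <= sum_f_R0 f N * sum_f_R0 g N.
Proof.
  intros Hf Hg; rewrite sum_conv, (Rmult_comm (sum_f_R0 f N)), <- sum_scal_l.
  apply sum_Rle; intros i Hi.
  rewrite (Rmult_comm _ (f i)); apply Rmult_le_compat_l; auto.
  apply sum_le_extend; [auto|lia].
Qed.

Lemma series_conv (f g : nat -> R) a b :
  (forall i, 0 <= f i) -> (forall i, 0 <= g i) ->
  is_series f a -> is_series g b -> is_series (conv f g) (a * b).
Proof. intros; now apply is_series_mult_pos. Qed.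

(* Both factors are split at n/2, so that the long factor keeps an index >= n/2. *)
Lemma conv_half (a b : nat -> R) n :
  conv a b n =
  sum_f_R0 (fun i => if (2 * i <=? n)%nat then a i * b (n - i)%nat else 0) n
  + sum_f_R0 (fun i => if (2 * i <? n)%nat then b i * a (n - i)%nat else 0) n.
Proof.
  rewrite <- (sum_rev (fun i => if (2 * i <? n)%nat then b i * a (n - i)%nat else 0)).
  rewrite <- plus_sum. apply sum_eq; intros i Hi.
  replace (n - (n - i))%nat with i by lia.
  destruct (Nat.leb_spec (2 * i) n); destruct (Nat.ltb_spec (2 * (n - i)) n);
    try lia; ring.
Qed.

(** * Sequences of order n^(-3/2) *)

(* [sqrt (n+1)], so that no division by 0 occurs at n = 0 *)
Definition rt (n : nat) : R := sqrt (INR (S n)).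

Lemma rt_pos n : 0 < rt n.
Proof. apply sqrt_lt_R0, lt_0_INR; lia. Qed.

Lemma rt_sqr n : rt n * rt n = INR n + 1.
Proof. unfold rt; rewrite sqrt_sqrt, S_INR; [reflexivity|apply pos_INR]. Qed.

Lemma rt_ge1 n : 1 <= rt n.
Proof.
  pose proof (rt_sqr n); pose proof (rt_pos n); pose proof (pos_INR n); nra.
Qed.

Lemma rt_le n m : (n <= m)%nat -> rt n <= rt m.
Proof. intros H; apply sqrt_le_1_alt, le_INR; lia. Qed.

Lemma rt_half i n : (2 * i <= n)%nat -> rt n <= 2 * rt (n - i).
Proof.
  intros H; pose proof (rt_sqr n); pose proof (rt_sqr (n - i)).
  pose proof (rt_pos n); pose proof (rt_pos (n - i)).
  assert (INR n <= 2 * INR (n - i)).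
  { change 2 with (INR 2); rewrite <- mult_INR; apply le_INR; lia. }
  nra.
Qed.

Lemma inv_rt_half p i n :
  (2 * i <= n)%nat -> / rt (n - i) ^ p <= 2 ^ p / rt n ^ p.
Proof.
  intros H; pose proof (rt_pos n); pose proof (rt_pos (n - i)).
  apply Rmult_le_reg_r with (rt n ^ p * rt (n - i) ^ p).
  { apply Rmult_lt_0_compat; now apply pow_lt. }
  field_simplify; try (apply pow_nonzero; lra).
  rewrite <- Rpow_mult_distr; apply pow_incr; split; [lra|].
  rewrite Rmult_comm; now apply rt_half.
Qed.

Lemma rt_infty : is_lim_seq rt p_infty.
Proof.
  apply is_lim_seq_spec; intros M; unfold rt.
  destruct (INR_unbounded (Rmax M 0 * Rmax M 0)) as [N HN].
  exists N; intros n Hn.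
  pose proof (rt_sqr n); pose proof (rt_pos n); unfold rt in *.
  apply le_INR in Hn. pose proof (Rmax_l M 0); pose proof (Rmax_r M 0).
  nra.
Qed.

Lemma inv_rt_lim : is_lim_seq (fun n => / rt n) 0.
Proof.
  replace (Finite 0) with (Rbar_inv p_infty) by reflexivity.
  apply is_lim_seq_inv; [apply rt_infty|discriminate].
Qed.

Lemma rt_ratio (i : nat) : is_lim_seq (fun n => rt n / rt (n - i)) 1.
Proof.
  apply is_lim_seq_ext_loc with (fun n => sqrt (1 + INR i * / rt (n - i) * / rt (n - i))).
  { exists i; intros n Hn; pose proof (rt_pos (n - i)).
    pose proof (rt_sqr (n - i)). pose proof (rt_sqr n). pose proof (pos_INR i).
    unfold rt at 3 4; rewrite <- sqrt_div_alt by (apply lt_0_INR; lia).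
    f_equal. rewrite !S_INR.
    replace (INR n) with (INR (n - i) + INR i) by (rewrite <- plus_INR; f_equal; lia).
    rewrite Rmult_assoc, <- Rinv_mult, H0. pose proof (pos_INR (n - i)).
    field; lra. }
  replace (Finite 1) with (Finite (sqrt (1 + INR i * 0 * 0))) by
    (rewrite !Rmult_0_r, Rplus_0_r; f_equal; apply sqrt_1).
  apply is_lim_seq_continuous with (f := sqrt)
    (u := fun n => 1 + INR i * / rt (n - i) * / rt (n - i)).
  { apply continuity_pt_sqrt; lra. }
  pose proof (lim_shift_down _ _ i inv_rt_lim) as H.
  apply is_lim_seq_plus'; [apply is_lim_seq_const|].
  repeat apply is_lim_seq_mult'; try exact H. apply is_lim_seq_const.
Qed.

Lemma lim_pow (u : nat -> R) (l : R) p :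
  is_lim_seq u l -> is_lim_seq (fun n => u n ^ p) (l ^ p).
Proof.
  intros H; induction p as [|p IH]; simpl; [apply is_lim_seq_const|].
  now apply is_lim_seq_mult'.
Qed.

Lemma lim_rt_shift (a : nat -> R) (L : R) p i :
  is_lim_seq (fun n => a n * rt n ^ p) L ->
  is_lim_seq (fun n => a (n - i)%nat * rt n ^ p) L.
Proof.
  intros H; apply lim_shift_down with (i := i) in H.
  apply is_lim_seq_ext with
    (fun n => a (n - i)%nat * rt (n - i) ^ p * (rt n / rt (n - i)) ^ p).
  { intros n; pose proof (rt_pos (n - i)).
    unfold Rdiv; rewrite Rpow_mult_distr, pow_inv. field.
    apply pow_nonzero; lra. }
  replace L with (L * 1 ^ p) by (rewrite pow1; ring).
  apply is_lim_seq_mult'; [exact H|].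
  apply lim_pow, rt_ratio.
Qed.

Lemma lim_rt_bound (a : nat -> R) (L : R) p :
  is_lim_seq (fun n => a n * rt n ^ p) L ->
  exists K, 0 < K /\ forall n, Rabs (a n) <= K / rt n ^ p.
Proof.
  intros H; destruct (lim_bounded _ _ H) as [K [HK Hb]].
  exists K; split; [exact HK|]; intros n; specialize (Hb n).
  pose proof (pow_lt _ p (rt_pos n)).
  rewrite Rabs_mult, (Rabs_pos_eq (rt n ^ p)) in Hb by lra.
  apply Rmult_le_reg_r with (rt n ^ p); [lra|].
  unfold Rdiv; rewrite Rmult_assoc, Rinv_l; lra.
Qed.

Lemma sum_inv_rt n : sum_f_R0 (fun i => / rt i) n <= 2 * rt n.
Proof.
  induction n as [|n IH].
  - simpl; pose proof (rt_ge1 0); pose proof (rt_pos 0).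
    apply Rmult_le_reg_r with (rt 0); [lra|]. rewrite Rinv_l by lra. nra.
  - rewrite tech5.
    pose proof (rt_sqr n); pose proof (rt_sqr (S n)); rewrite S_INR in *.
    pose proof (rt_pos n); pose proof (rt_pos (S n)).
    assert (/ rt (S n) <= 2 * rt (S n) - 2 * rt n); [|lra].
    apply Rmult_le_reg_r with (rt (S n)); [lra|]. rewrite Rinv_l by lra. nra.
Qed.

(** With x = [rt n], y = [rt (S n)] and y^2 - x^2 = 1, the right side is 2 / (x y (x + y)), and x <=
    y. This lets sums of n^(-3/2) telescope. *)
Lemma inv_rt3_le n : / rt (S n) ^ 3 <= 2 / rt n - 2 / rt (S n).
Proof.
  pose proof (rt_sqr n); pose proof (rt_sqr (S n)); rewrite S_INR in *.
  pose proof (rt_pos n); pose proof (rt_pos (S n)).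
  set (x := rt n) in *; set (y := rt (S n)) in *.
  assert (x <= y) by (apply rt_le; lia).
  replace (2 / x - 2 / y) with (2 * (y - x) / (x * y)) by (field; lra).
  assert (y - x = / (x + y)).
  { apply Rmult_eq_reg_r with (x + y); [|lra]. rewrite Rinv_l by lra. nra. }
  rewrite H4.
  replace (2 * / (x + y) / (x * y)) with (/ ((x + y) / 2 * (x * y))) by (field; lra).
  apply Rinv_le_contravar; [apply Rmult_lt_0_compat; nra|].
  nra.
Qed.

Lemma sum_inv_rt3 n : sum_f_R0 (fun i => / rt i ^ 3) n <= 3.
Proof.
  assert (sum_f_R0 (fun i => / rt i ^ 3) n <= 3 - 2 / rt n).
  { induction n as [|n IH].
    - simpl. replace (rt 0) with 1 by (unfold rt; simpl; now rewrite sqrt_1). lra.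
    - rewrite tech5. pose proof (inv_rt3_le n). lra. }
  pose proof (rt_pos n). assert (0 < 2 / rt n) by (apply Rdiv_lt_0_compat; lra). lra.
Qed.

Lemma summable_rt3 (a : nat -> R) K :
  (forall n, 0 <= a n <= K / rt n ^ 3) -> exists S, is_series a S.
Proof.
  intros H.
  destruct (ex_series_bounded a (K * 3)) as [l [Hl _]]; [intros; apply H| |now exists l].
  intros n. assert (0 <= K).
  { specialize (H 0%nat). pose proof (pow_lt _ 3 (rt_pos 0)).
    apply Rmult_le_reg_r with (/ rt 0 ^ 3); [now apply Rinv_0_lt_compat|].
    unfold Rdiv in H; lra. }
  apply Rle_trans with (K * sum_f_R0 (fun i => / rt i ^ 3) n).
  - rewrite <- sum_scal_l; apply sum_Rle; intros; apply H.
  - apply Rmult_le_compat_l; [lra|apply sum_inv_rt3].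
Qed.

(** The boolean [c] stands for either half of [conv_half], with <= or with <. Since i <= n/2, the
    factor [b (n - i)] is bounded by 2^p B / [rt n]^p, which gives the domination for [tannery]. *)
Lemma half_lim (c : nat -> nat -> bool) (a b : nat -> R) p (L S : R) :
  (forall n i, c n i = true -> (2 * i <= n)%nat) ->
  (forall n i, (2 * i < n)%nat -> c n i = true) ->
  (forall n, 0 <= a n) -> is_series a S ->
  is_lim_seq (fun n => b n * rt n ^ p) L ->
  is_lim_seq (fun n => sum_f_R0 (fun i => if c n i then a i * b (n - i)%nat else 0) n
      * rt n ^ p) (S * L).
Proof.
  intros Hc1 Hc2 Ha HS HL.
  destruct (lim_rt_bound _ _ _ HL) as [B [HB HbB]].
  apply is_lim_seq_ext with (fun n => sum_f_R0
     (fun i => if c n i then a i * (b (n - i)%nat * rt n ^ p) else 0) n).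
  { intros n; rewrite (Rmult_comm _ (rt n ^ p)), <- sum_scal_l; apply sum_eq; intros.
    destruct (c n i); ring. }
  apply tannery with (N := fun n => n)
    (F := fun n i => if c n i then a i * (b (n - i)%nat * rt n ^ p) else 0)
    (f := fun i => a i * L) (G := fun i => 2 ^ p * B * a i).
  - auto.
  - intros i. apply is_lim_seq_ext_loc with (fun n => a i * (b (n - i)%nat * rt n ^ p)).
    + exists (2 * i + 1)%nat; intros n Hn. rewrite Hc2 by lia; reflexivity.
    + apply is_lim_seq_mult'; [apply is_lim_seq_const|]. now apply lim_rt_shift.
  - intros n i. pose proof (pow_lt 2 p ltac:(lra)).
    destruct (c n i) eqn:E.
    + apply Hc1 in E. rewrite !Rabs_mult, (Rabs_pos_eq (a i)) by auto.
      pose proof (pow_lt _ p (rt_pos n)). rewrite (Rabs_pos_eq (rt n ^ p)) by lra.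
      rewrite (Rmult_comm (2 ^ p * B)); apply Rmult_le_compat_l; [auto|].
      apply Rle_trans with (B * (2 ^ p / rt n ^ p) * rt n ^ p).
      * apply Rmult_le_compat_r; [lra|]. eapply Rle_trans; [apply HbB|].
        unfold Rdiv at 1; apply Rmult_le_compat_l; [lra|now apply inv_rt_half].
      * apply Req_le; field. lra.
    + rewrite Rabs_R0. apply Rmult_le_pos; [|auto]. nra.
  - exists (2 ^ p * B * S). apply (is_series_scal (2 ^ p * B) a S HS).
  - apply is_series_scal_r with (c := L) (a := a) (l := S). exact HS.
Qed.

(** * Exponential and quasi-inverse *)

Lemma half_bound (c : nat -> nat -> bool) (a b : nat -> R) p B n :
  (forall n i, c n i = true -> (2 * i <= n)%nat) ->
  (forall i, 0 <= a i) -> (forall i, b i <= B / rt i ^ p) -> 0 <= B ->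
  sum_f_R0 (fun i => if c n i then a i * b (n - i)%nat else 0) n
  <= 2 ^ p * B * sum_f_R0 a n / rt n ^ p.
Proof.
  intros Hc Ha Hb HB.
  pose proof (pow_lt _ p (rt_pos n)). pose proof (pow_lt 2 p ltac:(lra)).
  replace (2 ^ p * B * sum_f_R0 a n / rt n ^ p)
    with (2 ^ p * B / rt n ^ p * sum_f_R0 a n) by (field; lra).
  rewrite <- sum_scal_l; apply sum_Rle; intros i Hi.
  assert (0 <= 2 ^ p * B / rt n ^ p).
  { apply Rdiv_le_0_compat; [nra|lra]. }
  specialize (Ha i). destruct (c n i) eqn:E; [|nra].
  rewrite (Rmult_comm (_ / _)); apply Rmult_le_compat_l; [auto|].
  eapply Rle_trans; [apply Hb|].
  apply Rle_trans with (B * (2 ^ p / rt n ^ p)).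
  - unfold Rdiv at 1; apply Rmult_le_compat_l; [auto|apply inv_rt_half; eauto].
  - lra.
Qed.

(** Principle of one long index: one factor keeps a bounded index and contributes its sum, the other
    has an index close to n and contributes its limit. *)
Lemma conv_lim (a b : nat -> R) p (La Lb A B : R) :
  (forall n, 0 <= a n) -> (forall n, 0 <= b n) ->
  is_series a A -> is_series b B ->
  is_lim_seq (fun n => a n * rt n ^ p) La ->
  is_lim_seq (fun n => b n * rt n ^ p) Lb ->
  is_lim_seq (fun n => conv a b n * rt n ^ p) (A * Lb + B * La).
Proof.
  intros Ha Hb HA HB HLa HLb.
  apply is_lim_seq_ext with (fun n =>
   sum_f_R0 (fun i => if (2 * i <=? n)%nat then a i * b (n - i)%nat else 0) n * rt n ^ p
  + sum_f_R0 (fun i => if (2 * i <? n)%nat then b i * a (n - i)%nat else 0) n * rt n ^ p).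
  { intros n; rewrite conv_half; ring. }
  apply is_lim_seq_plus'.
  - apply half_lim with (c := fun n i => (2 * i <=? n)%nat); auto; intros n i H.
    + now apply Nat.leb_le.
    + apply Nat.leb_le; lia.
  - apply half_lim with (c := fun n i => (2 * i <? n)%nat); auto; intros n i H.
    + apply Nat.ltb_lt in H; lia.
    + now apply Nat.ltb_lt.
Qed.

Lemma conv_half_bound (a b : nat -> R) p p' A B n :
  (forall i, 0 <= a i <= A / rt i ^ p) -> (forall i, 0 <= b i <= B / rt i ^ p') ->
  0 <= A -> 0 <= B ->
  conv a b n <= 2 ^ p' * B * sum_f_R0 a n / rt n ^ p' + 2 ^ p * A * sum_f_R0 b n / rt n ^ p.
Proof.
  intros Ha Hb HA HB; rewrite conv_half; apply Rplus_le_compat.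
  - apply half_bound with (c := fun n i => (2 * i <=? n)%nat);
      try (intros; first [apply Ha|apply Hb]); auto.
    intros m i H; now apply Nat.leb_le.
  - apply half_bound with (c := fun n i => (2 * i <? n)%nat);
      try (intros; first [apply Ha|apply Hb]); auto.
    intros m i H; apply Nat.ltb_lt in H; lia.
Qed.

Lemma conv_bound (a b : nat -> R) p A B SA SB :
  (forall i, 0 <= a i <= A / rt i ^ p) -> (forall i, 0 <= b i <= B / rt i ^ p) ->
  0 <= A -> 0 <= B ->
  (forall n, sum_f_R0 a n <= SA) -> (forall n, sum_f_R0 b n <= SB) ->
  forall n, 0 <= conv a b n <= 2 ^ p * (B * SA + A * SB) / rt n ^ p.
Proof.
  intros Ha Hb HA HB HSA HSB n; split.
  { apply conv_nonneg; intros; [apply Ha|apply Hb]. }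
  eapply Rle_trans; [now apply conv_half_bound with (A := A) (B := B) (p := p) (p' := p)|].
  pose proof (pow_lt _ p (rt_pos n)). pose proof (pow_lt 2 p ltac:(lra)).
  unfold Rdiv; rewrite <- Rmult_plus_distr_r.
  apply Rmult_le_compat_r; [left; now apply Rinv_0_lt_compat|].
  assert (B * sum_f_R0 a n <= B * SA) by now apply Rmult_le_compat_l.
  assert (A * sum_f_R0 b n <= A * SB) by now apply Rmult_le_compat_l. nra.
Qed.

Lemma sum_bound_rt1 (b : nat -> R) B n :
  (forall i, b i <= B / rt i) -> 0 <= B -> sum_f_R0 b n <= 2 * B * rt n.
Proof.
  intros H HB. apply Rle_trans with (B * sum_f_R0 (fun i => / rt i) n).
  - rewrite <- sum_scal_l; apply sum_Rle; intros; apply H.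
  - pose proof (sum_inv_rt n). nra.
Qed.

(* One differentiation step [n y_n = (b * h)_n] with [b = O(n^(-1/2))] gains a factor
   n^(-1/2) on the decay of [h], up to the decay n^(-3/2). *)
Lemma deriv_step (y b h : nat -> R) p B H SH :
  (p <= 2)%nat -> (forall n, INR n * y n = conv b h n) ->
  (forall n, 0 <= b n <= B / rt n) -> (forall n, 0 <= h n <= H / rt n ^ p) ->
  0 <= B -> 0 <= H -> (forall n, sum_f_R0 h n <= SH) ->
  exists Y, 0 <= Y /\ forall n, y n <= Y / rt n ^ (S p).
Proof.
  intros Hp Hy Hb Hh HB HH HS.
  set (K := 2 ^ p * H * (2 * B) + 2 * B * SH).
  assert (HSH : 0 <= SH).
  { eapply Rle_trans; [|apply (HS 0%nat)]. apply (Hh 0%nat). }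
  pose proof (pow_lt 2 p ltac:(lra)) as H2p.
  assert (HK : 0 <= K) by (unfold K; repeat (apply Rplus_le_le_0_compat || apply Rmult_le_pos); lra).
  (* The factor 2 comes from n + 1 <= 2 n for n >= 1; [Rabs (y 0)] covers n = 0, about which the
     differential relation says nothing. *)
  exists (2 * K + Rabs (y 0%nat)); split; [pose proof (Rabs_pos (y 0%nat)); lra|].
  intros n. pose proof (rt_pos n) as Hr. pose proof (pow_lt _ p Hr) as Hrp.
  pose proof (pow_lt _ (S p) Hr) as HrS.
  destruct n as [|n].
  { replace (rt 0) with 1 in * by (unfold rt; simpl; now rewrite sqrt_1).
    rewrite pow1. pose proof (Rle_abs (y 0%nat)). lra. }
  assert (Hc : conv b h (S n) <= K * rt (S n) / rt (S n) ^ p).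
  { eapply Rle_trans.
    { apply conv_half_bound with (p := 1%nat) (p' := p) (A := B) (B := H); auto.
      intros i; rewrite pow_1; apply Hb. }
    rewrite !pow_1.
    assert (S1 : sum_f_R0 b (S n) <= 2 * B * rt (S n)) by (apply sum_bound_rt1; [intros; apply Hb|lra]).
    specialize (HS (S n)).
    assert (Hrr : / rt (S n) <= rt (S n) / rt (S n) ^ p).
    { apply Rmult_le_reg_r with (rt (S n) ^ p * rt (S n)); [nra|].
      field_simplify; [|lra|lra]. apply Rle_pow; [apply rt_ge1|lia]. }
    assert (0 <= / rt (S n) ^ p) by (left; now apply Rinv_0_lt_compat).
    assert (0 <= / rt (S n)) by (left; now apply Rinv_0_lt_compat).
    assert (2 ^ p * H * sum_f_R0 b (S n) / rt (S n) ^ p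
            <= 2 ^ p * H * (2 * B) * (rt (S n) / rt (S n) ^ p)).
    { replace (2 ^ p * H * (2 * B) * (rt (S n) / rt (S n) ^ p)) with
       (2 ^ p * H * (2 * B * rt (S n)) / rt (S n) ^ p) by (unfold Rdiv; ring).
      apply Rmult_le_compat_r; [lra|]. apply Rmult_le_compat_l; [nra|lra]. }
    assert (2 * B * sum_f_R0 h (S n) / rt (S n) <= 2 * B * SH * (rt (S n) / rt (S n) ^ p)).
    { apply Rle_trans with (2 * B * SH * / rt (S n)).
      - apply Rmult_le_compat_r; [lra|]. apply Rmult_le_compat_l; lra.
      - apply Rmult_le_compat_l; [nra|lra]. }
    unfold K; replace ((2 ^ p * H * (2 * B) + 2 * B * SH) * rt (S n) / rt (S n) ^ p)
      with (2 ^ p * H * (2 * B) * (rt (S n) / rt (S n) ^ p)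
            + 2 * B * SH * (rt (S n) / rt (S n) ^ p)) by (unfold Rdiv; ring).
    lra. }
  rewrite <- Hy in Hc. pose proof (rt_sqr (S n)) as Hq.
  assert (HI : 1 <= INR (S n)) by (rewrite S_INR; pose proof (pos_INR n); lra).
  assert (Hle : y (S n) <= 2 * K / rt (S n) ^ S p).
  { destruct (Rle_dec (y (S n)) 0) as [H0|H0].
    { apply Rle_trans with 0; [auto|]. apply Rdiv_le_0_compat; [lra|auto]. }
    assert (rt (S n) * rt (S n) * y (S n) <= 2 * (K * rt (S n) / rt (S n) ^ p)) by nra.
    apply Rmult_le_reg_l with (rt (S n) * rt (S n)); [nra|].
    eapply Rle_trans; [eassumption|]. apply Req_le; simpl; field; lra. }
  eapply Rle_trans; [exact Hle|]. unfold Rdiv; apply Rmult_le_compat_r.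
  - left; now apply Rinv_0_lt_compat.
  - pose proof (Rabs_pos (y 0%nat)); lra.
Qed.

Lemma lim_INR_ratio : is_lim_seq (fun n => rt n ^ 2 / INR n) 1.
Proof.
  apply is_lim_seq_incr_1.
  apply is_lim_seq_ext with (fun n => 1 + / rt n * / rt n).
  { intros n; pose proof (rt_sqr n); pose proof (rt_sqr (S n)).
    pose proof (pos_INR n). rewrite <- Rinv_mult, H.
    simpl pow; rewrite Rmult_1_r, H0, S_INR. field; lra. }
  replace (Finite 1) with (Finite (1 + 0 * 0)) by (f_equal; ring).
  apply is_lim_seq_plus'; [apply is_lim_seq_const|].
  apply is_lim_seq_mult'; apply inv_rt_lim.
Qed.

(** Where [b] has the long index, [h] contributes its whole sum and leaves [SH * beta] n^(-1/2).
    Where [h] has the long index, the half is at most of order n^(1/2) n^(-3/2) and vanishes against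
    n^(-1/2). Division by n then produces n^(-3/2). *)
Lemma deriv_lim (y b h : nat -> R) (beta H SH : R) :
  (forall n, INR n * y n = conv b h n) ->
  (forall n, 0 <= b n) -> is_lim_seq (fun n => b n * rt n) beta ->
  (forall n, 0 <= h n <= H / rt n ^ 3) -> 0 <= H -> is_series h SH ->
  is_lim_seq (fun n => y n * rt n ^ 3) (SH * beta).
Proof.
  intros Hy Hb Hbl Hh HH HS.
  assert (Hb1 : is_lim_seq (fun n => b n * rt n ^ 1) beta).
  { eapply is_lim_seq_ext; [|exact Hbl]. intros; simpl; ring. }
  destruct (lim_rt_bound _ _ _ Hb1) as [B [HB HbB]].
  assert (HbB' : forall n, b n <= B / rt n).
  { intros n; specialize (HbB n); rewrite pow_1 in HbB.
    pose proof (Rle_abs (b n)); lra. }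
  apply is_lim_seq_ext_loc with (fun n => (rt n ^ 2 / INR n) *
   (sum_f_R0 (fun i => if (2 * i <=? n)%nat then b i * h (n - i)%nat else 0) n * rt n
  + sum_f_R0 (fun i => if (2 * i <? n)%nat then h i * b (n - i)%nat else 0) n * rt n ^ 1)).
  { exists 1%nat; intros n Hn.
    rewrite pow_1, <- Rmult_plus_distr_r, <- conv_half, <- Hy.
    assert (0 < INR n) by (apply lt_0_INR; lia). field; lra. }
  replace (SH * beta) with (1 * (0 + SH * beta)) by ring.
  apply is_lim_seq_mult'; [apply lim_INR_ratio|].
  apply is_lim_seq_plus'.
  - apply is_lim_seq_le_le with (u := fun _ => 0) (w := fun n => 16 * B * H * / rt n).
    + intros n. pose proof (rt_pos n). split.
      * apply Rmult_le_pos; [|lra]. apply sum_nonneg; intros.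
        destruct (_ <=? _)%nat; [|lra]. apply Rmult_le_pos; auto; apply Hh.
      * apply Rle_trans with (2 ^ 3 * H * sum_f_R0 b n / rt n ^ 3 * rt n).
        { apply Rmult_le_compat_r; [lra|].
          apply half_bound with (c := fun n i => (2 * i <=? n)%nat); auto.
          - intros m i Hm; now apply Nat.leb_le.
          - intros; apply Hh. }
        pose proof (sum_bound_rt1 b B n HbB' ltac:(lra)).
        apply Rle_trans with (2 ^ 3 * H * (2 * B * rt n) / rt n ^ 3 * rt n).
        { unfold Rdiv; repeat apply Rmult_le_compat_r; try lra.
          - left; apply Rinv_0_lt_compat, pow_lt; auto.
          - nra. }
        apply Req_le; field; lra.
    + apply is_lim_seq_const.
    + replace (Finite 0) with (Finite (16 * B * H * 0)) by (f_equal; ring).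
      apply is_lim_seq_mult'; [apply is_lim_seq_const|apply inv_rt_lim].
  - apply half_lim with (c := fun n i => (2 * i <? n)%nat); auto.
    + intros n i Hi; apply Nat.ltb_lt in Hi; lia.
    + intros n i Hi; now apply Nat.ltb_lt.
    + apply Hh.
Qed.

Lemma is_derive_psum (f : nat -> R) N x :
  is_derive (fun y => sum_f_R0 (fun n => f n * y ^ n) N) x
    (sum_f_R0 (fun n => INR n * f n * x ^ pred n) N).
Proof.
  induction N as [|N IH]; simpl sum_f_R0.
  - auto_derive; [trivial|simpl; ring].
  - apply (is_derive_plus (V := R_NormedModule)); [exact IH|].
    auto_derive; [trivial|].
    destruct N as [|N]; [simpl; ring|].
    change (pred (S N)) with N; change (x ^ S N) with (x * x ^ N); ring.
Qed.

(* The polynomials S = sum_(n<=N) m_n x^n and A = sum_(n<=N) (b_n/n) x^n satisfy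
   S' <= A' S coefficientwise, so S exp(-A) is nonincreasing on [0,1]. *)
Lemma exp_partial_sum (m b : nat -> R) N :
  (forall n, 0 <= m n) -> (forall n, 0 <= b n) -> b O = 0 -> m O = 1 ->
  (forall n, INR n * m n = conv b m n) ->
  sum_f_R0 m N <= exp (sum_f_R0 (fun n => b n / INR n) N).
Proof.
  intros Hm Hb Hb0 Hm0 Hmb.
  set (Sf := fun x => sum_f_R0 (fun n => m n * x ^ n) N).
  set (Af := fun x => sum_f_R0 (fun n => b n / INR n * x ^ n) N).
  set (f := fun x => Sf x * exp (- Af x)).
  set (Sd := fun x => sum_f_R0 (fun n => INR n * m n * x ^ pred n) N).
  set (Ad := fun x => sum_f_R0 (fun n => INR n * (b n / INR n) * x ^ pred n) N).
  assert (HdS : forall x, is_derive Sf x (Sd x)) by (intros; apply is_derive_psum).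
  assert (HdA : forall x, is_derive Af x (Ad x)) by (intros; apply is_derive_psum).
  assert (Hd : forall x, is_derive f x ((Sd x - Ad x * Sf x) * exp (- Af x))).
  { intros x; unfold f. auto_derive.
    - split; [exists (Sd x); apply HdS|split; [exists (Ad x); apply HdA|trivial]].
    - rewrite (is_derive_unique _ _ _ (HdS x) : Derive (fun x => Sf x) x = _).
      rewrite (is_derive_unique _ _ _ (HdA x) : Derive (fun x => Af x) x = _). ring. }
  assert (Hneg : forall x, 0 < x -> Sd x - Ad x * Sf x <= 0).
  { intros x Hx. apply Rmult_le_reg_l with x; [auto|].
    assert (E1 : x * Sd x = sum_f_R0 (conv (fun n => b n * x ^ n) (fun n => m n * x ^ n)) N).
    { unfold Sd; rewrite <- sum_scal_l; apply sum_eq; intros n Hn.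
      rewrite conv_geom, <- Hmb. destruct n; simpl; ring. }
    assert (E2 : x * Ad x = sum_f_R0 (fun n => b n * x ^ n) N).
    { unfold Ad; rewrite <- sum_scal_l; apply sum_eq; intros n Hn.
      destruct n; [simpl; rewrite Hb0; ring|].
      change (x ^ S n) with (x * x ^ n); simpl pred.
      field. apply not_0_INR; lia. }
    rewrite Rmult_minus_distr_l, <- Rmult_assoc, E1, E2.
    assert (sum_f_R0 (conv (fun n => b n * x ^ n) (fun n => m n * x ^ n)) N
      <= sum_f_R0 (fun n => b n * x ^ n) N * Sf x).
    { apply sum_conv_le; intros; apply Rmult_le_pos; auto; apply pow_le; lra. }
    lra. }
  assert (Hmvt : f 1 <= f 0).
  { destruct (MVT_cor2 f (fun x => (Sd x - Ad x * Sf x) * exp (- Af x)) 0 1 Rlt_0_1)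
      as [c [Hc1 Hc2]].
    - intros; apply is_derive_Reals, Hd.
    - pose proof (Hneg c ltac:(lra)). pose proof (exp_pos (- Af c)). nra. }
  assert (E0 : forall g, sum_f_R0 (fun n => g n * 0 ^ n) N = g O).
  { intros g. destruct N; [simpl; ring|].
    rewrite decomp_sum by lia. rewrite sum_zero; [simpl; ring|]. intros; simpl; ring. }
  assert (E1 : forall g, sum_f_R0 (fun n => g n * 1 ^ n) N = sum_f_R0 g N).
  { intros g; apply sum_eq; intros; rewrite pow1; ring. }
  unfold f, Sf, Af in Hmvt; rewrite !E0, !E1, Hm0, Hb0 in Hmvt.
  replace (- (0 / INR 0)) with 0 in Hmvt by (unfold Rdiv; ring).
  rewrite exp_0, exp_Ropp in Hmvt.
  pose proof (exp_pos (sum_f_R0 (fun n => b n / INR n) N)).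
  apply Rmult_le_reg_r with (/ exp (sum_f_R0 (fun n => b n / INR n) N)).
  - now apply Rinv_0_lt_compat.
  - rewrite Rinv_r; lra.
Qed.

(** Three rounds of [deriv_step] lead from boundedness to n^(-3/2). The last hypothesis passes each
    new bound on [y] to [h]; it serves with h = y for the exponential and h = y * y for the
    quasi-inverse. *)
Lemma deriv_bootstrap (y b : nat -> R) (h : nat -> R) B Y H SH :
  (forall n, INR n * y n = conv b h n) -> (forall n, 0 <= b n <= B / rt n) -> 0 <= B ->
  (forall n, sum_f_R0 h n <= SH) -> 0 <= Y -> (forall n, y n <= Y) -> 0 <= H ->
  (forall p X, 0 <= X -> (forall n, y n <= X / rt n ^ p) ->
     forall n, 0 <= h n <= 2 ^ p * (H * X) / rt n ^ p) ->
  exists X, 0 <= X /\ forall n, y n <= X / rt n ^ 3.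
Proof.
  intros Hy Hb HB HS HY0 HY HH Hh.
  assert (Hstep : forall p X, (p <= 2)%nat -> 0 <= X -> (forall n, y n <= X / rt n ^ p) ->
     exists X', 0 <= X' /\ forall n, y n <= X' / rt n ^ (S p)).
  { intros p X Hp HX HyX. apply (deriv_step y b h p B (2 ^ p * (H * X)) SH); auto.
    repeat apply Rmult_le_pos; try lra. apply pow_le; lra. }
  destruct (Hstep 0%nat Y) as [Y1 [HY1 Hm1]]; [lia|lra| |].
  { intros n; simpl. specialize (HY n); lra. }
  destruct (Hstep 1%nat Y1) as [Y2 [HY2 Hm2]]; [lia|lra|auto|].
  apply (Hstep 2%nat Y2); [lia|lra|auto].
Qed.

(** The relation between [m] and [b] is z M' = z A' M for M = exp A with A = sum b_n z^n / n. The
    coefficients b_n / n are of order n^(-3/2), so A, and with it M, converges at z = 1; [deriv_lim]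
    then supplies the limit. *)
Lemma exp_closure (m b : nat -> R) (beta K : R) :
  (forall n, 0 <= m n <= K) -> (forall n, 0 <= b n) -> b O = 0 -> m O = 1 ->
  (forall n, INR n * m n = conv b m n) ->
  is_lim_seq (fun n => b n * rt n) beta ->
  exists S, 1 <= S /\ is_series m S /\ is_lim_seq (fun n => m n * rt n ^ 3) (S * beta).
Proof.
  intros Hm Hb Hb0 Hm0 Hmb Hbl.
  assert (Hb1 : is_lim_seq (fun n => b n * rt n ^ 1) beta).
  { eapply is_lim_seq_ext; [|exact Hbl]. intros; simpl; ring. }
  destruct (lim_rt_bound _ _ _ Hb1) as [B [HB HbB]].
  assert (HbB' : forall n, 0 <= b n <= B / rt n).
  { intros n; specialize (HbB n); rewrite pow_1 in HbB.
    pose proof (Rle_abs (b n)). specialize (Hb n); lra. }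
  destruct (ex_series_bounded m (exp (2 * B * 3))) as [S [HS _]].
  { intros; apply Hm. }
  { intros n; eapply Rle_trans; [apply exp_partial_sum; auto; intros; apply Hm|].
    assert (Hsum : sum_f_R0 (fun n => b n / INR n) n <= 2 * B * 3).
    { apply Rle_trans with (2 * B * sum_f_R0 (fun i => / rt i ^ 3) n).
      - rewrite <- sum_scal_l; apply sum_Rle; intros i Hi.
        pose proof (rt_pos i). pose proof (rt_sqr i).
        destruct i as [|i].
        + rewrite Hb0; unfold Rdiv; rewrite Rmult_0_l.
          apply Rmult_le_pos; [lra|]. left; apply Rinv_0_lt_compat, pow_lt; auto.
        + assert (1 <= INR (S i)) by (rewrite S_INR; pose proof (pos_INR i); lra).
          apply Rmult_le_reg_r with (INR (S i) * rt (S i) ^ 3).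
          { apply Rmult_lt_0_compat; [lra|now apply pow_lt]. }
          field_simplify; [|lra|lra].
          apply Rle_trans with (B / rt (S i) * rt (S i) ^ 3).
          * rewrite Rmult_comm, (Rmult_comm (B / _)). apply Rmult_le_compat_l; [apply pow_le; lra|apply HbB'].
          * replace (B / rt (S i) * rt (S i) ^ 3) with (B * (rt (S i) * rt (S i))) by (field; lra).
            nra.
      - apply Rmult_le_compat_l; [lra|apply sum_inv_rt3]. }
    destruct Hsum as [Hs|Hs]; [left; now apply exp_increasing|right; now rewrite Hs]. }
  assert (HSn : forall n, sum_f_R0 m n <= S).
  { intros n; apply sum_le_series; [intros; apply Hm|exact HS]. }
  assert (HK : 0 <= K) by (eapply Rle_trans; apply (Hm 0%nat)).
  destruct (deriv_bootstrap m b m B K 1 S) as [Y [HY HmY]]; auto; try lra.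
  { intros n; apply Hm. }
  { intros p X HX HmX n; split; [apply Hm|]. eapply Rle_trans; [apply HmX|].
    unfold Rdiv; apply Rmult_le_compat_r.
    - left; apply Rinv_0_lt_compat, pow_lt, rt_pos.
    - pose proof (pow_R1_Rle 2 p ltac:(lra)). nra. }
  exists S; split; [|split; [exact HS|]].
  - rewrite <- Hm0. exact (HSn 0%nat).
  - apply deriv_lim with (b := b) (h := m) (H := Y); auto.
    intros n; split; [apply Hm|apply HmY].
Qed.

Lemma inverse_bound (q d : nat -> R) (Q : R) :
  (forall n, 0 <= q n) -> (forall n, 0 <= d n) ->
  (forall n, d n = delta0 n + conv q d n) -> is_series q Q -> Q < 1 ->
  is_series d (/ (1 - Q)).
Proof.
  intros Hq Hd Hdq HQ HQ1.
  assert (HB : forall n, sum_f_R0 d n <= / (1 - Q)).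
  { intros n. assert (sum_f_R0 d n <= 1 + Q * sum_f_R0 d n).
    { rewrite (sum_eq d _ n (fun i _ => Hdq i)) at 1. rewrite plus_sum, sum_delta0.
      apply Rplus_le_compat_l. eapply Rle_trans; [now apply sum_conv_le|].
      apply Rmult_le_compat_r; [now apply cond_pos_sum|now apply sum_le_series]. }
    apply Rmult_le_reg_l with (1 - Q); [lra|]. rewrite Rinv_r; lra. }
  destruct (ex_series_bounded d _ Hd HB) as [D [HD _]].
  assert (E : is_series (fun n => delta0 n + conv q d n) (1 + Q * D)).
  { apply (is_series_plus (V := R_NormedModule)); [apply series_delta0|now apply series_conv]. }
  apply is_series_ext with (b := d) in E; [|intros; symmetry; apply Hdq].
  apply is_series_unique in E; pose proof (is_series_unique _ _ HD) as E'.
  replace (/ (1 - Q)) with D; [exact HD|].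
  apply Rmult_eq_reg_l with (1 - Q); [|lra]. rewrite Rinv_r; lra.
Qed.

(** Differentiating D = 1 + Q D gives D' = Q' D + Q D'. Multiplying by D ([E2]) and replacing D by 1
    + Q D on the left ([E3]) cancels Q D D' and leaves D' = Q' D^2, with no division by 1 - Q. *)
Lemma inverse_deriv (q d : nat -> R) :
  (forall n, d n = delta0 n + conv q d n) ->
  forall n, INR n * d n = conv (conv (fun i => INR i * q i) d) d n.
Proof.
  intros Hdq n. set (q' := fun i => INR i * q i).
  set (d' := fun i => INR i * d i).
  assert (E1 : forall n, d' n = conv q' d n + conv q d' n).
  { intros k; unfold d' at 1. rewrite Hdq, Rmult_plus_distr_l, conv_deriv.
    unfold delta0; destruct k; simpl; fold q' d'; ring. }
  assert (E2 : conv d d' n = conv d (conv q' d) n + conv d (conv q d') n).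
  { rewrite <- conv_plus_r; apply conv_ext; auto. }
  assert (E3 : conv d d' n = d' n + conv (conv q d) d' n).
  { rewrite <- (conv_delta_l d' n), <- conv_plus_l; apply conv_ext; auto. }
  rewrite <- (conv_assoc d q d') in E2.
  rewrite (conv_ext (conv q d) (conv d q) d' d') in E3 by (intros; try apply conv_comm; reflexivity).
  change (INR n * d n) with (d' n). rewrite (conv_comm d (conv q' d)) in E2. lra.
Qed.

(** In z D' = z Q' D^2 the sequence n q_n is of order n^(-1/2), and d * d has the sum (1 - Q)^(-2),
    which is the factor in the limit. *)
Lemma inverse_closure (q d : nat -> R) (Q lam : R) :
  (forall n, 0 <= q n) -> (forall n, 0 <= d n) ->
  (forall n, d n = delta0 n + conv q d n) -> is_series q Q -> Q < 1 ->
  is_lim_seq (fun n => q n * rt n ^ 3) lam ->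
  is_lim_seq (fun n => d n * rt n ^ 3) (lam / (1 - Q) ^ 2).
Proof.
  intros Hq Hd Hdq HQ HQ1 Hl.
  pose proof (inverse_bound q d Q Hq Hd Hdq HQ HQ1) as HD. set (D := / (1 - Q)) in *.
  assert (HDn : forall n, sum_f_R0 d n <= D) by (intros; now apply sum_le_series).
  assert (Hh := series_conv d d D D Hd Hd HD HD).
  assert (Hb : is_lim_seq (fun n => INR n * q n * rt n) lam).
  { apply is_lim_seq_ext_loc with (fun n => q n * rt n ^ 3 * / (rt n ^ 2 / INR n)).
    { exists 1%nat; intros n Hn. assert (0 < INR n) by (apply lt_0_INR; lia).
      pose proof (rt_pos n). field; lra. }
    replace (Finite lam) with (Finite (lam * / 1)) by (f_equal; field).
    apply is_lim_seq_mult'; [exact Hl|].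
    apply (is_lim_seq_inv _ 1); [apply lim_INR_ratio|]. intros E; inversion E; lra. }
  assert (Hder : forall n, INR n * d n = conv (fun i => INR i * q i) (conv d d) n).
  { intros n; rewrite inverse_deriv with (q := q) by auto. apply conv_assoc. }
  assert (Hb1 : is_lim_seq (fun n => INR n * q n * rt n ^ 1) lam).
  { eapply is_lim_seq_ext; [|exact Hb]. intros; simpl; ring. }
  destruct (lim_rt_bound _ _ _ Hb1) as [B [HB HbB]].
  assert (HbB' : forall n, 0 <= INR n * q n <= B / rt n).
  { intros n; specialize (HbB n); rewrite pow_1 in HbB.
    pose proof (Rle_abs (INR n * q n)). specialize (Hq n); pose proof (pos_INR n).
    split; [now apply Rmult_le_pos|lra]. }
  assert (HD0 : 0 <= D) by (eapply Rle_trans; [apply (Hd 0%nat)|apply (HDn 0%nat)]).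
  assert (Hdd : forall p X, 0 <= X -> (forall n, d n <= X / rt n ^ p) ->
     forall n, 0 <= conv d d n <= 2 ^ p * (2 * D * X) / rt n ^ p).
  { intros p X HX HdX. replace (2 * D * X) with (X * D + X * D) by ring. apply conv_bound; auto. }
  destruct (deriv_bootstrap d (fun i => INR i * q i) (conv d d) B D (2 * D) (D * D))
    as [Y [HY HdY]]; auto; try lra.
  { intros n; apply sum_le_series; [|exact Hh]. intros; now apply conv_nonneg. }
  { intros n; eapply Rle_trans; [|apply (HDn n)]. now apply sum_term_le. }
  replace (lam / (1 - Q) ^ 2) with (D * D * lam) by (unfold D; field; lra).
  apply deriv_lim with (b := fun i => INR i * q i) (h := conv d d)
    (H := 2 ^ 3 * (2 * D * Y)); auto.
  - apply HbB'.
  - nra.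
Qed.

(** * Renewal sequences *)

Lemma sum_restrict (f : nat -> R) m n :
  (m <= n)%nat -> sum_f_R0 (fun i => if (i <=? m)%nat then f i else 0) n = sum_f_R0 f m.
Proof.
  intros H. rewrite (sum_extend_zero _ m n); [|intros i Hi|exact H].
  - apply sum_eq; intros i Hi. apply Nat.leb_le in Hi; now rewrite Hi.
  - apply Nat.leb_gt in Hi; now rewrite Hi.
Qed.

Lemma sum_single (f : nat -> R) j n :
  (j <= n)%nat -> sum_f_R0 (fun i => if (i =? j)%nat then f i else 0) n = f j.
Proof.
  intros H; induction H.
  - destruct j; [reflexivity|]. rewrite tech5, Nat.eqb_refl, sum_zero; [ring|].
    intros i Hi. replace (i =? S j)%nat with false; [reflexivity|].
    symmetry; apply Nat.eqb_neq; lia.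
  - rewrite tech5, IHle. replace (S m =? j)%nat with false; [ring|].
    symmetry; apply Nat.eqb_neq; lia.
Qed.

Lemma finite_pos_min (q : nat -> R) j N :
  (forall k, (k <= N)%nat -> 0 < q (j + k)%nat) ->
  exists m, 0 < m /\ forall k, (k <= N)%nat -> m <= q (j + k)%nat.
Proof.
  induction N as [|N IH]; intros H.
  - exists (q (j + 0)%nat); split; [apply H; lia|]. intros k Hk.
    replace k with 0%nat by lia; lra.
  - destruct IH as [m [Hm Hm']]; [intros; apply H; lia|].
    exists (Rmin m (q (j + S N)%nat)); split; [apply Rmin_glb_lt; [auto|apply H; lia]|].
    intros k Hk. destruct (Nat.eq_dec k (S N)) as [->|].
    + apply Rmin_r.
    + eapply Rle_trans; [apply Rmin_l|apply Hm'; lia].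
Qed.

(* If e_n > L - eps is nearly extremal, then e_n is an average of the e_(n-j), so all the
   e_(n-j) with j in a fixed window of positive weights are nearly extremal too. *)
Lemma averaging_limsup (q e s : nat -> R) (j0 n0 : nat) (s0 : R) :
  (forall n, 0 <= q n) -> is_series q 1 ->
  (forall j, (j0 <= j)%nat -> 0 < q j) ->
  (forall n, Rabs (e n) <= 1) ->
  (forall n, (n0 <= n)%nat -> e n = conv q e n) ->
  (forall n, e (S n) = s (S n) - s n) -> (forall n, Rabs (s n) <= s0) ->
  forall eps, 0 < eps -> exists M, forall n, (M <= n)%nat -> e n < eps.
Proof.
  intros Hq HQ Hpos He Hconv Hs Hsb eps Heps.
  destruct (ex_LimSup_seq e) as [[L| |] HL].
  - assert (HL0 : L <= 0).
    2:{ destruct (HL (mkposreal eps Heps)) as [_ [M HM]]. exists M; intros n Hn.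
        specialize (HM n Hn); simpl in HM; lra. }
    apply Rnot_lt_le; intros HLp.
    (* A run of N + 1 values of [e] above L/2 would add up to more than 2 [s0], although it
       telescopes to a difference of two values of [s]. *)
    destruct (INR_unbounded (2 * (2 * s0) / L)) as [N HN].
    destruct (finite_pos_min q j0 N) as [qm [Hqm Hqm']]; [intros; apply Hpos; lia|].
    (* Three errors of this size arise below; together they cost at most half of [q j * L]. *)
    assert (Hep : 0 < qm * L / 6) by nra.
    destruct (HL (mkposreal _ Hep)) as [Hlow [M1 HM1]]; simpl in Hlow, HM1.
    set (ep := qm * L / 6) in *.
    destruct (proj1 (lim_eps _ _) (proj1 (series_lim _ _) HQ) ep Hep) as [M2 HM2].
    destruct (Hlow (M1 + M2 + j0 + N + n0 + 2)%nat) as [n [Hn Hen]].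
    assert (Hall : forall k, (k <= N)%nat -> L / 2 <= e (n - (j0 + k))%nat).
    { intros k Hk. set (j := (j0 + k)%nat).
      rewrite Hconv in Hen by lia.
      assert (Hle : conv q e n <= (L + ep) * 1
         + q j * (e (n - j)%nat - L - ep) + ep).
      (* Three pieces: the bound L + ep wherever n - i >= [M1], the exact correction at i = j, and
         the tail of [q], where only [e] <= 1 is known. *)
      { apply Rle_trans with (sum_f_R0 (fun i => (L + ep) * q i
          + ((if (i =? j)%nat then q i * (e (n - i)%nat - L - ep) else 0)
          + (q i - if (i <=? n - M1)%nat then q i else 0))) n).
        - apply sum_Rle; intros i Hi. specialize (Hq i).
          assert (Hei := He (n - i)%nat). apply Rabs_le_between in Hei.
          destruct (Nat.eqb_spec i j); destruct (Nat.leb_spec i (n - M1)); try nra.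
          + specialize (HM1 (n - i)%nat ltac:(lia)). nra.
        - rewrite plus_sum, plus_sum, sum_scal_l, minus_sum, sum_restrict by lia.
          rewrite sum_single with (f := fun i => q i * (e (n - i)%nat - L - ep)) by (unfold j; lia).
          pose proof (sum_le_series q 1 n Hq HQ).
          specialize (HM2 (n - M1)%nat ltac:(lia)). apply Rabs_def2 in HM2.
          assert ((L + ep) * sum_f_R0 q n <= (L + ep) * 1) by (apply Rmult_le_compat_l; lra).
          lra. }
      specialize (Hqm' k Hk); fold j in Hqm'.
      assert (q j * (L / 2) <= q j * e (n - j)%nat).
      {
        unfold ep in *. nra. }
      apply Rmult_le_reg_l with (q j); lra. }
    assert (Htel : forall k, (k <= N)%nat ->
       sum_f_R0 (fun k => e (n - (j0 + k))%nat) k = s (n - j0)%nat - s (n - j0 - S k)%nat).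
    { induction k as [|k IHk]; intros Hk.
      - simpl. rewrite Nat.add_0_r. replace (n - j0)%nat with (S (n - j0 - 1)) at 1 by lia.
        rewrite Hs. f_equal; f_equal; lia.
      - rewrite tech5, IHk by lia.
        replace (n - (j0 + S k))%nat with (S (n - j0 - S (S k))) by lia. rewrite Hs.
        replace (S (n - j0 - S (S k))) with (n - j0 - S k)%nat by lia. ring. }
    specialize (Htel N (le_n N)).
    assert (Hge : INR (S N) * (L / 2) <= sum_f_R0 (fun k => e (n - (j0 + k))%nat) N).
    { rewrite Rmult_comm, <- sum_cte. apply sum_Rle; intros; now apply Hall. }
    assert (H1 := Hsb (n - j0)%nat). assert (H2 := Hsb (n - j0 - S N)%nat).
    apply Rabs_le_between in H1. apply Rabs_le_between in H2.
    rewrite Htel, S_INR in Hge.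
    apply Rmult_lt_compat_r with (r := L / 2) in HN; [|lra].
    replace (2 * (2 * s0) / L * (L / 2)) with (2 * s0) in HN by (field; lra). nra.
  - destruct (HL 1 0%nat) as [n [_ Hn]].
    specialize (He n); apply Rabs_le_between in He; lra.
  - auto.
Qed.

Section Renewal.
Variables (q d : nat -> R) (j0 : nat).
Hypothesis Hq : forall n, 0 <= q n.
Hypothesis Hq0 : q O = 0.
Hypothesis HQ : is_series q 1.
Hypothesis Hpos : forall j, (j0 <= j)%nat -> 0 < q j.
Hypothesis Hd : forall n, 0 <= d n.
Hypothesis Hdq : forall n, d n = delta0 n + conv q d n.

Definition tail_mass (n : nat) : R := 1 - sum_f_R0 q n.

Lemma tail_mass_pos n : 0 < tail_mass n.
Proof.
  unfold tail_mass. assert (sum_f_R0 q (S (n + j0)) <= 1) by now apply sum_le_series.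
  pose proof (sum_le_extend q n (n + j0) Hq ltac:(lia)).
  rewrite tech5 in H. specialize (Hpos (S (n + j0)) ltac:(lia)). lra.
Qed.

(** [tail_mass] has generating function (1 - Q)/(1 - z) and D = 1/(1 - Q); the product is 1/(1 - z).
    In probabilistic terms, the terms split the total mass by the last renewal up to n. *)
Lemma renewal_identity n : conv tail_mass d n = 1.
Proof.
  rewrite conv_comm. unfold conv, tail_mass.
  rewrite (sum_eq _ (fun i => d i - d i * sum_f_R0 q (n - i))) by (intros; ring).
  rewrite minus_sum, <- sum_conv.
  rewrite (sum_eq d _ n (fun i _ => Hdq i)), plus_sum, sum_delta0.
  rewrite (sum_eq (conv q d) (conv d q)) by (intros; apply conv_comm). ring.
Qed.

Lemma renewal_le1 n : d n <= 1.
Proof.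
  rewrite <- (renewal_identity n).
  replace (d n) with (tail_mass 0 * d (n - 0)%nat)
    by (unfold tail_mass; simpl; rewrite Hq0, Nat.sub_0_r; ring).
  apply (sum_term_le (fun i => tail_mass i * d (n - i)%nat)); [|lia].
  intros j; apply Rmult_le_pos; [left; apply tail_mass_pos|auto].
Qed.

(** The backward difference [e] satisfies e = q * e from n = 2 on, once the unit mass at 0 has
    dropped out, and it telescopes to the bounded [d]. So [averaging_limsup] applies to [e] and to
    [- e]. Aiming at differences rather than at the limit of [d] treats finite and infinite mean at
    once. *)
Lemma renewal_diff : is_lim_seq (fun n => d (S n) - d n) 0.
Proof.
  set (e := fun n => d n - match n with O => 0 | S n' => d n' end).
  assert (Heb : forall n, Rabs (e n) <= 1).
  { intros n; apply Rabs_le; unfold e. pose proof (renewal_le1 n). specialize (Hd n) as H1.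
    destruct n; [lra|]. pose proof (renewal_le1 n). specialize (Hd n) as H2. lra. }
  assert (Hrec : forall n, (2 <= n)%nat -> e n = conv q e n).
  { intros n Hn. destruct n as [|[|n]]; try lia. unfold e at 1.
    rewrite (Hdq (S (S n))), (Hdq (S n)). unfold delta0; simpl Nat.eqb; cbv iota.
    unfold conv. rewrite !(tech5 _ (S n)), Nat.sub_diag.
    replace (e O) with (d O) by (unfold e; ring).
    rewrite (sum_eq (fun i => q i * e (S (S n) - i)%nat)
       (fun i => q i * d (S (S n) - i)%nat - q i * d (S n - i)%nat)).
    - rewrite minus_sum; ring.
    - intros i Hi. unfold e. replace (S (S n) - i)%nat with (S (S n - i)) by lia. ring. }
  assert (Hdb : forall n, Rabs (d n) <= 1).
  { intros n; rewrite Rabs_pos_eq by auto; apply renewal_le1. }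
  assert (Hup : forall eps, 0 < eps -> exists M, forall n, (M <= n)%nat -> e n < eps).
  { apply (averaging_limsup q e d j0 2 1); auto. }
  assert (Hlo : forall eps, 0 < eps -> exists M, forall n, (M <= n)%nat -> - e n < eps).
  { apply (averaging_limsup q (fun n => - e n) (fun n => - d n) j0 2 1); auto.
    - intros n; rewrite Rabs_Ropp; auto.
    - intros n Hn; rewrite Hrec by lia. unfold conv.
      rewrite <- (Rmult_1_l (sum_f_R0 _ _)), Ropp_mult_distr_l, <- sum_scal_l.
      apply sum_eq; intros; ring.
    - intros n; unfold e; ring.
    - intros n; rewrite Rabs_Ropp; auto. }
  apply lim_eps; intros eps Heps.
  destruct (Hup eps Heps) as [M1 HM1]. destruct (Hlo eps Heps) as [M2 HM2].
  exists (M1 + M2)%nat; intros n Hn.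
  specialize (HM1 (S n) ltac:(lia)). specialize (HM2 (S n) ltac:(lia)).
  unfold e in *. apply Rabs_def1; lra.
Qed.

Lemma renewal_diff_shift j : is_lim_seq (fun n => d (n - j)%nat - d n) 0.
Proof.
  induction j as [|j IH].
  - apply is_lim_seq_ext with (fun _ => 0); [|apply is_lim_seq_const].
    intros n; rewrite Nat.sub_0_r; ring.
  - apply is_lim_seq_ext_loc with (fun n =>
      (d (n - j)%nat - d n) + - 1 * (d (S (n - S j)) - d (n - S j)%nat)).
    { exists (S j); intros n Hn. replace (S (n - S j)) with (n - j)%nat by lia. ring. }
    replace (Finite 0) with (Finite (0 + -1 * 0)) by (f_equal; ring).
    apply is_lim_seq_plus'; [exact IH|].
    apply is_lim_seq_mult'; [apply is_lim_seq_const|].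
    apply lim_shift_down with (u := fun n => d (S n) - d n), renewal_diff.
Qed.

Lemma sum_by_parts N :
  sum_f_R0 (fun n => INR n * q n) N + INR N * tail_mass N
  = sum_f_R0 tail_mass N - tail_mass N.
Proof.
  induction N as [|N IH]; [simpl; ring|].
  rewrite !(tech5 _ N).
  assert (tail_mass (S N) = tail_mass N - q (S N)) by (unfold tail_mass; simpl; ring).
  rewrite H, S_INR. lra.
Qed.

(** For summable f the shifted differences of [d] vanish under the domination f, so (f * d)_n - d_n
    sum f tends to 0. With f = [tail_mass], the renewal identity forces d_n -> 1/mu; with f = n q_n
    this yields the limit claimed. *)
Lemma renewal_finite_mean mu :
  is_series tail_mass mu ->
  exists v, 0 < v /\ is_lim_seq (fun n => conv (fun i => INR i * q i) d n) v.
Proof.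
  intros Hmu.
  assert (HT : forall n, 0 <= tail_mass n) by (intros; left; apply tail_mass_pos).
  assert (Havg : forall f F, (forall i, 0 <= f i) -> is_series f F ->
     is_lim_seq (fun n => conv f d n - d n * sum_f_R0 f n) 0).
  { intros f F Hf HF.
    apply is_lim_seq_ext with (fun n => sum_f_R0 (fun j => f j * (d (n - j)%nat - d n)) n).
    { intros n; unfold conv. rewrite <- sum_scal_l, <- minus_sum.
      apply sum_eq; intros; ring. }
    apply tannery with (N := fun n => n) (F := fun n j => f j * (d (n - j)%nat - d n))
      (f := fun _ => 0) (G := f).
    - auto.
    - intros j. replace (Finite 0) with (Finite (f j * 0)) by (f_equal; ring).
      apply is_lim_seq_mult'; [apply is_lim_seq_const|apply renewal_diff_shift].
    - intros n j. rewrite Rabs_mult, Rabs_pos_eq by auto.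
      pose proof (renewal_le1 n). pose proof (renewal_le1 (n - j)).
      pose proof (Hd n). pose proof (Hd (n - j)%nat).
      assert (Rabs (d (n - j)%nat - d n) <= 1) by (apply Rabs_le; lra).
      specialize (Hf j). nra.
    - now exists F.
    - apply series_lim. apply is_lim_seq_ext with (fun _ => 0); [|apply is_lim_seq_const].
      intros; symmetry; now apply sum_zero. }
  assert (Hmu1 : 1 <= mu).
  { pose proof (sum_le_series _ _ 0 HT Hmu) as H; simpl in H.
    unfold tail_mass in H; simpl in H; lra. }
  assert (Hdl : is_lim_seq d (/ mu)).
  { assert (H1 : is_lim_seq (fun n => d n * sum_f_R0 tail_mass n) 1).
    { apply is_lim_seq_ext with
        (fun n => 1 + -1 * (conv tail_mass d n - d n * sum_f_R0 tail_mass n)).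
      { intros n; rewrite renewal_identity; ring. }
      replace (Finite 1) with (Finite (1 + -1 * 0)) by (f_equal; ring).
      apply is_lim_seq_plus'; [apply is_lim_seq_const|].
      apply is_lim_seq_mult'; [apply is_lim_seq_const|].
      now apply Havg with (f := tail_mass) (F := mu). }
    apply is_lim_seq_ext with (fun n => d n * sum_f_R0 tail_mass n / sum_f_R0 tail_mass n).
    { intros n. assert (0 < sum_f_R0 tail_mass n).
      { pose proof (sum_term_le _ 0 n HT ltac:(lia)). pose proof (tail_mass_pos 0). lra. }
      field; lra. }
    replace (Finite (/ mu)) with (Finite (1 / mu)) by (f_equal; field; lra).
    apply is_lim_seq_div'; [exact H1|now apply series_lim|lra]. }
  assert (Hnq : forall n, 0 <= INR n * q n) by (intros; apply Rmult_le_pos; auto using pos_INR).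
  destruct (ex_series_bounded _ mu Hnq) as [nu [Hnu _]].
  { intros N. pose proof (sum_by_parts N). pose proof (sum_le_series _ _ N HT Hmu).
    pose proof (HT N). pose proof (Rmult_le_pos _ _ (pos_INR N) (HT N)). lra. }
  assert (Hnup : 0 < nu).
  { pose proof (sum_le_series _ _ (S j0) Hnq Hnu).
    pose proof (sum_term_le _ (S j0) (S j0) Hnq ltac:(lia)).
    assert (0 < INR (S j0) * q (S j0)).
    { apply Rmult_lt_0_compat; [apply lt_0_INR; lia|apply Hpos; lia]. }
    cbv beta in *; lra. }
  exists (/ mu * nu); split.
  { apply Rmult_lt_0_compat; [apply Rinv_0_lt_compat; lra|auto]. }
  apply is_lim_seq_ext with (fun n =>
     (conv (fun i => INR i * q i) d n - d n * sum_f_R0 (fun i => INR i * q i) n)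
     + d n * sum_f_R0 (fun i => INR i * q i) n).
  { intros n; ring. }
  replace (Finite (/ mu * nu)) with (Finite (0 + / mu * nu)) by (f_equal; ring).
  apply is_lim_seq_plus'; [now apply Havg with (F := nu)|].
  apply is_lim_seq_mult'; [exact Hdl|now apply series_lim].
Qed.

Lemma rt_step_ratio :
  is_lim_seq (fun n => (2 / rt n - 2 / rt (S n)) * rt (S n) ^ 3) 1.
Proof.
  set (r := fun n => rt (S n) / rt n).
  assert (Hr : is_lim_seq r 1).
  { pose proof (rt_ratio 1) as H. apply is_lim_seq_incr_1 in H.
    eapply is_lim_seq_ext; [|exact H]. intros n; unfold r; simpl. now rewrite Nat.sub_0_r. }
  apply is_lim_seq_ext with (fun n => 2 * r n ^ 2 / (1 + r n)).
  { intros n; unfold r. pose proof (rt_pos n). pose proof (rt_pos (S n)).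
    pose proof (rt_sqr n). pose proof (rt_sqr (S n)). rewrite S_INR in H2.
    assert (E : rt (S n) * rt (S n) = rt n * rt n + 1) by lra.
    replace (2 / rt n - 2 / rt (S n))
      with (2 * (rt (S n) * rt (S n) - rt n * rt n) / (rt n * rt (S n) * (rt n + rt (S n))))
      by (field; lra).
    rewrite E. field; lra. }
  replace (Finite 1) with (Finite (2 * 1 ^ 2 / (1 + 1))) by (f_equal; field).
  apply is_lim_seq_div'; [|apply is_lim_seq_plus'; [apply is_lim_seq_const|exact Hr]|lra].
  apply is_lim_seq_mult'; [apply is_lim_seq_const|]. now apply lim_pow.
Qed.

(** * Renewal sequences of infinite mean, with weights of order n^(-3/2) *)

Section Critical.
Variable lam : R.
Hypothesis Hlam : 0 < lam.
Hypothesis Hql : is_lim_seq (fun n => q n * rt n ^ 3) lam.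

Lemma tail_lim : is_lim_seq tail_mass 0.
Proof.
  replace (Finite 0) with (Finite (1 - 1)) by (f_equal; ring).
  apply is_lim_seq_minus'; [apply is_lim_seq_const|now apply series_lim].
Qed.

(** Comparison with c (2 / [rt n]): the difference tends to 0 and is eventually increasing for c =
    lam + eps/4, decreasing for c = lam - eps/4. Its sign is therefore known in both cases. *)
Lemma tail_asymp : is_lim_seq (fun n => tail_mass n * rt n) (2 * lam).
Proof.
  set (De := fun n => 2 / rt n - 2 / rt (S n)).
  assert (HDe : forall n, 0 < De n).
  { intros n; unfold De. pose proof (inv_rt3_le n). pose proof (rt_pos (S n)).
    assert (0 < / rt (S n) ^ 3) by (apply Rinv_0_lt_compat, pow_lt; auto). lra. }
  assert (Hr : is_lim_seq (fun n => q (S n) / De n) lam).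
  { apply is_lim_seq_ext with
      (fun n => (q (S n) * rt (S n) ^ 3) / (De n * rt (S n) ^ 3)).
    { intros n. specialize (HDe n). pose proof (rt_pos (S n)). field; lra. }
    replace (Finite lam) with (Finite (lam / 1)) by (f_equal; field).
    apply is_lim_seq_div'; [|apply rt_step_ratio|lra].
    now apply (is_lim_seq_incr_1 (fun n => q n * rt n ^ 3)). }
  assert (Hz : forall c, is_lim_seq (fun n => tail_mass n - c * (2 / rt n)) 0).
  { intros c. replace (Finite 0) with (Finite (0 - c * (2 * 0))) by (f_equal; ring).
    apply is_lim_seq_minus'; [apply tail_lim|].
    apply is_lim_seq_mult'; [apply is_lim_seq_const|].
    apply is_lim_seq_mult'; [apply is_lim_seq_const|apply inv_rt_lim]. }
  assert (Hstep : forall n, tail_mass (S n) = tail_mass n - q (S n))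
    by (intros; unfold tail_mass; simpl; ring).
  apply lim_eps; intros eps Heps.
  destruct (proj1 (lim_eps _ _) Hr (eps / 4) ltac:(lra)) as [N HN].
  assert (Hq' : forall n, (N <= n)%nat ->
     (lam - eps / 4) * De n <= q (S n) <= (lam + eps / 4) * De n).
  { intros n Hn. specialize (HN n Hn). specialize (HDe n). apply Rabs_def2 in HN.
    replace (q (S n)) with (q (S n) / De n * De n) by (field; lra). nra. }
  exists N; intros n Hn. pose proof (rt_pos n).
  assert (H1 : tail_mass n - (lam + eps / 4) * (2 / rt n) <= 0).
  { assert (Hl := Hz (lam + eps / 4)).
    apply is_lim_seq_incr_n with (N := n) in Hl.
    apply (is_lim_seq_incr_compare _ _ Hl) with (n := 0%nat).
    intros k; simpl. rewrite Hstep. specialize (Hq' (k + n)%nat ltac:(lia)).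
    unfold De in Hq'. lra. }
  assert (H2 : 0 <= tail_mass n - (lam - eps / 4) * (2 / rt n)).
  { assert (Hl := Hz (lam - eps / 4)).
    apply is_lim_seq_incr_n with (N := n) in Hl.
    apply (is_lim_seq_decr_compare _ _ Hl) with (n := 0%nat).
    intros k; simpl. rewrite Hstep. specialize (Hq' (k + n)%nat ltac:(lia)).
    unfold De in Hq'. lra. }
  assert (H3 : tail_mass n * rt n - 2 * lam =
     (tail_mass n - (lam + eps / 4) * (2 / rt n)) * rt n + eps / 2) by (field; lra).
  assert (H4 : tail_mass n * rt n - 2 * lam =
     (tail_mass n - (lam - eps / 4) * (2 / rt n)) * rt n - eps / 2) by (field; lra).
  apply Rabs_def1; nra.
Qed.

(** Tail masses decrease, so J + 1 of them add up to at least (J + 1) times the last, which is of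
    order [rt J]. *)
Lemma tail_sum_unbounded M : exists J, M < sum_f_R0 tail_mass J.
Proof.
  destruct (proj1 (lim_eps _ _) tail_asymp lam Hlam) as [N HN].
  pose proof (proj2 (is_lim_seq_spec _ _) rt_infty (Rmax M 0 / lam)) as [N2 HN2].
  set (J := (N + N2)%nat). exists J.
  assert (Hdec : forall i, (i <= J)%nat -> tail_mass J <= tail_mass i).
  { intros i Hi; unfold tail_mass. pose proof (sum_le_extend q i J Hq Hi). lra. }
  specialize (HN J ltac:(lia)). specialize (HN2 J ltac:(lia)).
  apply Rabs_def2 in HN. pose proof (rt_sqr J). pose proof (rt_pos J).
  assert (sum_f_R0 (fun _ => tail_mass J) J <= sum_f_R0 tail_mass J) by (apply sum_Rle; auto).
  rewrite sum_cte, S_INR, <- H in H1.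
  apply Rmult_lt_compat_l with (r := lam) in HN2; [|auto].
  replace (lam * (Rmax M 0 / lam)) with (Rmax M 0) in HN2 by (field; lra).
  pose proof (Rmax_l M 0). nra.
Qed.

(** The renewal identity cut at J, with each d_(n-j) replaced by d_n at vanishing cost, bounds d_n
    times the sum of the first tail masses by 2. That sum can be made larger than 2/eps. *)
Lemma renewal_null : is_lim_seq d 0.
Proof.
  apply lim_eps; intros eps Heps.
  destruct (tail_sum_unbounded (2 / eps)) as [J HJ].
  set (S0 := sum_f_R0 tail_mass J) in *.
  assert (HL : is_lim_seq (fun n => sum_f_R0 (fun j => tail_mass j * (d (n - j)%nat - d n)) J) 0).
  { replace 0 with (sum_f_R0 (fun j => tail_mass j * 0) J) by (apply sum_zero; intros; ring).
    apply lim_sum with (F := fun n j => tail_mass j * (d (n - j)%nat - d n)).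
    intros j; apply is_lim_seq_mult'; [apply is_lim_seq_const|apply renewal_diff_shift]. }
  destruct (proj1 (lim_eps _ _) HL 1 Rlt_0_1) as [N HN].
  exists (N + J)%nat; intros n Hn. specialize (HN n ltac:(lia)).
  rewrite Rminus_0_r in *. rewrite Rabs_pos_eq by auto. apply Rabs_def2 in HN.
  rewrite (sum_eq _ (fun j => tail_mass j * d (n - j)%nat - d n * tail_mass j)) in HN
    by (intros; ring).
  rewrite minus_sum, sum_scal_l in HN. fold S0 in HN.
  assert (sum_f_R0 (fun j => tail_mass j * d (n - j)%nat) J <= 1).
  { rewrite <- (renewal_identity n). apply sum_le_extend; [|lia].
    intros; apply Rmult_le_pos; auto. left; apply tail_mass_pos. }
  assert (0 < 2 / eps) by (apply Rdiv_lt_0_compat; lra).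
  apply Rmult_lt_reg_r with S0; [lra|].
  apply Rlt_le_trans with (eps * (2 / eps)).
  - replace (eps * (2 / eps)) with 2 by (field; lra). lra.
  - nra.
Qed.

(* n q_n is asymptotically half the tail mass, and the tail masses times d sum to 1. *)
Lemma renewal_critical :
  is_lim_seq (fun n => conv (fun i => INR i * q i) d n) (1 / 2).
Proof.
  set (u := fun j => INR j * q j / tail_mass j - 1 / 2).
  assert (Hu : is_lim_seq u 0).
  { replace (Finite 0) with (Finite (lam * / 1 / (2 * lam) - 1 / 2)) by (f_equal; field; lra).
    apply is_lim_seq_minus'; [|apply is_lim_seq_const].
    apply is_lim_seq_ext_loc with (fun n =>
      (q n * rt n ^ 3 * / (rt n ^ 2 / INR n)) / (tail_mass n * rt n)).
    { exists 1%nat; intros n Hn. assert (0 < INR n) by (apply lt_0_INR; lia).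
      pose proof (rt_pos n). pose proof (tail_mass_pos n). field; lra. }
    apply is_lim_seq_div'; [|apply tail_asymp|lra].
    apply is_lim_seq_mult'; [exact Hql|].
    apply (is_lim_seq_inv _ 1); [apply lim_INR_ratio|]. intros E; inversion E; lra. }
  apply is_lim_seq_ext with
    (fun n => 1 / 2 + sum_f_R0 (fun j => tail_mass j * d (n - j)%nat * u j) n).
  { intros n. replace (1 / 2) with (1 / 2 * conv tail_mass d n) by (rewrite renewal_identity; field).
    unfold conv at 1; rewrite <- sum_scal_l, <- plus_sum. apply sum_eq; intros j Hj.
    unfold u. pose proof (tail_mass_pos j). field; lra. }
  replace (Finite (1 / 2)) with (Finite (1 / 2 + 0)) by (f_equal; ring).
  apply is_lim_seq_plus'; [apply is_lim_seq_const|].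
  apply toeplitz with (c := fun n j => tail_mass j * d (n - j)%nat); auto.
  - intros; apply Rmult_le_pos; auto. left; apply tail_mass_pos.
  - intros n. pose proof (renewal_identity n). unfold conv in H. lra.
  - intros i. replace (Finite 0) with (Finite (tail_mass i * 0)) by (f_equal; ring).
    apply is_lim_seq_mult'; [apply is_lim_seq_const|apply lim_shift_down, renewal_null].
Qed.
End Critical.
End Renewal.

(** * Regular variation *)

Lemma lim_inv_INR : is_lim_seq (fun n => / INR n) 0.
Proof.
  replace (Finite 0) with (Rbar_inv p_infty) by reflexivity.
  apply is_lim_seq_inv; [apply is_lim_seq_INR|discriminate].
Qed.

(* A sequence with [n h_n = (t * h)_n] and [t -> alpha] is regularly varying of index
   [alpha - 1]: its partial sums H satisfy [n h_n / H_n -> alpha]. *)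
Section RegularVariation.
Variables (h t : nat -> R) (alpha : R).
Hypothesis Hh : forall n, 0 <= h n.
Hypothesis Hh0 : 0 < h O.
Hypothesis Ht : is_lim_seq t alpha.
Hypothesis Halpha : 0 < alpha.
Hypothesis Hth : forall n, INR n * h n = conv t h n.

Lemma psum_pos n : 0 < sum_f_R0 h n.
Proof. pose proof (sum_term_le h 0 n Hh ltac:(lia)); lra. Qed.

Lemma rv_upper : exists K, 0 < K /\ forall n, INR n * h n <= K * sum_f_R0 h n.
Proof.
  destruct (lim_bounded _ _ Ht) as [K [HK HtK]]. exists K; split; [exact HK|].
  intros n; rewrite Hth, <- (sum_rev h), <- sum_scal_l. apply sum_Rle; intros i Hi.
  apply Rmult_le_compat_r; [auto|]. eapply Rle_trans; [apply Rle_abs|auto].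
Qed.

Lemma rv_small j : is_lim_seq (fun n => h (n - j)%nat / sum_f_R0 h n) 0.
Proof.
  destruct rv_upper as [K [HK HKn]].
  apply is_lim_seq_le_le_loc with (u := fun _ => 0) (w := fun n => K * / INR (n - j)).
  - exists (S j); intros n Hn. pose proof (psum_pos n).
    assert (0 < INR (n - j)) by (apply lt_0_INR; lia). split.
    + now apply Rdiv_le_0_compat.
    + apply Rmult_le_reg_r with (sum_f_R0 h n * INR (n - j)); [now apply Rmult_lt_0_compat|].
      replace (h (n - j)%nat / sum_f_R0 h n * (sum_f_R0 h n * INR (n - j)))
        with (INR (n - j) * h (n - j)%nat) by (field; lra).
      replace (K * / INR (n - j) * (sum_f_R0 h n * INR (n - j)))
        with (K * sum_f_R0 h n) by (field; lra).
      pose proof (sum_le_extend h (n - j) n Hh ltac:(lia)).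
      specialize (HKn (n - j)%nat).
      apply Rle_trans with (K * sum_f_R0 h (n - j)); [lra|].
      apply Rmult_le_compat_l; lra.
  - apply is_lim_seq_const.
  - replace (Finite 0) with (Finite (K * 0)) by (f_equal; ring).
    apply is_lim_seq_mult'; [apply is_lim_seq_const|].
    apply lim_shift_down with (u := fun n => / INR n), lim_inv_INR.
Qed.

(** The ratio is the mean of [t] for the weights h_(n-j) / H_n. They add up to 1 and each of them
    tends to 0, so the mean follows the limit of [t]. *)
Lemma rv_index : is_lim_seq (fun n => INR n * h n / sum_f_R0 h n) alpha.
Proof.
  apply is_lim_seq_ext with (fun n =>
    alpha + sum_f_R0 (fun j => h (n - j)%nat / sum_f_R0 h n * (t j - alpha)) n).
  { intros n; pose proof (psum_pos n). rewrite Hth.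
    rewrite (sum_eq _ (fun j => / sum_f_R0 h n * (t j * h (n - j)%nat - alpha * h (n - j)%nat)))
      by (intros; field; lra).
    rewrite sum_scal_l, minus_sum, sum_scal_l, sum_rev. unfold conv; field; lra. }
  replace (Finite alpha) with (Finite (alpha + 0)) by (f_equal; ring).
  apply is_lim_seq_plus'; [apply is_lim_seq_const|].
  apply toeplitz with (c := fun n j => h (n - j)%nat / sum_f_R0 h n).
  - intros; apply Rdiv_le_0_compat; [auto|apply psum_pos].
  - intros n. pose proof (psum_pos n).
    rewrite (sum_eq _ (fun j => / sum_f_R0 h n * h (n - j)%nat)) by (intros; unfold Rdiv; ring).
    rewrite sum_scal_l, sum_rev, Rinv_l; lra.
  - apply rv_small.
  - replace (Finite 0) with (Finite (alpha - alpha)) by (f_equal; ring).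
    apply is_lim_seq_minus'; [exact Ht|apply is_lim_seq_const].
Qed.

Lemma rv_lower :
  exists N, forall n, (N <= n)%nat -> 0 < h n /\ sum_f_R0 h n <= 2 / alpha * (INR n * h n).
Proof.
  destruct (proj1 (lim_eps _ _) rv_index (alpha / 2) ltac:(lra)) as [N HN].
  exists N; intros n Hn. specialize (HN n Hn). apply Rabs_def2 in HN.
  pose proof (psum_pos n).
  assert (H1 : alpha / 2 * sum_f_R0 h n < INR n * h n).
  { replace (INR n * h n) with (INR n * h n / sum_f_R0 h n * sum_f_R0 h n) by (field; lra).
    apply Rmult_lt_compat_r; lra. }
  split.
  - destruct (Rle_lt_or_eq_dec _ _ (Hh n)) as [|E]; [auto|].
    rewrite <- E, Rmult_0_r in H1. assert (0 < alpha / 2 * sum_f_R0 h n) by nra. lra.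
  - apply Rmult_le_reg_l with (alpha / 2); [lra|].
    replace (alpha / 2 * (2 / alpha * (INR n * h n))) with (INR n * h n) by (field; lra). lra.
Qed.

Lemma rv_psum_ratio j : is_lim_seq (fun n => sum_f_R0 h (n - j) / sum_f_R0 h n) 1.
Proof.
  induction j as [|j IH].
  - apply is_lim_seq_ext with (fun _ => 1); [|apply is_lim_seq_const].
    intros n; rewrite Nat.sub_0_r. pose proof (psum_pos n). field; lra.
  - apply is_lim_seq_ext_loc with (fun n => sum_f_R0 h (n - j) / sum_f_R0 h n
       - h (n - j)%nat / sum_f_R0 h n).
    { exists (S j); intros n Hn. replace (n - j)%nat with (S (n - S j)) by lia.
      rewrite tech5. pose proof (psum_pos n). field; lra. }
    replace (Finite 1) with (Finite (1 - 0)) by (f_equal; ring).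
    apply is_lim_seq_minus'; [exact IH|apply rv_small].
Qed.

(** By [rv_index], h_m is alpha H_m / m up to a factor tending to 1, and neither H_m nor m changes
    its order when m goes from n to n - j. *)
Lemma rv_ratio j : is_lim_seq (fun n => h (n - j)%nat / h n) 1.
Proof.
  destruct rv_lower as [N HN].
  apply is_lim_seq_ext_loc with (fun n =>
    (INR (n - j) * h (n - j)%nat / sum_f_R0 h (n - j)) * (sum_f_R0 h (n - j) / sum_f_R0 h n)
     * / (INR n * h n / sum_f_R0 h n) * (1 + INR j * / INR (n - j))).
  { exists (N + j + 1)%nat; intros n Hn.
    destruct (HN n ltac:(lia)). pose proof (psum_pos n). pose proof (psum_pos (n - j)).
    assert (0 < INR (n - j)) by (apply lt_0_INR; lia).
    assert (0 < INR n) by (apply lt_0_INR; lia).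
    assert (INR n = INR (n - j) + INR j) by (rewrite <- plus_INR; f_equal; lia).
    replace (1 + INR j * / INR (n - j)) with (INR n / INR (n - j)) by (rewrite H5; field; lra).
    field; lra. }
  replace (Finite 1) with (Finite (alpha * 1 * / alpha * (1 + INR j * 0)))
    by (f_equal; field; lra).
  apply is_lim_seq_mult'; [apply is_lim_seq_mult'; [apply is_lim_seq_mult'|]|].
  - apply lim_shift_down with (u := fun n => INR n * h n / sum_f_R0 h n), rv_index.
  - apply rv_psum_ratio.
  - apply (is_lim_seq_inv _ alpha); [apply rv_index|]. intros E; inversion E; lra.
  - apply is_lim_seq_plus'; [apply is_lim_seq_const|].
    apply is_lim_seq_mult'; [apply is_lim_seq_const|].
    apply lim_shift_down with (u := fun n => / INR n), lim_inv_INR.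
Qed.

(** Since H_n >= h_0 > 0, the index bound gives h_n >= c/n eventually, against which n^(-3/2)
    vanishes. *)
Lemma rv_negligible (f : nat -> R) F :
  (forall n, 0 <= f n <= F / rt n ^ 3) -> 0 <= F -> is_lim_seq (fun n => f n / h n) 0.
Proof.
  intros Hf HF. destruct rv_lower as [N HN].
  apply is_lim_seq_le_le_loc with (u := fun _ => 0)
    (w := fun n => F * (2 / alpha) / h 0%nat * / rt n).
  - exists (S N); intros n Hn. destruct (HN n ltac:(lia)) as [Hp Hb].
    specialize (Hf n). pose proof (rt_pos n). pose proof (rt_sqr n).
    split; [now apply Rdiv_le_0_compat|].
    pose proof (sum_term_le h 0 n Hh ltac:(lia)).
    assert (H3 : h 0%nat <= 2 / alpha * (rt n * rt n * h n)).
    { apply Rle_trans with (2 / alpha * (INR n * h n)); [lra|].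
      apply Rmult_le_compat_l; [apply Rdiv_le_0_compat; lra|]. nra. }
    apply Rmult_le_reg_r with (h n * rt n ^ 3).
    { apply Rmult_lt_0_compat; [auto|now apply pow_lt]. }
    replace (f n / h n * (h n * rt n ^ 3)) with (f n * rt n ^ 3) by (field; lra).
    apply Rle_trans with (F / rt n ^ 3 * rt n ^ 3).
    { apply Rmult_le_compat_r; [apply pow_le; lra|apply Hf]. }
    replace (F / rt n ^ 3 * rt n ^ 3) with (F * 1) by (field; lra).
    replace (F * (2 / alpha) / h 0%nat * / rt n * (h n * rt n ^ 3))
      with (F * (2 / alpha * (rt n * rt n * h n) / h 0%nat)) by (field; lra).
    apply Rmult_le_compat_l; [auto|].
    apply Rmult_le_reg_r with (h 0%nat); [auto|].
    replace (2 / alpha * (rt n * rt n * h n) / h 0%nat * h 0%nat)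
      with (2 / alpha * (rt n * rt n * h n)) by (field; lra). lra.
  - apply is_lim_seq_const.
  - replace (Finite 0) with (Finite (F * (2 / alpha) / h 0%nat * 0)) by (f_equal; ring).
    apply is_lim_seq_mult'; [apply is_lim_seq_const|apply inv_rt_lim].
Qed.

(** For i <= n/2 the quotient h_(n-i) / h_n is bounded, because both terms are comparable to H_m /
    m; [tannery] then yields [Sf]. In the other half f is O(n^(-3/2)) against H_n = O(n h_n). *)
Lemma rv_conv (f : nat -> R) F Sf :
  (forall n, 0 <= f n <= F / rt n ^ 3) -> 0 <= F -> is_series f Sf ->
  is_lim_seq (fun n => conv f h n / h n) Sf.
Proof.
  intros Hf HF HS. destruct rv_lower as [N HN]. destruct rv_upper as [K [HK HKn]].
  replace (Finite Sf) with (Finite (Sf + 0)) by (f_equal; ring).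
  apply is_lim_seq_ext with (fun n =>
    sum_f_R0 (fun i => if (2 * i <=? n)%nat then f i * h (n - i)%nat else 0) n / h n
    + sum_f_R0 (fun i => if (2 * i <? n)%nat then h i * f (n - i)%nat else 0) n / h n).
  { intros n; rewrite conv_half; unfold Rdiv; ring. }
  assert (Hal : 0 < 2 / alpha) by (apply Rdiv_lt_0_compat; lra).
  apply is_lim_seq_plus'.
  (* The guard on n makes the domination hold for every n: [h n] is known to be positive only from
     [N] on. *)
  - apply is_lim_seq_ext_loc with (fun n => sum_f_R0 (fun i =>
      if ((N + 1 <=? n) && (2 * i <=? n))%nat then f i * (h (n - i)%nat / h n) else 0) n).
    { exists (N + 1)%nat; intros n Hn. destruct (HN n ltac:(lia)).
      unfold Rdiv at 2; rewrite Rmult_comm, <- sum_scal_l. apply sum_eq; intros i Hi.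
      replace (N + 1 <=? n)%nat with true by (symmetry; now apply Nat.leb_le).
      rewrite andb_true_l. destruct (2 * i <=? n)%nat; [field; lra|ring]. }
    apply tannery with (N := fun n => n) (f := f) (G := fun i => K * 2 * (2 / alpha) * f i)
     (F := fun n i => if ((N + 1 <=? n) && (2 * i <=? n))%nat
         then f i * (h (n - i)%nat / h n) else 0).
    + auto.
    + intros i. apply is_lim_seq_ext_loc with (fun n => f i * (h (n - i)%nat / h n)).
      * exists (N + 1 + 2 * i)%nat; intros n Hn.
        replace (N + 1 <=? n)%nat with true by (symmetry; apply Nat.leb_le; lia).
        replace (2 * i <=? n)%nat with true by (symmetry; apply Nat.leb_le; lia). reflexivity.
      * replace (Finite (f i)) with (Finite (f i * 1)) by (f_equal; ring).
        apply is_lim_seq_mult'; [apply is_lim_seq_const|apply rv_ratio].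
    + intros n i. pose proof (proj1 (Hf i)).
      assert (0 <= K * 2 * (2 / alpha)) by nra.
      destruct ((N + 1 <=? n) && (2 * i <=? n))%nat eqn:E; [|rewrite Rabs_R0; nra].
      apply andb_prop in E; destruct E as [E1 E2].
      apply Nat.leb_le in E1; apply Nat.leb_le in E2.
      destruct (HN n ltac:(lia)) as [Hp Hb].
      rewrite Rabs_pos_eq by (apply Rmult_le_pos; [auto|now apply Rdiv_le_0_compat]).
      rewrite (Rmult_comm (K * 2 * _)). apply Rmult_le_compat_l; [auto|].
      apply Rmult_le_reg_r with (h n); [auto|].
      replace (h (n - i)%nat / h n * h n) with (h (n - i)%nat) by (field; lra).
      assert (Hi2 : INR n <= 2 * INR (n - i)).
      { change 2 with (INR 2); rewrite <- mult_INR; apply le_INR; lia. }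
      assert (0 < INR n) by (apply lt_0_INR; lia).
      specialize (HKn (n - i)%nat).
      pose proof (sum_le_extend h (n - i) n Hh ltac:(lia)).
      apply Rmult_le_reg_l with (INR n); [auto|].
      apply Rle_trans with (2 * (INR (n - i) * h (n - i)%nat)).
      { pose proof (Hh (n - i)%nat). nra. }
      apply Rle_trans with (2 * (K * (2 / alpha * (INR n * h n)))).
      { nra. }
      apply Req_le; ring.
    + exists (K * 2 * (2 / alpha) * Sf). apply (is_series_scal (K * 2 * (2 / alpha)) f Sf HS).
    + exact HS.
  - apply is_lim_seq_le_le_loc with (u := fun _ => 0)
      (w := fun n => 2 ^ 3 * F * (2 / alpha) * / rt n).
    + exists N; intros n Hn. destruct (HN n Hn) as [Hp Hb]. pose proof (rt_pos n). split.
      * apply Rdiv_le_0_compat; [|auto]. apply sum_nonneg; intros i Hi.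
        destruct (_ <? _)%nat; [|lra]. apply Rmult_le_pos; [auto|apply Hf].
      * apply Rmult_le_reg_r with (h n); [auto|].
        unfold Rdiv at 1; rewrite Rmult_assoc, Rinv_l, Rmult_1_r by lra.
        eapply Rle_trans.
        { apply half_bound with (c := fun n i => (2 * i <? n)%nat) (p := 3%nat) (B := F); auto.
          - intros m i Hm; apply Nat.ltb_lt in Hm; lia.
          - intros; apply Hf. }
        pose proof (rt_sqr n).
        apply Rle_trans with (2 ^ 3 * F * (2 / alpha * (rt n * rt n * h n)) / rt n ^ 3).
        { unfold Rdiv at 1 2; apply Rmult_le_compat_r.
          - left; apply Rinv_0_lt_compat, pow_lt; auto.
          - apply Rmult_le_compat_l; [lra|]. eapply Rle_trans; [exact Hb|].
            rewrite H0; nra. }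
        apply Req_le; field; lra.
    + apply is_lim_seq_const.
    + replace (Finite 0) with (Finite (2 ^ 3 * F * (2 / alpha) * 0)) by (f_equal; ring).
      apply is_lim_seq_mult'; [apply is_lim_seq_const|apply inv_rt_lim].
Qed.
End RegularVariation.

(** * The square-root singularity *)

Lemma CV_radius_ge1 (a : nat -> R) K :
  (forall n, Rabs (a n) <= K) -> Rbar_le 1 (CV_radius a).
Proof.
  intros H. apply (proj1 (CV_radius_bounded a)). exists K.
  intros n; rewrite pow1, Rmult_1_r; apply H.
Qed.

Lemma inside_CV (a : nat -> R) K x :
  (forall n, Rabs (a n) <= K) -> Rabs x < 1 -> Rbar_lt (Rabs x) (CV_radius a).
Proof.
  intros H Hx; eapply Rbar_lt_le_trans; [|eapply CV_radius_ge1; eauto]. exact Hx.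
Qed.

Lemma is_series_PSeries (a : nat -> R) x :
  Rbar_lt (Rabs x) (CV_radius a) -> is_series (fun n => a n * x ^ n) (PSeries a x).
Proof.
  intros H. apply CV_disk_inside, ex_series_Rabs, Series_correct in H.
  eapply is_series_ext; [|exact H]. reflexivity.
Qed.

Lemma PSeries_delta0 x : PSeries delta0 x = 1.
Proof.
  apply is_series_unique. apply is_series_ext with (2 := series_delta0).
  intros [|n]; unfold delta0; simpl; ring.
Qed.

Lemma one_minus_pow x n : 0 <= x <= 1 -> 0 <= 1 - x ^ n <= INR n * (1 - x).
Proof.
  intros Hx. induction n as [|n IH]; [simpl; lra|].
  rewrite S_INR; simpl pow. nra.
Qed.

(** Continuity at 1 made explicit: by Bernoulli's inequality, going from 1 down to 1 - del costs at
    most del M. *)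
Lemma psum_near_one (a : nat -> R) N : (forall n, 0 <= a n) -> 1 < sum_f_R0 a N ->
  exists x, 0 < x < 1 /\ 1 < sum_f_R0 (fun n => a n * x ^ n) N.
Proof.
  intros Ha HN. set (M := sum_f_R0 (fun n => a n * INR n) N).
  assert (HM : 0 <= M) by (apply cond_pos_sum; intros; apply Rmult_le_pos; auto using pos_INR).
  set (B := (sum_f_R0 a N - 1) / (2 * (M + 1))). set (del := Rmin (1 / 2) B).
  assert (HB : B * (2 * (M + 1)) = sum_f_R0 a N - 1) by (unfold B; field; lra).
  assert (Hd : del <= 1 / 2 /\ del <= B) by (split; [apply Rmin_l|apply Rmin_r]).
  assert (Hd0 : 0 < del) by (apply Rmin_glb_lt; [lra|apply Rdiv_lt_0_compat; lra]).
  exists (1 - del); split; [lra|].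
  assert (sum_f_R0 a N - sum_f_R0 (fun n => a n * (1 - del) ^ n) N <= del * M); [|nra].
  rewrite <- minus_sum. unfold M; rewrite <- sum_scal_l. apply sum_Rle; intros n Hn.
  pose proof (one_minus_pow (1 - del) n ltac:(lra)). specialize (Ha n). nra.
Qed.

(* The coefficients c of [1 - sqrt (1 - x)] are characterised by their recurrence. *)
Section SqrtSeries.
Variable c : nat -> R.
Hypothesis Hc0 : c 0%nat = 0.
Hypothesis Hc1 : c 1%nat = 1 / 2.
Hypothesis Hcr : forall n, (1 <= n)%nat -> INR (S n) * c (S n) = (INR n - 1 / 2) * c n.

Lemma sqrt_coef_bounds n : 0 <= c n <= 1 / 2.
Proof.
  destruct n; [lra|]. induction n as [|n IH]; [lra|].
  specialize (Hcr (S n) ltac:(lia)). rewrite !S_INR in Hcr. pose proof (pos_INR n).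
  split.
  - nra.
  - nra.
Qed.

Lemma sqrt_coef_abs n : Rabs (c n) <= 1 / 2.
Proof. pose proof (sqrt_coef_bounds n). rewrite Rabs_pos_eq; lra. Qed.

(** The coefficient recurrence read as a differential equation. It says that (1 - C) / sqrt (1 - x)
    has derivative 0, which [sqrt_series] integrates from x = 0. *)
Lemma sqrt_series_ode x : Rabs x < 1 ->
  (1 - x) * PSeries (PS_derive c) x = 1 / 2 * (1 - PSeries c x).
Proof.
  intros Hx. pose proof (inside_CV c _ x sqrt_coef_abs Hx) as HR.
  assert (HR' : Rbar_lt (Rabs x) (CV_radius (PS_derive c))) by (now rewrite CV_radius_derive).
  assert (E1 : ex_pseries c x) by (apply CV_radius_inside; exact HR).
  assert (E2 : ex_pseries (PS_derive c) x) by (apply CV_radius_inside; exact HR').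
  assert (E3 : ex_pseries delta0 x).
  { apply CV_radius_inside. apply inside_CV with 1; [|exact Hx].
    intros n; unfold delta0; destruct (n =? 0)%nat; rewrite Rabs_pos_eq; lra. }
  assert (E : PSeries (PS_derive c) x =
    PSeries (PS_plus (PS_incr_1 (PS_derive c))
      (PS_plus (PS_scal (-1/2) c) (PS_scal (1/2) delta0))) x).
  { apply PSeries_ext; intros [|n].
    - change (INR 1 * c 1%nat = 0 + (-1 / 2 * c 0%nat + 1 / 2 * 1)).
      rewrite Hc0, Hc1; simpl; field.
    - change (INR (S (S n)) * c (S (S n))
        = INR (S n) * c (S n) + (-1 / 2 * c (S n) + 1 / 2 * 0)).
      rewrite Hcr by lia. field. }
  rewrite PSeries_plus, PSeries_plus, !PSeries_scal, PSeries_incr_1, PSeries_delta0 in E.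
  - lra.
  - now apply ex_pseries_scal; [apply Rmult_comm|].
  - now apply ex_pseries_scal; [apply Rmult_comm|].
  - now apply ex_pseries_incr_1.
  - apply ex_pseries_plus; (apply ex_pseries_scal; [apply Rmult_comm|assumption]).
Qed.

Lemma sqrt_series x : 0 <= x < 1 -> is_series (fun n => c n * x ^ n) (1 - sqrt (1 - x)).
Proof.
  intros Hx.
  assert (Hin : forall y, Rabs y < 1 -> Rbar_lt (Rabs y) (CV_radius c)).
  { intros y Hy. now apply inside_CV with (1 / 2); [apply sqrt_coef_abs|]. }
  assert (Habs : Rabs x < 1) by (rewrite Rabs_pos_eq; lra).
  replace (1 - sqrt (1 - x)) with (PSeries c x); [now apply is_series_PSeries, Hin|].
  set (f := fun y => (1 - PSeries c y) * / sqrt (1 - y)).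
  assert (Hf : f 0 = f x).
  { destruct (Req_dec x 0) as [->|Hx0]; [reflexivity|].
    apply (eq_is_derive (V := R_NormedModule)); [|lra].
    intros y Hy. assert (Hy1 : Rabs y < 1) by (rewrite Rabs_pos_eq; lra).
    assert (HD := is_derive_PSeries c y (Hin y Hy1)).
    unfold f. auto_derive.
    - repeat split; try lra; [eexists; exact HD|]. apply Rgt_not_eq, sqrt_lt_R0; lra.
    - rewrite (is_derive_unique _ _ _ HD : Derive (fun x => PSeries c x) y = _).
      pose proof (sqrt_series_ode y Hy1) as Hode.
      assert (Hs : 0 < sqrt (1 - y)) by (apply sqrt_lt_R0; lra).
      assert (Hss : sqrt (1 - y) * sqrt (1 - y) = 1 - y) by (apply sqrt_sqrt; lra).
      replace (1 + - y) with (1 - y) by ring.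
      assert (E : PSeries (PS_derive c) y = 1 / 2 * (1 - PSeries c y) / (1 - y)).
      { rewrite <- Hode. field. lra. }
      unfold zero; simpl. rewrite E, <- Hss, sqrt_square by lra. field. lra. }
  unfold f in Hf. rewrite PSeries_0, Hc0, Rminus_0_r, sqrt_1 in Hf.
  assert (Hs : 0 < sqrt (1 - x)) by (apply sqrt_lt_R0; lra).
  assert (1 - PSeries c x = sqrt (1 - x)); [|lra].
  replace (1 - PSeries c x) with ((1 - PSeries c x) * / sqrt (1 - x) * sqrt (1 - x))
    by (field; lra).
  rewrite <- Hf; field.
Qed.

(** A partial sum above 1 would already exceed 1 - sqrt (1 - x) at some x < 1. A sum S < 1 is
    refuted at x = 1 - e^2 with e = (1 - S)/2, where the series has the value 1 - e > S. *)
Lemma sqrt_series_one : is_series c 1.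
Proof.
  assert (Hpos : forall n, 0 <= c n) by apply sqrt_coef_bounds.
  assert (HB : forall N, sum_f_R0 c N <= 1).
  { intros N. apply Rnot_lt_le; intros Hlt.
    destruct (psum_near_one c N Hpos Hlt) as [x [Hx H1]].
    pose proof (sum_le_series _ _ N (fun n => Rmult_le_pos _ _ (Hpos n) (pow_le x n ltac:(lra)))
      (sqrt_series x ltac:(lra))) as H2.
    pose proof (sqrt_pos (1 - x)). lra. }
  destruct (ex_series_bounded c 1 Hpos HB) as [S [HS HS1]].
  replace 1 with S; [exact HS|].
  apply Rle_antisym; [exact HS1|]. apply Rnot_lt_le; intros Hlt.
  set (e := (1 - S) / 2).
  assert (HSp : 0 <= S) by (eapply Rle_trans; [apply (Hpos 0%nat)|apply (sum_le_series c S 0 Hpos HS)]).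
  assert (He : 0 < e <= 1 / 2) by (unfold e; lra).
  assert (Hx : 0 <= 1 - e * e < 1) by nra.
  pose proof (sqrt_series _ Hx) as H1.
  replace (1 - (1 - e * e)) with (e * e) in H1 by ring.
  rewrite sqrt_square in H1 by lra.
  assert (1 - e <= S); [|unfold e in *; lra].
  apply series_lim in H1. apply (is_lim_seq_le _ _ _ _ (fun n => Rle_trans _ _ _
    (sum_Rle (fun n => c n * (1 - e * e) ^ n) c n
      (fun i _ => ltac:(pose proof (one_minus_pow (1 - e * e) i ltac:(lra)); specialize (Hpos i); nra)))
      (Rle_refl _)) H1 (proj1 (series_lim _ _) HS)).
Qed.

Variable kap : R.
Hypothesis Hkap : 0 < kap.
Hypothesis Hcl : is_lim_seq (fun n => c n * rt n ^ 3) kap.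

(** Subtracting L/kap times [c] leaves [a'] = o(c). Beyond [N] the remainder is dominated by eps/2
    times [c], for which sum c_n (1 - x^n) = sqrt (1 - x); the terms up to [N] cost only O(1 -
    x). *)
Lemma abelian_sqrt (a : nat -> R) (L A : R) :
  is_lim_seq (fun n => a n * rt n ^ 3) L -> is_series a A ->
  forall eps, 0 < eps -> exists del, 0 < del /\
    forall x Ax, 0 <= x -> 1 - del < x < 1 -> is_series (fun n => a n * x ^ n) Ax ->
      Rabs (A - Ax - L / kap * sqrt (1 - x)) <= eps * sqrt (1 - x).
Proof.
  intros HL HA eps Heps.
  set (a' := fun n => a n - L / kap * c n).
  assert (Hc : forall n, 0 <= c n) by apply sqrt_coef_bounds.
  assert (Ha' : is_lim_seq (fun n => a' n * rt n ^ 3 / (c n * rt n ^ 3)) 0).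
  { replace (Finite 0) with (Finite ((L - L / kap * kap) / kap)) by (f_equal; field; lra).
    apply is_lim_seq_div'; [|exact Hcl|lra].
    apply is_lim_seq_ext with (fun n => a n * rt n ^ 3 - L / kap * (c n * rt n ^ 3)).
    { intros n; unfold a'; ring. }
    apply is_lim_seq_minus'; [exact HL|].
    apply is_lim_seq_mult'; [apply is_lim_seq_const|exact Hcl]. }
  destruct (proj1 (lim_eps _ _) Ha' (eps / 2) ltac:(lra)) as [N1 HN1].
  destruct (proj1 (lim_eps _ _) Hcl kap Hkap) as [N2 HN2].
  set (N := (N1 + N2)%nat).
  assert (Hb : forall n, (N <= n)%nat -> Rabs (a' n) <= eps / 2 * c n).
  { intros n Hn. specialize (HN1 n ltac:(lia)). specialize (HN2 n ltac:(lia)).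
    apply Rabs_def2 in HN2. rewrite Rminus_0_r in HN1.
    pose proof (rt_pos n). pose proof (pow_lt _ 3 H).
    assert (0 < c n).
    { nra. }
    replace (a' n) with (a' n * rt n ^ 3 / (c n * rt n ^ 3) * c n) by (field; lra).
    rewrite Rabs_mult, (Rabs_pos_eq (c n)) by lra. apply Rmult_le_compat_r; lra. }
  set (M := sum_f_R0 (fun n => Rabs (a' n) * INR n) N).
  assert (HM : 0 <= M).
  { apply cond_pos_sum; intros; apply Rmult_le_pos; [apply Rabs_pos|apply pos_INR]. }
  (* If s = sqrt (1 - x) is below [r], then s M <= eps/2; hence the radius r^2. *)
  set (r := eps / (2 * (M + 1))).
  assert (Hr : 0 < r) by (apply Rdiv_lt_0_compat; lra).
  exists (r * r); split; [nra|]. intros x Ax Hx0 Hx HAx.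
  assert (Hx1 : 0 <= x <= 1) by lra.
  set (s := sqrt (1 - x)).
  assert (Hs : 0 < s) by (apply sqrt_lt_R0; lra).
  assert (Hss : s * s = 1 - x) by (apply sqrt_sqrt; lra).
  assert (Hser : forall b B Bx, is_series b B -> is_series (fun n => b n * x ^ n) Bx ->
     is_lim_seq (fun n => sum_f_R0 (fun i => b i * (1 - x ^ i)) n) (B - Bx)).
  { intros b B Bx H1 H2. apply is_lim_seq_ext with
      (fun n => sum_f_R0 b n - sum_f_R0 (fun i => b i * x ^ i) n).
    { intros n; rewrite <- minus_sum; apply sum_eq; intros; ring. }
    apply is_lim_seq_minus'; now apply series_lim. }
  pose proof (Hser a A Ax HA HAx) as La.
  pose proof (Hser c 1 _ sqrt_series_one (sqrt_series x ltac:(lra))) as Lc.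
  replace (1 - (1 - sqrt (1 - x))) with s in Lc by (unfold s; ring).
  assert (Hpart : forall m, Rabs (sum_f_R0 (fun i => a' i * (1 - x ^ i)) m) <= eps * s).
  { intros m. eapply Rle_trans; [apply sum_abs|].
    apply Rle_trans with (eps / 2 * sum_f_R0 (fun i => c i * (1 - x ^ i)) m
       + sum_f_R0 (fun i => if (i <=? N)%nat then Rabs (a' i) * INR i * (1 - x) else 0) m).
    { rewrite <- sum_scal_l, <- plus_sum. apply sum_Rle; intros i Hi.
      pose proof (one_minus_pow x i Hx1). rewrite Rabs_mult, (Rabs_pos_eq (1 - _)) by lra.
      pose proof (Rabs_pos (a' i)). specialize (Hc i).
      assert (0 <= c i * (1 - x ^ i)) by (apply Rmult_le_pos; lra).
      destruct (Nat.leb_spec i N).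
      - nra.
      - specialize (Hb i ltac:(lia)).
        assert (Rabs (a' i) * (1 - x ^ i) <= eps / 2 * c i * (1 - x ^ i))
          by (apply Rmult_le_compat_r; lra). lra. }
    assert (H1 : sum_f_R0 (fun i => c i * (1 - x ^ i)) m <= s).
    { apply (is_lim_seq_incr_compare _ _ Lc). intros k; rewrite tech5.
      pose proof (one_minus_pow x (S k) Hx1).
      assert (0 <= c (S k) * (1 - x ^ S k)) by (apply Rmult_le_pos; [apply Hc|lra]). lra. }
    assert (H2 : sum_f_R0 (fun i => if (i <=? N)%nat then Rabs (a' i) * INR i * (1 - x) else 0) m
       <= (1 - x) * M).
    { apply Rle_trans with (sum_f_R0 (fun i => if (i <=? N)%nat then Rabs (a' i) * INR i * (1 - x) else 0) (m + N)).
      - apply sum_le_extend; [|lia]. intros i; destruct (i <=? N)%nat; [|lra].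
        pose proof (Rabs_pos (a' i)). pose proof (pos_INR i).
        apply Rmult_le_pos; [nra|lra].
      - rewrite sum_restrict by lia. unfold M; rewrite <- sum_scal_l.
        apply Req_le, sum_eq; intros; ring. }
    assert (s * M <= eps / 2).
    { apply Rle_trans with (r * (M + 1)); [nra|]. unfold r. apply Req_le; field; lra. }
    nra. }
  assert (Llim : is_lim_seq (fun n => sum_f_R0 (fun i => a' i * (1 - x ^ i)) n)
     (A - Ax - L / kap * s)).
  { apply is_lim_seq_ext with (fun n => sum_f_R0 (fun i => a i * (1 - x ^ i)) n
      - L / kap * sum_f_R0 (fun i => c i * (1 - x ^ i)) n).
    { intros n; rewrite <- sum_scal_l, <- minus_sum. apply sum_eq; intros; unfold a'; ring. }
    apply is_lim_seq_minus'; [exact La|].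
    apply is_lim_seq_mult'; [apply is_lim_seq_const|exact Lc]. }
  apply is_lim_seq_abs in Llim; simpl in Llim.
  exact (is_lim_seq_le _ _ _ _ Hpart Llim (is_lim_seq_const _)).
Qed.
End SqrtSeries.

(** * Continuity theorem for generating functions *)

Section GeneratingFunctions.
Variables (a : nat -> nat -> R) (N : nat -> nat) (f : R -> R) (v1 : R).
Hypothesis Hv1 : 0 < v1.
Hypothesis HN : forall n, (n <= N n)%nat.
Hypothesis Ha : forall n k, 0 <= a n k.
Hypothesis Ha0 : forall n k, (N n < k)%nat -> a n k = 0.
Hypothesis Hf : forall v, 0 <= v <= v1 ->
  is_lim_seq (fun n => sum_f_R0 (fun k => a n k * v ^ k) (N n)) (f v).

Lemma gf_bound :
  exists K, 0 < K /\ forall n m, sum_f_R0 (fun k => a n k * v1 ^ k) m <= K.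
Proof.
  destruct (lim_bounded _ _ (Hf v1 ltac:(lra))) as [K [HK HB]]. exists K; split; [exact HK|].
  intros n m.
  assert (Hp : forall k, 0 <= a n k * v1 ^ k).
  { intros; apply Rmult_le_pos; auto. apply pow_le; lra. }
  apply Rle_trans with (sum_f_R0 (fun k => a n k * v1 ^ k) (m + N n)).
  - apply sum_le_extend; [exact Hp|lia].
  - rewrite (sum_extend_zero _ (N n)); [|intros i Hi; rewrite Ha0 by lia; ring|lia].
    eapply Rle_trans; [apply Rle_abs|apply HB].
Qed.

(* Once the first k limits are known, [a n k] is squeezed, up to O(v), by the normalised
   tail of the generating function at v, which converges; let v tend to 0. *)
Lemma gf_coef_lim k : ex_finite_lim_seq (fun n => a n k).
Proof.
  destruct gf_bound as [K [HK HB]].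
  induction k as [k IH] using (well_founded_induction lt_wf).
  apply ex_lim_seq_cauchy_corr. intros [eps Heps]; simpl.
  set (C := K / v1 ^ S k).
  assert (HC : 0 < C) by (apply Rdiv_lt_0_compat; [auto|apply pow_lt; auto]).
  set (v := Rmin v1 (eps / (4 * C))).
  assert (Hv0 : 0 < v) by (apply Rmin_glb_lt; [auto|apply Rdiv_lt_0_compat; lra]).
  assert (Hvv : v <= v1) by apply Rmin_l.
  assert (Hve : v * C <= eps / 4).
  { apply Rle_trans with (eps / (4 * C) * C).
    - apply Rmult_le_compat_r; [lra|apply Rmin_r].
    - apply Req_le; field; lra. }
  assert (Hvk := pow_lt v k Hv0).
  set (g := fun n => (sum_f_R0 (fun j => a n j * v ^ j) (N n)
     - match k with O => 0 | S k' => sum_f_R0 (fun j => a n j * v ^ j) k' end) / v ^ k).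
  assert (Hg : ex_finite_lim_seq g).
  { assert (Hlow : ex_finite_lim_seq (fun n =>
       match k with O => 0 | S k' => sum_f_R0 (fun j => a n j * v ^ j) k' end)).
    { destruct k as [|k']; [exists 0; apply is_lim_seq_const|].
      assert (forall m, (m <= k')%nat -> ex_finite_lim_seq (fun n => sum_f_R0 (fun j => a n j * v ^ j) m)).
      { induction m as [|m IHm]; intros Hm.
        - destruct (IH 0%nat ltac:(lia)) as [l Hl]. exists (l * v ^ 0).
          apply is_lim_seq_mult'; [exact Hl|apply is_lim_seq_const].
        - destruct (IHm ltac:(lia)) as [l1 Hl1].
          destruct (IH (S m) ltac:(lia)) as [l2 Hl2]. exists (l1 + l2 * v ^ S m).
          apply is_lim_seq_plus'; [exact Hl1|].
          apply is_lim_seq_mult'; [exact Hl2|apply is_lim_seq_const]. }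
      now apply H. }
    destruct Hlow as [l Hl]. exists ((f v - l) * / v ^ k).
    apply is_lim_seq_mult'; [|apply is_lim_seq_const].
    apply is_lim_seq_minus'; [apply Hf; lra|exact Hl]. }
  assert (Hsq : forall n, (k <= n)%nat -> a n k <= g n <= a n k + v * C).
  { intros n Hn.
    assert (Hp : forall j, 0 <= a n j * v ^ j).
    { intros; apply Rmult_le_pos; auto. apply pow_le; lra. }
    assert (Hsplit : forall m, (k <= m)%nat ->
      a n k * v ^ k <= sum_f_R0 (fun j => a n j * v ^ j) m
         - match k with O => 0 | S k' => sum_f_R0 (fun j => a n j * v ^ j) k' end
      <= a n k * v ^ k + v ^ k * v / v1 ^ S k *
        (sum_f_R0 (fun j => a n j * v1 ^ j) m - sum_f_R0 (fun j => a n j * v1 ^ j) k)).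
    { intros m Hm. induction Hm as [|m Hm IHm].
      - destruct k; simpl; lra.
      - rewrite !(tech5 _ m). specialize (Hp (S m)).
        assert (a n (S m) * v ^ S m <= v ^ k * v / v1 ^ S k * (a n (S m) * v1 ^ S m)); [|lra].
        pose proof (pow_lt v1 (S k) Hv1).
        replace (v ^ k * v / v1 ^ S k * (a n (S m) * v1 ^ S m)) with
          (a n (S m) * (v ^ S k * v1 ^ (m - k))).
        + apply Rmult_le_compat_l; [auto|].
          replace (v ^ S m) with (v ^ S k * v ^ (m - k)) by (rewrite <- pow_add; f_equal; lia).
          apply Rmult_le_compat_l; [apply pow_le; lra|]. apply pow_incr; lra.
        + replace (v1 ^ S m) with (v1 ^ S k * v1 ^ (m - k)) by (rewrite <- pow_add; f_equal; lia).
          change (v ^ S k) with (v * v ^ k). field; lra. }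
    specialize (Hsplit (N n) ltac:(specialize (HN n); lia)).
    assert (Hp1 : forall j, 0 <= a n j * v1 ^ j).
    { intros; apply Rmult_le_pos; auto. apply pow_le; lra. }
    pose proof (HB n (N n)). pose proof (cond_pos_sum _ k Hp1).
    assert (H3 : v ^ k * v / v1 ^ S k *
        (sum_f_R0 (fun j => a n j * v1 ^ j) (N n) - sum_f_R0 (fun j => a n j * v1 ^ j) k)
        <= v ^ k * (v * C)).
    { replace (v ^ k * (v * C)) with (v ^ k * v / v1 ^ S k * K) by (unfold C, Rdiv; ring).
      apply Rmult_le_compat_l; [|lra]. apply Rdiv_le_0_compat; [nra|apply pow_lt; auto]. }
    unfold g; split.
    - apply Rmult_le_reg_r with (v ^ k); [auto|].
      unfold Rdiv; rewrite Rmult_assoc, Rinv_l by lra. lra.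
    - apply Rmult_le_reg_r with (v ^ k); [auto|].
      unfold Rdiv; rewrite Rmult_assoc, Rinv_l by lra. lra. }
  apply ex_lim_seq_cauchy_corr in Hg.
  assert (He4 : 0 < eps / 4) by lra.
  destruct (Hg (mkposreal _ He4)) as [M HM]; simpl in HM.
  exists (M + k)%nat; intros n m Hn Hm.
  specialize (HM n m ltac:(lia) ltac:(lia)). apply Rabs_def2 in HM.
  pose proof (Hsq n ltac:(lia)). pose proof (Hsq m ltac:(lia)).
  apply Rabs_def1; lra.
Qed.

(** The bound at [v1] gives a n k v^k <= K (v / v1)^k uniformly in n, so limit and sum can be
    exchanged for v strictly below [v1]. *)
Lemma gf_continuity :
  exists l : nat -> R, (forall k, is_lim_seq (fun n => a n k) (l k)) /\
    forall v, 0 <= v < v1 -> is_series (fun k => l k * v ^ k) (f v).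
Proof.
  destruct gf_bound as [K [HK HB]].
  exists (fun k => real (Lim_seq (fun n => a n k))).
  assert (Hl : forall k, is_lim_seq (fun n => a n k) (real (Lim_seq (fun n => a n k)))).
  { intros k; apply Lim_seq_correct'. apply gf_coef_lim. }
  split; [exact Hl|]. intros v Hv.
  set (l := fun k => real (Lim_seq (fun n => a n k))) in *.
  set (r := v / v1).
  assert (Hr : 0 <= r < 1).
  { unfold r; split; [apply Rdiv_le_0_compat; lra|].
    apply Rmult_lt_reg_r with v1; [auto|]. unfold Rdiv; rewrite Rmult_assoc, Rinv_l; lra. }
  assert (HF : forall n k, a n k * v ^ k <= K * r ^ k).
  { intros n k.
    assert (Hp1 : forall j, 0 <= a n j * v1 ^ j).
    { intros; apply Rmult_le_pos; auto. apply pow_le; lra. }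
    pose proof (sum_term_le _ k k Hp1 (le_n k)) as H.
    specialize (HB n k). replace (v ^ k) with (v1 ^ k * r ^ k).
    - rewrite <- Rmult_assoc. apply Rmult_le_compat_r; [apply pow_le; lra|lra].
    - rewrite <- Rpow_mult_distr. f_equal. unfold r; field; lra. }
  assert (HG : ex_series (fun k => K * r ^ k)).
  { exists (K * / (1 - r)). apply (is_series_scal K (fun k => r ^ k) (/ (1 - r))).
    apply is_series_geom. rewrite Rabs_pos_eq; lra. }
  assert (Hlv : forall k, 0 <= l k * v ^ k <= K * r ^ k).
  { intros k.
    assert (Hlk : is_lim_seq (fun n => a n k * v ^ k) (l k * v ^ k))
      by (apply is_lim_seq_mult'; [apply Hl|apply is_lim_seq_const]).
    split.
    - apply (is_lim_seq_le (fun _ => 0) _ 0 _ (fun n => Rmult_le_pos _ _ (Ha n k) (pow_le v k (proj1 Hv)))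
        (is_lim_seq_const 0) Hlk).
    - apply (is_lim_seq_le _ (fun _ => K * r ^ k) _ (K * r ^ k) (fun n => HF n k) Hlk
        (is_lim_seq_const _)). }
  destruct HG as [SG HSG].
  destruct (ex_series_bounded (fun k => l k * v ^ k) SG) as [S [HS _]].
  { apply Hlv. }
  { intros n. apply Rle_trans with (sum_f_R0 (fun k => K * r ^ k) n).
    - apply sum_Rle; intros; apply Hlv.
    - apply sum_le_series; [|exact HSG]. intros i; specialize (Hlv i); lra. }
  replace (f v) with S; [exact HS|].
  assert (H1 : is_lim_seq (fun n => sum_f_R0 (fun k => a n k * v ^ k) (N n)) S).
  { apply tannery with (F := fun n k => a n k * v ^ k) (f := fun k => l k * v ^ k)
      (G := fun k => K * r ^ k); auto.
    - intros k. apply is_lim_seq_mult'; [apply Hl|apply is_lim_seq_const].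
    - intros n k. rewrite Rabs_pos_eq; [apply HF|].
      apply Rmult_le_pos; auto. apply pow_le; lra.
    - now exists SG. }
  pose proof (Hf v ltac:(lra)) as H2.
  apply is_lim_seq_unique in H1. apply is_lim_seq_unique in H2.
  rewrite H1 in H2. now inversion H2.
Qed.
End GeneratingFunctions.

(** * Measures on Z and Spitzer's identity *)

(* A finitely supported measure on Z is a list of (atom, mass); [integ] integrates against it. *)
Definition integ (l : list (Z * R)) (f : Z -> R) : R :=
  fold_right (fun a acc => snd a * f (fst a) + acc) 0 l.

Definition mconv (l1 l2 : list (Z * R)) : list (Z * R) :=
  flat_map (fun a => map (fun b => ((fst a + fst b)%Z, snd a * snd b)) l2) l1.

Definition nonneg_part (l : list (Z * R)) : list (Z * R) :=
  filter (fun a => (0 <=? fst a)%Z) l.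

Definition cut (f : Z -> R) (x : Z) : R := if (0 <=? x)%Z then f x else 0.
Definition cutneg (f : Z -> R) (x : Z) : R := if (0 <=? x)%Z then 0 else f x.

Lemma integ_ext_in l f g :
  (forall a, In a l -> f (fst a) = g (fst a)) -> integ l f = integ l g.
Proof.
  induction l as [|a l IH]; intros H; simpl; [reflexivity|].
  rewrite H, IH; [reflexivity| |now left]. intros b Hb; apply H; now right.
Qed.

Lemma integ_ext l f g : (forall x, f x = g x) -> integ l f = integ l g.
Proof. intros H; apply integ_ext_in; auto. Qed.

Lemma integ_plus l f g : integ l (fun x => f x + g x) = integ l f + integ l g.
Proof. induction l as [|a l IH]; simpl; [ring|rewrite IH; ring]. Qed.

Lemma integ_scal l c f : integ l (fun x => c * f x) = c * integ l f.
Proof. induction l as [|a l IH]; simpl; [ring|rewrite IH; ring]. Qed.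

Lemma integ_zero l f : (forall x, f x = 0) -> integ l f = 0.
Proof. intros H; induction l as [|a l IH]; simpl; [ring|rewrite IH, H; ring]. Qed.

Lemma integ_app l1 l2 f : integ (l1 ++ l2) f = integ l1 f + integ l2 f.
Proof. induction l1 as [|a l IH]; simpl; [ring|rewrite IH; ring]. Qed.

Lemma integ_exchange l1 l2 (h : Z -> Z -> R) :
  integ l1 (fun x => integ l2 (fun y => h x y))
  = integ l2 (fun y => integ l1 (fun x => h x y)).
Proof.
  induction l1 as [|a l IH]; simpl.
  - symmetry; now apply integ_zero.
  - rewrite IH, integ_plus, integ_scal; reflexivity.
Qed.

Lemma integ_mconv l1 l2 f :
  integ (mconv l1 l2) f = integ l1 (fun x => integ l2 (fun y => f (x + y)%Z)).
Proof.
  induction l1 as [|a l IH]; simpl; [reflexivity|].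
  rewrite integ_app, IH; f_equal. rewrite <- integ_scal. clear IH.
  induction l2 as [|b l2 IH2]; simpl; [reflexivity|]. rewrite IH2; ring.
Qed.

Lemma integ_nonneg_part l f : integ (nonneg_part l) f = integ l (cut f).
Proof.
  induction l as [|a l IH]; simpl; [reflexivity|].
  unfold cut at 1; destruct (0 <=? fst a)%Z; simpl; rewrite IH; ring.
Qed.

Lemma integ_cut_split l f : integ l f = integ l (cut f) + integ l (cutneg f).
Proof.
  rewrite <- integ_plus; apply integ_ext; intros x; unfold cut, cutneg.
  destruct (0 <=? x)%Z; ring.
Qed.

Lemma integ_le l f g :
  (forall a, In a l -> 0 <= snd a) -> (forall a, In a l -> f (fst a) <= g (fst a)) ->
  integ l f <= integ l g.
Proof.
  induction l as [|a l IH]; intros Hl H; simpl; [lra|].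
  apply Rplus_le_compat.
  - apply Rmult_le_compat_l; [apply Hl|apply H]; now left.
  - apply IH; intros b Hb; [apply Hl|apply H]; now right.
Qed.

Lemma integ_ge0 l f :
  (forall a, In a l -> 0 <= snd a) -> (forall a, In a l -> 0 <= f (fst a)) ->
  0 <= integ l f.
Proof.
  intros Hl Hf. rewrite <- (integ_zero l (fun _ => 0)) by reflexivity.
  apply integ_le; auto.
Qed.

Lemma integ_sum l (F : nat -> Z -> R) n :
  integ l (fun x => sum_f_R0 (fun j => F j x) n) = sum_f_R0 (fun j => integ l (F j)) n.
Proof.
  induction n as [|n IH]; simpl; [reflexivity|]. rewrite integ_plus, IH; reflexivity.
Qed.

Lemma in_mconv l1 l2 a : In a (mconv l1 l2) ->
  exists b e, In b l1 /\ In e l2 /\ fst a = (fst b + fst e)%Z /\ snd a = snd b * snd e.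
Proof.
  intros H; apply in_flat_map in H; destruct H as [b [Hb H]].
  apply in_map_iff in H; destruct H as [e [<- He]].
  exists b, e; simpl; auto.
Qed.

Fixpoint free_walk (st : list (Z * R)) (n : nat) : list (Z * R) :=
  match n with
  | O => [(0%Z, 1)]
  | S n' => mconv st (free_walk st n')
  end.

Fixpoint meander (st : list (Z * R)) (n : nat) : list (Z * R) :=
  match n with
  | O => [(0%Z, 1)]
  | S n' => nonneg_part (mconv st (meander st n'))
  end.

Definition dirac (k x : Z) : R := if Z.eqb x k then 1 else 0.

(* [v ^ x] on the nonnegative integers, with [0 ^ 0 = 1] *)
Definition zpow (v : R) (x : Z) : R := cut (fun x => v ^ Z.to_nat x) x.

Lemma zpow_add v x y : (0 <= x)%Z -> (0 <= y)%Z -> zpow v (x + y) = zpow v x * zpow v y.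
Proof.
  intros Hx Hy; unfold zpow, cut.
  rewrite !(proj2 (Z.leb_le _ _)) by lia. rewrite Z2Nat.inj_add by lia. apply pow_add.
Qed.

Lemma zpow_expand v x N : (x <= Z.of_nat N)%Z ->
  zpow v x = sum_f_R0 (fun k => v ^ k * dirac (Z.of_nat k) x) N.
Proof.
  intros H; unfold zpow, cut, dirac. destruct (Z.leb_spec 0 x) as [H0|H0].
  - rewrite <- (sum_single (fun k => v ^ k) (Z.to_nat x) N) by lia.
    apply sum_eq; intros i Hi.
    destruct (Nat.eqb_spec i (Z.to_nat x)); destruct (Z.eqb_spec x (Z.of_nat i)); try lia; ring.
  - rewrite sum_zero; [reflexivity|]. intros i Hi.
    destruct (Z.eqb_spec x (Z.of_nat i)); [lia|ring].
Qed.

Lemma integ_zpow l v N : (forall a, In a l -> (fst a <= Z.of_nat N)%Z) ->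
  integ l (zpow v) = sum_f_R0 (fun k => integ l (dirac (Z.of_nat k)) * v ^ k) N.
Proof.
  intros H.
  rewrite (integ_ext_in l _ (fun x => sum_f_R0 (fun k => v ^ k * dirac (Z.of_nat k) x) N))
    by (intros; apply zpow_expand; auto).
  rewrite integ_sum; apply sum_eq; intros. rewrite integ_scal; ring.
Qed.

Section Walk.
Variable st : list (Z * R).

Lemma free_walk_S n f :
  integ (free_walk st (S n)) f = integ st (fun i => integ (free_walk st n) (fun y => f (i + y)%Z)).
Proof. apply integ_mconv. Qed.

Lemma meander_S n f :
  integ (meander st (S n)) f
  = integ st (fun i => integ (meander st n) (fun y => cut f (i + y)%Z)).
Proof. simpl; rewrite integ_nonneg_part, integ_mconv; reflexivity. Qed.

Lemma meander_pos n a : In a (meander st n) -> (0 <= fst a)%Z.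
Proof.
  destruct n; simpl; intros H.
  - destruct H as [<-|[]]; simpl; lia.
  - apply filter_In in H; destruct H as [_ H]; now apply Z.leb_le.
Qed.

Lemma free_walk_le d n a : (forall a, In a st -> (fst a <= Z.of_nat d)%Z) ->
  In a (free_walk st n) -> (fst a <= Z.of_nat (d * n))%Z.
Proof.
  intros Hst; revert a; induction n as [|n IH]; simpl; intros a H.
  - destruct H as [<-|[]]; simpl; lia.
  - apply in_mconv in H; destruct H as [b [e [Hb [He [-> _]]]]].
    specialize (Hst b Hb). specialize (IH e He). lia.
Qed.

Lemma meander_le d n a : (forall a, In a st -> (fst a <= Z.of_nat d)%Z) ->
  In a (meander st n) -> (fst a <= Z.of_nat (d * n))%Z.
Proof.
  intros Hst; revert a; induction n as [|n IH]; simpl; intros a H.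
  - destruct H as [<-|[]]; simpl; lia.
  - apply filter_In in H; destruct H as [H _].
    apply in_mconv in H; destruct H as [b [e [Hb [He [-> _]]]]].
    specialize (Hst b Hb). specialize (IH e He). lia.
Qed.

Hypothesis Hst : forall a, In a st -> 0 <= snd a.

Lemma free_walk_mass n a : In a (free_walk st n) -> 0 <= snd a.
Proof.
  revert a; induction n as [|n IH]; simpl; intros a H.
  - destruct H as [<-|[]]; simpl; lra.
  - apply in_mconv in H; destruct H as [b [e [Hb [He [_ ->]]]]].
    apply Rmult_le_pos; auto.
Qed.

Lemma meander_mass n a : In a (meander st n) -> 0 <= snd a.
Proof.
  revert a; induction n as [|n IH]; simpl; intros a H.
  - destruct H as [<-|[]]; simpl; lra.
  - apply filter_In in H; destruct H as [H _].
    apply in_mconv in H; destruct H as [b [e [Hb [He [_ ->]]]]].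
    apply Rmult_le_pos; auto.
Qed.

Lemma meander_total n : integ st (fun _ => 1) = 1 -> integ (meander st n) (fun _ => 1) <= 1.
Proof.
  intros H; induction n as [|n IH]; [simpl; lra|].
  rewrite meander_S. apply Rle_trans with (integ st (fun _ => 1)); [|lra].
  apply integ_le; [exact Hst|]. intros a Ha.
  eapply Rle_trans; [|exact IH]. apply integ_le; [apply meander_mass|].
  intros b Hb; unfold cut; cbv beta. destruct (_ <=? _)%Z; lra.
Qed.

Definition sum_lt (f : nat -> R) (n : nat) : R :=
  match n with O => 0 | S m => sum_f_R0 f m end.

Lemma sum_lt_S f n : sum_lt f (S n) = sum_lt f n + f n.
Proof. destruct n; simpl; ring. Qed.

Lemma sum_lt_ext f g n : (forall i, (i < n)%nat -> f i = g i) -> sum_lt f n = sum_lt g n.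
Proof. intros H; destruct n; [reflexivity|]. apply sum_eq; intros; apply H; lia. Qed.

Lemma sum_lt_shift f n : sum_lt f (S n) = f O + sum_lt (fun j => f (S j)) n.
Proof.
  destruct n as [|n]; [simpl; ring|].
  change (sum_lt f (S (S n))) with (sum_f_R0 f (S n)). rewrite decomp_sum by lia; reflexivity.
Qed.

Lemma integ_sum_lt l (F : nat -> Z -> R) n :
  integ l (fun x => sum_lt (fun j => F j x) n) = sum_lt (fun j => integ l (F j)) n.
Proof. destruct n; [now apply integ_zero|apply integ_sum]. Qed.

(* Spitzer's identity, the coefficient form of
   [M(z,u) = exp (sum_n z^n/n [u^(>=0)] P(u)^n)].  In the induction step the positive part
   of a j-step walk is written as the whole walk minus its negative part; the negative parts
   telescope, because a negative walk followed by the overshoot of a meander stays negative. *)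
Lemma spitzer n f :
  INR n * integ (meander st n) f =
  sum_lt (fun j => integ (free_walk st (S j))
    (cut (fun x => integ (meander st (n - S j)) (fun y => f (x + y)%Z)))) n.
Proof.
  revert f; induction n as [|n IH]; intros f; [simpl; ring|].
  set (G := fun m x => integ (meander st m) (fun y => cut f (x + y)%Z)).
  set (Ps := fun j m => integ (free_walk st j) (cut (G m))).
  set (Ng := fun j m => integ (free_walk st j) (cutneg (G m))).
  (* The extra step moves from the free walk to the front of the meander. For x < 0, x + (i + y) >=
     0 already forces i + y >= 0, so the cut required by the longer meander is automatic. *)
  assert (Hneg : forall j m, integ st (fun i => integ (free_walk st j)
      (cutneg (fun x => G m (i + x)%Z))) = Ng j (S m)).
  { intros j m. rewrite integ_exchange. apply integ_ext; intros x.
    unfold cutneg. destruct (Z.leb_spec 0 x) as [Hx|Hx].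
    - now apply integ_zero.
    - unfold G. rewrite meander_S. apply integ_ext; intros i.
      apply integ_ext; intros y. unfold cut.
      replace (i + x + y)%Z with (x + (i + y))%Z by ring.
      destruct (Z.leb_spec 0 (x + (i + y))); destruct (Z.leb_spec 0 (i + y)); try lia; reflexivity. }
  assert (Hall : forall j m, integ st (fun i => integ (free_walk st j) (fun x => G m (i + x)%Z))
     = Ps (S j) m + Ng (S j) m).
  { intros j m. rewrite <- free_walk_S. apply integ_cut_split. }
  assert (Hpos : forall j m, integ st (fun i => integ (free_walk st j)
      (cut (fun x => G m (i + x)%Z))) = Ps (S j) m + Ng (S j) m - Ng j (S m)).
  { intros j m. rewrite <- Hall, <- Hneg.
    rewrite <- (Rmult_1_l (integ st (fun i => integ _ (cutneg _)))).
    unfold Rminus. rewrite Ropp_mult_distr_l, <- integ_scal, <- integ_plus.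
    apply integ_ext; intros i. rewrite (integ_cut_split _ (fun x => G m (i + x)%Z)). ring. }
  assert (Hfirst : integ (meander st (S n)) f = Ps 1%nat n + Ng 1%nat n).
  { rewrite meander_S, <- Hall. apply integ_ext; intros i. simpl.
    rewrite Rplus_0_r, Rmult_1_l.
    now rewrite Z.add_0_r. }
  assert (Hrest : INR n * integ (meander st (S n)) f =
     sum_lt (fun j => Ps (S (S j)) (n - S j)%nat
         + Ng (S (S j)) (n - S j)%nat - Ng (S j) (S (n - S j))) n).
  { rewrite meander_S, <- integ_scal.
    rewrite (integ_ext st _ (fun i => sum_lt (fun j => integ (free_walk st (S j))
       (cut (fun x => G (n - S j)%nat (i + x)%Z))) n)).
    - rewrite integ_sum_lt. apply sum_lt_ext; intros j Hj. apply Hpos.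
    - intros i. rewrite IH. apply sum_lt_ext; intros j Hj. apply integ_ext; intros x.
      unfold cut at 1 3. destruct (0 <=? x)%Z; [|reflexivity].
      apply integ_ext; intros y. now rewrite Z.add_assoc. }
  assert (Htel : forall k, (k <= n)%nat ->
     sum_lt (fun j => Ps (S (S j)) (n - S j)%nat
         + Ng (S (S j)) (n - S j)%nat - Ng (S j) (S (n - S j))) k
     = sum_lt (fun j => Ps (S (S j)) (n - S j)%nat) k + Ng (S k) (n - k)%nat - Ng 1%nat n).
  { induction k as [|k IHk]; intros Hk.
    - simpl. rewrite Nat.sub_0_r. ring.
    - rewrite !sum_lt_S, IHk by lia. replace (S (n - S k)) with (n - k)%nat by lia. ring. }
  assert (Hlast : Ng (S n) 0%nat = 0).
  { apply integ_zero; intros x. unfold cutneg, G, cut; simpl.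
    rewrite Z.add_0_r. destruct (0 <=? x)%Z; ring. }
  rewrite S_INR, Rmult_plus_distr_r, Rmult_1_l, Hrest, Hfirst, Htel, Nat.sub_diag, Hlast by lia.
  rewrite sum_lt_shift.
  rewrite (sum_lt_ext (fun j => integ (free_walk st (S (S j)))
    (cut (fun x => integ (meander st (S n - S (S j))) (fun y => f (x + y)%Z))))
    (fun j => Ps (S (S j)) (n - S j)%nat)).
  - replace (integ (free_walk st 1) (cut (fun x => integ (meander st (S n - 1)) (fun y => f (x + y)%Z))))
      with (Ps 1%nat n); [ring|].
    replace (S n - 1)%nat with n by lia. apply integ_ext; intros x.
    unfold cut at 1 2. destruct (Z.leb_spec 0 x); [|reflexivity].
    apply integ_ext_in; intros a Ha. apply meander_pos in Ha. unfold cut.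
    rewrite (proj2 (Z.leb_le _ _)) by lia. reflexivity.
  - intros j Hj.
    apply integ_ext; intros x. unfold cut at 1 2.
    destruct (Z.leb_spec 0 x); [|reflexivity].
    apply integ_ext_in; intros a Ha. apply meander_pos in Ha. unfold cut.
    rewrite (proj2 (Z.leb_le _ _)) by lia. reflexivity.
Qed.

Definition pos_gf (v : R) (j : nat) : R :=
  match j with O => 0 | _ => integ (free_walk st j) (zpow v) end.

(** [zpow v] is multiplicative on nonnegative altitudes, so Spitzer's identity factorises into the
    hypothesis of [exp_closure]. Its sum starts at one step, which is why [pos_gf] is 0 at j = 0. *)
Lemma spitzer_gf v n :
  INR n * integ (meander st n) (zpow v)
  = conv (pos_gf v) (fun m => integ (meander st m) (zpow v)) n.
Proof.
  rewrite spitzer. destruct n as [|n]; [unfold conv; simpl; ring|].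
  rewrite conv_S. rewrite Rmult_0_l, Rplus_0_l.
  apply sum_eq; intros j Hj. simpl (pos_gf v (S j)).
  rewrite Rmult_comm, <- integ_scal. apply integ_ext; intros x.
  unfold cut. destruct (Z.leb_spec 0 x) as [Hx|Hx].
  - rewrite Rmult_comm, <- integ_scal. apply integ_ext_in; intros a Ha.
    apply meander_pos in Ha. now apply zpow_add.
  - unfold zpow, cut. rewrite (proj2 (Z.leb_gt _ _)) by lia. ring.
Qed.
End Walk.

(** * Gaussian integrals *)

Lemma sin_le_id x : 0 <= x -> sin x <= x.
Proof. intros [H|<-]; [left; now apply sin_lt_x|rewrite sin_0; lra]. Qed.

Lemma cos_ge_quadratic x : 1 - x * x / 2 <= cos x.
Proof.
  assert (H : forall y, 0 <= y -> 1 - y * y / 2 <= cos y).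
  { intros y Hy. replace y with (2 * (y / 2)) at 3 by field. rewrite cos_2a_sin.
    pose proof (sin_le_id (y / 2) ltac:(lra)).
    assert (- (y / 2) <= sin (y / 2)).
    { destruct (Rle_dec y 2).
      - assert (0 <= sin (y / 2)); [|lra].
        apply sin_ge_0; [lra|]. pose proof PI2_1. lra.
      - pose proof (SIN_bound (y / 2)). lra. }
    nra. }
  destruct (Rle_dec 0 x); [now apply H|].
  rewrite <- cos_neg. replace (x * x) with (- x * - x) by ring. apply H; lra.
Qed.

Lemma sin_ge_cubic x : 0 <= x -> x - x ^ 3 / 6 <= sin x.
Proof.
  intros [Hx|<-]; [|rewrite sin_0; lra].
  destruct (MVT_cor2 (fun x => sin x - x + x ^ 3 / 6) (fun x => cos x - 1 + x * x / 2) 0 x Hx)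
    as [c [Hc1 Hc2]].
  - intros c Hc. auto_derive; [trivial|]. field.
  - rewrite sin_0 in Hc1. pose proof (cos_ge_quadratic c). nra.
Qed.

Lemma sin_taylor x : Rabs (sin x - x) <= Rabs x ^ 3.
Proof.
  assert (H : forall y, 0 <= y -> Rabs (sin y - y) <= Rabs y ^ 3).
  { intros y Hy. rewrite (Rabs_pos_eq y) by lra.
    pose proof (sin_ge_cubic y Hy). pose proof (sin_le_id y Hy).
    apply Rabs_le; lra. }
  destruct (Rle_dec 0 x); [now apply H|].
  specialize (H (- x) ltac:(lra)). rewrite sin_neg, Rabs_Ropp in H.
  replace (- sin x - - x) with (- (sin x - x)) in H by ring. now rewrite Rabs_Ropp in H.
Qed.

Lemma cos_taylor x : Rabs (cos x - 1 + x * x / 2) <= Rabs x ^ 3.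
Proof.
  assert (H : forall y, 0 <= y -> Rabs (cos y - 1 + y * y / 2) <= Rabs y ^ 3).
  { intros y Hy. rewrite (Rabs_pos_eq y) by lra.
    pose proof (cos_ge_quadratic y). pose proof (pow_le y 3 Hy).
    apply Rabs_le; split; [lra|].
    destruct (Rle_dec y 2) as [H2|H2].
    - replace y with (2 * (y / 2)) at 1 by field. rewrite cos_2a_sin.
      set (z := y / 2) in *. assert (Hz : 0 <= z <= 1) by (unfold z; lra).
      pose proof (sin_ge_cubic z ltac:(lra)).
      assert (0 <= z - z ^ 3 / 6) by nra.
      assert ((z - z ^ 3 / 6) * (z - z ^ 3 / 6) <= sin z * sin z) by nra.
      replace y with (2 * z) by (unfold z; field).
      assert (z ^ 4 <= z ^ 3) by (simpl; assert (0 <= z * z * z) by nra; nra).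
      assert (0 <= z ^ 6) by (apply pow_le; lra).
      assert (0 <= z ^ 3) by (apply pow_le; lra).
      lra.
    - pose proof (COS_bound y). assert (y * y / 2 <= y ^ 3) by (simpl; nra). lra. }
  destruct (Rle_dec 0 x); [now apply H|].
  specialize (H (- x) ltac:(lra)). rewrite cos_neg, Rabs_Ropp in H.
  replace (- x * - x) with (x * x) in H by ring. exact H.
Qed.

Lemma exp_ge_id x : 1 + x <= exp x.
Proof. destruct (Req_dec x 0) as [->|H]; [rewrite exp_0; lra|left; now apply exp_ineq1]. Qed.

Lemma exp_le_compat x y : x <= y -> exp x <= exp y.
Proof. intros [H| ->]; [left; now apply exp_increasing|lra]. Qed.

Lemma exp_neg_taylor y : 0 <= y -> Rabs (exp (- y) - 1 + y) <= y * y.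
Proof.
  intros Hy. pose proof (exp_ge_id (- y)). apply Rabs_le; split; [nra|].
  pose proof (exp_ge_id y). rewrite exp_Ropp.
  assert (/ exp y <= / (1 + y)) by (apply Rinv_le_contravar; lra).
  assert (/ (1 + y) <= 1 - y + y * y).
  { apply Rmult_le_reg_r with (1 + y); [lra|]. rewrite Rinv_l by lra. nra. }
  lra.
Qed.

Definition gauss (T : R) : R := RInt (fun t => exp (- (t * t))) 0 T.

Lemma gauss_cont t : continuous (fun t => exp (- (t * t))) t.
Proof.
  apply (ex_derive_continuous (fun t => exp (- (t * t)))). auto_derive; trivial.
Qed.

Lemma gauss_is_RInt a b : ex_RInt (fun t => exp (- (t * t))) a b.
Proof. apply (ex_RInt_continuous (V := R_CompleteNormedModule)); intros; apply gauss_cont. Qed.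

Lemma gauss_mono S T : S <= T -> gauss S <= gauss T.
Proof.
  intros H. unfold gauss.
  rewrite <- (RInt_Chasles (fun t => exp (- (t * t))) 0 S T) by apply gauss_is_RInt.
  assert (0 <= RInt (fun t => exp (- (t * t))) S T).
  { apply RInt_ge_0; [exact H|apply gauss_is_RInt|]. intros; left; apply exp_pos. }
  change (plus ?x ?y) with (x + y). lra.
Qed.

Lemma gauss_bound T : 0 <= T -> gauss T <= PI / 2.
Proof.
  intros HT.
  assert (HI : is_RInt (fun t => / (1 + t * t)) 0 T (atan T - atan 0)).
  { apply (is_RInt_derive (V := R_CompleteNormedModule) atan (fun t => / (1 + t * t))).
    - intros x _. apply is_derive_Reals.
      replace (/ (1 + x * x)) with (/ (1 + x ^ 2)) by (f_equal; ring).
      apply derivable_pt_lim_atan.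
    - intros x _. apply (ex_derive_continuous (fun t => / (1 + t * t))).
      auto_derive; nra. }
  apply Rle_trans with (atan T - atan 0).
  - apply (is_RInt_le (fun t => exp (- (t * t))) (fun t => / (1 + t * t)) 0 T);
      [exact HT|apply (RInt_correct (V := R_CompleteNormedModule)), gauss_is_RInt|exact HI|].
    intros x _. rewrite exp_Ropp. apply Rinv_le_contravar; [nra|apply exp_ge_id].
  - rewrite atan_0. pose proof (atan_bound T). lra.
Qed.

(** The Gaussian integral over the half-line, that is sqrt PI / 2, kept as a symbol. *)
Definition gauss_lim : R := real (Lim_seq (fun n => gauss (INR n))).

Lemma gauss_lim_spec : is_lim_seq (fun n => gauss (INR n)) gauss_lim.
Proof.
  apply Lim_seq_correct'. apply ex_finite_lim_seq_incr with (PI / 2).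
  - intros n; apply gauss_mono; rewrite S_INR; lra.
  - intros n; apply gauss_bound, pos_INR.
Qed.

Lemma gauss_le_lim T : gauss T <= gauss_lim.
Proof.
  destruct (INR_unbounded T) as [N HN].
  apply Rle_trans with (gauss (INR N)); [apply gauss_mono; lra|].
  apply (is_lim_seq_incr_compare _ _ gauss_lim_spec).
  intros n; apply gauss_mono; rewrite S_INR; lra.
Qed.

Lemma gauss_lim_pos : 0 < gauss_lim.
Proof.
  apply Rlt_le_trans with (gauss 1); [|apply gauss_le_lim].
  apply RInt_gt_0; [lra| |].
  - intros; apply exp_pos.
  - intros; apply gauss_cont.
Qed.

Lemma gauss_lim_seq (T : nat -> R) :
  is_lim_seq T p_infty -> is_lim_seq (fun n => gauss (T n)) gauss_lim.
Proof.
  intros H. apply lim_eps; intros eps Heps.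
  destruct (proj1 (lim_eps _ _) gauss_lim_spec eps Heps) as [N HN].
  destruct (proj2 (is_lim_seq_spec _ _) H (INR N)) as [M HM].
  exists M; intros n Hn. specialize (HN N (le_n N)). specialize (HM n Hn).
  pose proof (gauss_mono (INR N) (T n) ltac:(lra)). pose proof (gauss_le_lim (T n)).
  apply Rabs_def2 in HN. apply Rabs_def1; lra.
Qed.

Lemma gauss_scale y : 0 < y ->
  is_RInt (fun t => exp (- (y * (t * t)))) 0 PI (gauss (PI * sqrt y) / sqrt y).
Proof.
  intros Hy. assert (Hs : 0 < sqrt y) by now apply sqrt_lt_R0.
  assert (Hss : sqrt y * sqrt y = y) by (apply sqrt_sqrt; lra).
  apply is_RInt_ext with (fun t => scal (/ sqrt y)
    (scal (sqrt y) (exp (- ((sqrt y * t + 0) * (sqrt y * t + 0)))))).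
  { intros t _.
    rewrite <- Rmult_assoc, Rinv_l, Rmult_1_l by lra. f_equal.
    rewrite <- Hss at 3. ring. }
  replace (gauss (PI * sqrt y) / sqrt y) with (scal (/ sqrt y) (gauss (PI * sqrt y)))
    by (unfold scal; simpl; unfold mult; simpl; field; lra).
  apply (is_RInt_scal (V := R_NormedModule)).
  apply (is_RInt_comp_lin (V := R_NormedModule) (fun t => exp (- (t * t)))).
  replace (sqrt y * 0 + 0) with 0 by ring. replace (sqrt y * PI + 0) with (PI * sqrt y) by ring.
  apply (RInt_correct (V := R_CompleteNormedModule)), gauss_is_RInt.
Qed.

Lemma is_RInt_linear_gauss z : 0 < z ->
  is_RInt (fun t => t * exp (- (z * (t * t)))) 0 PI ((1 - exp (- (z * (PI * PI)))) / (2 * z)).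
Proof.
  intros Hz.
  replace ((1 - exp (- (z * (PI * PI)))) / (2 * z)) with
    (minus ((fun t => - exp (- (z * (t * t))) / (2 * z)) PI)
           ((fun t => - exp (- (z * (t * t))) / (2 * z)) 0)).
  - apply (is_RInt_derive (V := R_CompleteNormedModule)
      (fun t => - exp (- (z * (t * t))) / (2 * z))).
    + intros x _. auto_derive; [lra|]. field; lra.
    + intros x _. apply (ex_derive_continuous (fun t => t * exp (- (z * (t * t))))).
      auto_derive; trivial.
  - unfold minus, plus, opp; simpl. replace (- (z * (0 * 0))) with 0 by ring.
    rewrite exp_0. field; lra.
Qed.

Lemma is_RInt_cos_Z (m : Z) :
  is_RInt (fun t => cos (IZR m * t)) 0 PI (if Z.eqb m 0 then PI else 0).
Proof.
  destruct (Z.eqb_spec m 0) as [->|Hm].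
  - apply is_RInt_ext with (fun _ => 1).
    { intros; rewrite Rmult_0_l, cos_0; reflexivity. }
    replace PI with (scal (PI - 0) 1) at 2 by (unfold scal; simpl; unfold mult; simpl; ring).
    apply (is_RInt_const (V := R_NormedModule)).
  - assert (Hm' : IZR m <> 0) by now apply not_0_IZR.
    replace 0 with (minus ((fun t => sin (IZR m * t) / IZR m) PI)
       ((fun t => sin (IZR m * t) / IZR m) 0)) at 2.
    + apply (is_RInt_derive (V := R_CompleteNormedModule) (fun t => sin (IZR m * t) / IZR m)).
      * intros x _. auto_derive; [trivial|]. field; auto.
      * intros x _. apply (ex_derive_continuous (fun t => cos (IZR m * t))).
        auto_derive; trivial.
    + unfold minus, plus, opp; simpl. rewrite Rmult_0_r, sin_0.
      replace (sin (IZR m * PI)) with 0; [field; auto|].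
      symmetry; apply sin_eq_0_1. now exists m.
Qed.

(** Real form on half a period: the real part of the usual integrand is even in t, so cosines on
    [0, PI] suffice. *)
Lemma fourier_inversion l k :
  is_RInt (fun t => integ l (fun x => cos (IZR (x - k) * t))) 0 PI (PI * integ l (dirac k)).
Proof.
  induction l as [|a l IH]; simpl.
  - rewrite Rmult_0_r. replace 0 with (scal (PI - 0) 0) at 2
      by (unfold scal; simpl; unfold mult; simpl; ring).
    apply (is_RInt_const (V := R_NormedModule)).
  - rewrite Rmult_plus_distr_l.
    apply (is_RInt_plus (V := R_NormedModule)); [|exact IH].
    replace (PI * (snd a * dirac k (fst a)))
      with (scal (snd a) (if Z.eqb (fst a - k) 0 then PI else 0)).
    + apply (is_RInt_scal (V := R_NormedModule)), is_RInt_cos_Z.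
    + unfold scal; simpl; unfold mult; simpl. unfold dirac.
      destruct (Z.eqb_spec (fst a - k) 0); destruct (Z.eqb_spec (fst a) k); try lia; ring.
Qed.

(** * Local limit theorem *)

Definition char_fun (l : list (Z * R)) (t : R) : C :=
  (integ l (fun x => cos (IZR x * t)), integ l (fun x => sin (IZR x * t))).

Lemma char_fun_mconv l1 l2 t :
  char_fun (mconv l1 l2) t = Cmult (char_fun l1 t) (char_fun l2 t).
Proof.
  unfold char_fun, Cmult; simpl; f_equal; rewrite integ_mconv.
  - rewrite (integ_ext _ _ (fun x => integ l2 (fun y => cos (IZR y * t)) * cos (IZR x * t)
       + (- integ l2 (fun y => sin (IZR y * t))) * sin (IZR x * t))).
    + rewrite integ_plus, !integ_scal. ring.
    + intros x. rewrite Rmult_comm, <- integ_scal.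
      rewrite (Rmult_comm (- _)), Ropp_mult_distr_r_reverse, Ropp_mult_distr_l, <- integ_scal, <- integ_plus.
      apply integ_ext; intros y. rewrite plus_IZR, Rmult_plus_distr_r, cos_plus. ring.
  - rewrite (integ_ext _ _ (fun x => integ l2 (fun y => cos (IZR y * t)) * sin (IZR x * t)
       + integ l2 (fun y => sin (IZR y * t)) * cos (IZR x * t))).
    + rewrite integ_plus, !integ_scal. ring.
    + intros x. rewrite (Rmult_comm _ (sin _)), (Rmult_comm _ (cos _)), <- !integ_scal, <- integ_plus.
      apply integ_ext; intros y. rewrite plus_IZR, Rmult_plus_distr_r, sin_plus. ring.
Qed.

Lemma char_fun_walk st n t : char_fun (free_walk st n) t = Cpow (char_fun st t) n.
Proof.
  induction n as [|n IH]; simpl.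
  - unfold char_fun, RtoC; simpl. rewrite !Rmult_0_l, cos_0, sin_0.
    f_equal; ring.
  - rewrite char_fun_mconv, IH; reflexivity.
Qed.

Lemma char_fun_shift l k t :
  integ l (fun x => cos (IZR (x - k) * t))
  = cos (IZR k * t) * fst (char_fun l t) + sin (IZR k * t) * snd (char_fun l t).
Proof.
  unfold char_fun; simpl. rewrite <- !integ_scal, <- integ_plus. apply integ_ext; intros x.
  rewrite minus_IZR, Rmult_minus_distr_r, cos_minus. ring.
Qed.

Lemma Cmod_pow_le z r n : Cmod z <= r -> Cmod (Cpow z n) <= r ^ n.
Proof.
  intros H; induction n as [|n IH]; simpl; [rewrite Cmod_1; lra|].
  rewrite Cmod_mult. pose proof (Cmod_ge_0 z). pose proof (Cmod_ge_0 (Cpow z n)). nra.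
Qed.

Lemma Cpow_diff z w r n : Cmod z <= r -> Cmod w <= r ->
  Cmod (Cminus (Cpow z n) (Cpow w n)) <= INR n * r ^ pred n * Cmod (Cminus z w).
Proof.
  intros Hz Hw. pose proof (Cmod_ge_0 z) as Hz0.
  induction n as [|n IH].
  - simpl. replace (Cminus 1 1) with (RtoC 0) by ring. rewrite Cmod_0; lra.
  - replace (Cminus (Cpow z (S n)) (Cpow w (S n))) with
      (Cplus (Cmult z (Cminus (Cpow z n) (Cpow w n))) (Cmult (Cminus z w) (Cpow w n)))
      by (simpl; ring).
    eapply Rle_trans; [apply Cmod_triangle|]. rewrite !Cmod_mult.
    pose proof (Cmod_pow_le w r n Hw). pose proof (Cmod_ge_0 (Cminus z w)).
    pose proof (Cmod_ge_0 (Cminus (Cpow z n) (Cpow w n))).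
    apply Rle_trans with (r * (INR n * r ^ pred n * Cmod (Cminus z w)) + Cmod (Cminus z w) * r ^ n).
    + nra.
    + apply Req_le. rewrite S_INR; simpl pred. destruct n; simpl pow; simpl pred; [simpl; ring|].
      ring.
Qed.

Lemma one_minus_cos_le y : Rabs (cos y - 1) <= Rabs y.
Proof.
  pose proof (cos_ge_quadratic y). pose proof (COS_bound y).
  rewrite Rabs_left1 by lra. unfold Rabs; destruct (Rcase_abs y); nra.
Qed.

Lemma abs_sin_le y : Rabs (sin y) <= Rabs y.
Proof.
  assert (H : forall y, 0 <= y -> Rabs (sin y) <= Rabs y).
  { intros x Hx. rewrite (Rabs_pos_eq x) by auto. pose proof (sin_le_id x Hx).
    pose proof (SIN_bound x).
    apply Rabs_le; split; [|auto].
    destruct (Rle_dec x 1); [|lra].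
    assert (0 <= sin x); [|lra]. apply sin_ge_0; [auto|]. pose proof PI2_1. lra. }
  destruct (Rle_dec 0 y); [now apply H|].
  specialize (H (- y) ltac:(lra)). now rewrite sin_neg, !Rabs_Ropp in H.
Qed.

Lemma abs_le_Cmod (z : C) : Rabs (fst z) <= Cmod z /\ Rabs (snd z) <= Cmod z.
Proof.
  pose proof (Rmax_Cmod z). split; eapply Rle_trans; try exact H; [apply Rmax_l|apply Rmax_r].
Qed.

(** Half of the exponent is spent on y exp (-y) <= 1 with y = a m t^2 / 2. This absorbs m t^2 and
    leaves t exp (-y), which has an explicit primitive. *)
Lemma cubic_exp_bound a m t : 0 < a -> 0 <= m -> 0 <= t ->
  m * t ^ 3 * exp (- (a * m * (t * t))) <= 2 / a * (t * exp (- (a / 2 * m * (t * t)))).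
Proof.
  intros Ha Hm Ht. set (y := a / 2 * m * (t * t)).
  replace (- (a * m * (t * t))) with (- y + - y) by (unfold y; field).
  rewrite exp_plus.
  assert (y * exp (- y) <= 1).
  { pose proof (exp_ge_id y). pose proof (exp_pos y). rewrite exp_Ropp.
    apply Rmult_le_reg_r with (exp y); [auto|]. rewrite Rmult_assoc, Rinv_l; lra. }
  replace (m * t ^ 3 * (exp (- y) * exp (- y))) with (2 / a * t * exp (- y) * (y * exp (- y)))
    by (unfold y; field; lra).
  replace (2 / a * (t * exp (- y))) with (2 / a * t * exp (- y) * 1) by ring.
  apply Rmult_le_compat_l; [|auto].
  pose proof (exp_pos (- y)). repeat apply Rmult_le_pos; try lra. left; now apply Rinv_0_lt_compat.
Qed.

Lemma exp_pow x n : exp x ^ n = exp (INR n * x).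
Proof.
  induction n as [|n IH]; [simpl; rewrite Rmult_0_l, exp_0; reflexivity|].
  rewrite S_INR; simpl pow. rewrite IH, <- exp_plus. f_equal; ring.
Qed.

Section LocalLimit.
Variables (st : list (Z * R)) (s2 : R).
Hypothesis Hmass : forall a, In a st -> 0 <= snd a.
Hypothesis Htot : integ st (fun _ => 1) = 1.
Hypothesis Hmean : integ st IZR = 0.
Hypothesis Hvar : integ st (fun x => IZR x * IZR x) = s2.
Hypothesis Hs2 : 0 < s2.
Hypothesis Hper : forall t, 0 < t <= PI -> Cmod (char_fun st t) < 1.

(** Unit mass, zero mean and variance [s2] make both functions agree up to t^2; the third absolute
    moment [K0] controls the remainder. *)
Lemma char_fun_taylor : exists K, 0 < K /\ forall t, 0 <= t <= PI ->
  Cmod (Cminus (char_fun st t) (RtoC (exp (- (s2 / 2 * (t * t)))))) <= K * t ^ 3.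
Proof.
  set (K0 := integ st (fun x => Rabs (IZR x) ^ 3)).
  assert (HK0 : 0 <= K0).
  { apply integ_ge0; auto. intros; apply pow_le, Rabs_pos. }
  exists (2 * K0 + s2 * s2 * PI + 1). pose proof PI_RGT_0.
  split; [nra|]. intros t Ht.
  assert (Habs : forall g : Z -> R, Rabs (integ st g) <= integ st (fun x => Rabs (g x))).
  { clear - Hmass. intros g. induction st as [|a l IH]; simpl; [rewrite Rabs_R0; lra|].
    eapply Rle_trans; [apply Rabs_triang|]. apply Rplus_le_compat.
    - rewrite Rabs_mult, (Rabs_pos_eq (snd a)) by (apply Hmass; now left). lra.
    - apply IH; intros; apply Hmass; now right. }
  assert (Ht3 : 0 <= t ^ 3) by (apply pow_le; lra).
  assert (Hcube : forall x, Rabs (IZR x * t) ^ 3 = t ^ 3 * Rabs (IZR x) ^ 3).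
  { intros x. rewrite Rabs_mult, (Rabs_pos_eq t), Rpow_mult_distr by lra. ring. }
  assert (H1 : Rabs (fst (char_fun st t) - 1 + s2 / 2 * (t * t)) <= K0 * t ^ 3).
  { simpl. replace (integ st (fun x => cos (IZR x * t)) - 1 + s2 / 2 * (t * t))
      with (integ st (fun x => cos (IZR x * t) - 1 + IZR x * t * (IZR x * t) / 2)).
    - eapply Rle_trans; [apply Habs|]. unfold K0; rewrite Rmult_comm, <- integ_scal.
      apply integ_le; [auto|]. intros a Ha; cbv beta. rewrite <- Hcube. apply cos_taylor.
    - rewrite (integ_ext _ _ (fun x => (cos (IZR x * t) + -1 * 1) + t * t / 2 * (IZR x * IZR x)))
        by (intros; field).
      rewrite integ_plus, integ_plus, !integ_scal, Htot, Hvar. field. }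
  assert (H2 : Rabs (snd (char_fun st t)) <= K0 * t ^ 3).
  { simpl. replace (integ st (fun x => sin (IZR x * t)))
      with (integ st (fun x => sin (IZR x * t) - IZR x * t)).
    - eapply Rle_trans; [apply Habs|]. unfold K0; rewrite Rmult_comm, <- integ_scal.
      apply integ_le; [auto|]. intros a Ha; cbv beta. rewrite <- Hcube. apply sin_taylor.
    - rewrite (integ_ext _ _ (fun x => sin (IZR x * t) + - t * IZR x)) by (intros; ring).
      rewrite integ_plus, integ_scal, Hmean. ring. }
  assert (H3 : Rabs (exp (- (s2 / 2 * (t * t))) - 1 + s2 / 2 * (t * t)) <= s2 * s2 * PI * t ^ 3).
  { eapply Rle_trans; [apply exp_neg_taylor; nra|].
    assert (0 <= s2 * s2) by nra.
    replace (s2 / 2 * (t * t) * (s2 / 2 * (t * t))) with (s2 * s2 * (t / 4 * t ^ 3)) by (simpl; field).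
    rewrite (Rmult_assoc (s2 * s2) PI). apply Rmult_le_compat_l; [auto|].
    apply Rmult_le_compat_r; lra. }
  set (w := exp (- (s2 / 2 * (t * t)))) in *.
  replace (Cminus (char_fun st t) (RtoC w)) with
    (Cplus (RtoC (fst (char_fun st t) - w)) (Cmult Ci (RtoC (snd (char_fun st t))))).
  - eapply Rle_trans; [apply Cmod_triangle|]. rewrite Cmod_mult, !Cmod_R.
    replace (Cmod Ci) with 1 by
      (unfold Cmod, Ci; cbn [fst snd]; replace (0 ^ 2 + 1 ^ 2) with 1 by ring; now rewrite sqrt_1).
    replace (fst (char_fun st t) - w) with
      ((fst (char_fun st t) - 1 + s2 / 2 * (t * t)) + - (w - 1 + s2 / 2 * (t * t))) by ring.
    pose proof (Rabs_triang (fst (char_fun st t) - 1 + s2 / 2 * (t * t)) (- (w - 1 + s2 / 2 * (t * t)))) as H4.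
    rewrite Rabs_Ropp in H4. lra.
  - apply injective_projections; simpl; ring.
Qed.

Lemma char_fun_cont : forall t, continuity_pt (fun t => Cmod (char_fun st t)) t.
Proof.
  intros t.
  assert (H : forall g : Z -> R -> R, (forall x, continuity_pt (g x) t) ->
     continuity_pt (fun t => integ st (fun x => g x t)) t).
  { intros g Hg. clear - Hg. induction st as [|a l IH]; simpl.
    - apply continuity_pt_const; now intros x y.
    - apply continuity_pt_plus; [|exact IH].
      apply continuity_pt_mult; [apply continuity_pt_const; now intros x y|apply Hg]. }
  apply continuity_pt_filterlim.
  apply (continuous_comp (fun t => integ st (fun x => cos (IZR x * t)) * (integ st (fun x => cos (IZR x * t)) * 1)
      + integ st (fun x => sin (IZR x * t)) * (integ st (fun x => sin (IZR x * t)) * 1)) sqrt).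
  - apply continuity_pt_filterlim.
    assert (Hc : continuity_pt (fun t => integ st (fun x => cos (IZR x * t))) t).
    { apply H. intros x. apply continuity_pt_filterlim.
      apply (ex_derive_continuous (fun t => cos (IZR x * t))). auto_derive; trivial. }
    assert (Hs : continuity_pt (fun t => integ st (fun x => sin (IZR x * t))) t).
    { apply H. intros x. apply continuity_pt_filterlim.
      apply (ex_derive_continuous (fun t => sin (IZR x * t))). auto_derive; trivial. }
    assert (H1 : continuity_pt (fun _ => 1) t) by (apply continuity_pt_const; now intros x y).
    apply continuity_pt_plus; repeat apply continuity_pt_mult; auto.
  - apply continuity_pt_filterlim, continuity_pt_sqrt. nra.
Qed.

Lemma char_fun_gauss_bound : exists a, 0 < a <= s2 / 2 /\
  forall t, 0 <= t <= PI -> Cmod (char_fun st t) <= exp (- (a * (t * t))).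
Proof.
  destruct char_fun_taylor as [K [HK HT]]. pose proof PI_RGT_0 as HPI.
  (* near 0, |phi| <= 1 - s2 t^2/2 + (K + s2^2 PI) t^3 <= 1 - s2 t^2/4 *)
  set (K1 := K + s2 * s2 * PI).
  assert (HK1 : 0 < K1) by (unfold K1; nra).
  set (t0 := Rmin PI (s2 / (4 * K1))).
  assert (Ht0 : 0 < t0) by (apply Rmin_glb_lt; [auto|apply Rdiv_lt_0_compat; lra]).
  assert (Ht0P : t0 <= PI) by apply Rmin_l.
  assert (Ht0K : K1 * t0 <= s2 / 4).
  { apply Rle_trans with (K1 * (s2 / (4 * K1))); [|apply Req_le; field; lra].
    apply Rmult_le_compat_l; [lra|apply Rmin_r]. }
  destruct (continuity_ab_maj (fun t => Cmod (char_fun st t)) t0 PI Ht0P) as [tm [Hmax Htm]].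
  { intros; apply char_fun_cont. }
  set (M := Rmax (1 / 2) (Cmod (char_fun st tm))).
  assert (HM : 1 / 2 <= M < 1).
  { split; [apply Rmax_l|]. apply Rmax_lub_lt; [lra|]. apply Hper; lra. }
  (* The second argument makes exp (- a t^2) >= M on all of [0, PI], where M < 1 bounds the modulus
     away from 0. *)
  set (a := Rmin (s2 / 4) (- ln M / (PI * PI))).
  assert (HlnM : ln M < 0) by (rewrite <- ln_1; apply ln_increasing; lra).
  assert (HPP : 0 < PI * PI) by nra.
  assert (Ha : 0 < a) by (apply Rmin_glb_lt; [lra|apply Rdiv_lt_0_compat; lra]).
  assert (Ha1 : a <= s2 / 4) by apply Rmin_l.
  assert (Ha2 : a * (PI * PI) <= - ln M).
  { apply Rle_trans with (- ln M / (PI * PI) * (PI * PI)); [|apply Req_le; field; lra].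
    apply Rmult_le_compat_r; [lra|apply Rmin_r]. }
  exists a; split; [lra|]. intros t Ht.
  destruct (Rle_dec t t0) as [Hs|Hl].
  - specialize (HT t Ht). set (w := exp (- (s2 / 2 * (t * t)))) in *.
    assert (H1 : Cmod (char_fun st t) <= w + K * t ^ 3).
    { replace (char_fun st t) with (Cplus (RtoC w) (Cminus (char_fun st t) (RtoC w))) by ring.
      eapply Rle_trans; [apply Cmod_triangle|]. rewrite Cmod_R, Rabs_pos_eq; [lra|].
      left; apply exp_pos. }
    pose proof (exp_neg_taylor (s2 / 2 * (t * t)) ltac:(nra)) as H2. fold w in H2.
    apply Rabs_le_between in H2.
    assert (Ht3 : 0 <= t ^ 3) by (apply pow_le; lra).
    assert (H3 : s2 / 2 * (t * t) * (s2 / 2 * (t * t)) <= s2 * s2 * PI * t ^ 3).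
    { replace (s2 / 2 * (t * t) * (s2 / 2 * (t * t))) with (s2 * s2 * (t / 4 * t ^ 3)) by (simpl; field).
      rewrite (Rmult_assoc (s2 * s2) PI). apply Rmult_le_compat_l; [nra|].
      apply Rmult_le_compat_r; lra. }
    assert (H4 : K1 * t ^ 3 <= s2 / 4 * (t * t)).
    { replace (K1 * t ^ 3) with (K1 * t * (t * t)) by (simpl; ring).
      apply Rmult_le_compat_r; [nra|]. nra. }
    pose proof (exp_ge_id (- (a * (t * t)))).
    unfold K1 in H4. nra.
  - apply Rle_trans with M.
    + eapply Rle_trans; [apply Hmax; lra|apply Rmax_r].
    + rewrite <- (exp_ln M) by lra. apply exp_le_compat.
      assert (a * (t * t) <= a * (PI * PI)) by (apply Rmult_le_compat_l; nra). lra.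
Qed.

(** The first bound, uniform in k, later dominates sums over altitudes; the second identifies the
    limit. For the latter, |phi^n - w^n| with w the Gaussian is O(n t^3 exp (- a n t^2)), and
    dropping the oscillation in k costs O(|k| t) times a Gaussian. Both integrate to O(1/n), below
    the main term n^(-1/2). *)
Lemma local_limit_error : exists a K, 0 < a <= s2 / 2 /\ 0 < K /\
  (forall n k, Rabs (integ (free_walk st n) (dirac k)) * PI
     <= RInt (fun t => exp (- (a * INR n * (t * t)))) 0 PI) /\
  (forall n k, (1 <= n)%nat -> 
     Rabs (PI * integ (free_walk st n) (dirac k)
       - RInt (fun t => exp (- (s2 / 2 * INR n * (t * t)))) 0 PI)
     <= (K + 2 * Rabs (IZR k)) / (a * INR n)).
Proof.
  destruct char_fun_taylor as [K [HK HT]].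
  destruct char_fun_gauss_bound as [a [Ha HB]].
  pose proof PI_RGT_0 as HPI.
  assert (Hint : forall y, ex_RInt (fun t => exp (- (y * (t * t)))) 0 PI).
  { intros y. apply (ex_RInt_continuous (V := R_CompleteNormedModule)); intros.
    apply (ex_derive_continuous (fun t => exp (- (y * (t * t))))). auto_derive; trivial. }
  assert (HBn : forall n t, 0 <= t <= PI ->
    Cmod (Cpow (char_fun st t) n) <= exp (- (a * INR n * (t * t)))).
  { intros n t Ht. eapply Rle_trans; [apply Cmod_pow_le, (HB t Ht)|].
    rewrite exp_pow. right; f_equal; ring. }
  set (K1 := K * exp (a * (PI * PI)) * (2 / a)).
  assert (HK1 : 0 < K1).
  { repeat apply Rmult_lt_0_compat; try lra; [apply exp_pos|].
    apply Rinv_0_lt_compat; lra. }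
  exists a, K1; repeat split; try lra.
  - intros n k.
    replace (Rabs (integ (free_walk st n) (dirac k)) * PI)
      with (Rabs (PI * integ (free_walk st n) (dirac k)))
      by (rewrite Rabs_mult, (Rabs_pos_eq PI); lra).
    refine (norm_RInt_le (V := R_NormedModule) _ _ 0 PI _ _ (Rlt_le _ _ HPI) _
      (fourier_inversion (free_walk st n) k)
      (RInt_correct (V := R_CompleteNormedModule) _ _ _ (Hint _))).
    intros t Ht.
    eapply Rle_trans; [|apply HBn; lra].
    rewrite <- char_fun_walk, char_fun_shift. set (z := char_fun (free_walk st n) t).
    replace (cos (IZR k * t) * fst z + sin (IZR k * t) * snd z)
      with (fst (Cmult z (cos (IZR k * t), - sin (IZR k * t)))) by (simpl; ring).
    eapply Rle_trans; [apply abs_le_Cmod|]. rewrite Cmod_mult.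
    replace (Cmod (cos (IZR k * t), - sin (IZR k * t))) with 1; [lra|].
    unfold Cmod; cbn [fst snd].
    replace (cos (IZR k * t) ^ 2 + (- sin (IZR k * t)) ^ 2) with 1; [now rewrite sqrt_1|].
    pose proof (sin2_cos2 (IZR k * t)) as H. unfold Rsqr in H. lra.
  - intros n k Hn.
    assert (HIn : 1 <= INR n) by (replace 1 with (INR 1) by reflexivity; now apply le_INR).
    set (b := a / 2 * INR n). assert (Hb : 0 < b) by (unfold b; nra).
    set (Kk := K1 + 2 * Rabs (IZR k)).
    assert (HKk : 0 < Kk) by (unfold Kk; pose proof (Rabs_pos (IZR k)); lra).
    assert (Hpt : forall t, 0 <= t <= PI ->
      Rabs (integ (free_walk st n) (fun x => cos (IZR (x - k) * t))
            - exp (- (s2 / 2 * INR n * (t * t)))) <= Kk * (t * exp (- (b * (t * t))))).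
    { intros t Ht. rewrite char_fun_shift, char_fun_walk.
      set (z := char_fun st t). set (w := exp (- (s2 / 2 * (t * t)))).
      assert (Hwn : exp (- (s2 / 2 * INR n * (t * t))) = w ^ n).
      { unfold w; rewrite exp_pow; f_equal; ring. }
      set (y := IZR k * t).
      assert (Hy : Rabs y = Rabs (IZR k) * t) by (unfold y; rewrite Rabs_mult, (Rabs_pos_eq t); lra).
      assert (Hz : Cmod z <= exp (- (a * (t * t)))) by (apply HB; lra).
      assert (Hw : Cmod (RtoC w) <= exp (- (a * (t * t)))).
      { rewrite Cmod_R, Rabs_pos_eq by (left; apply exp_pos).
        apply exp_le_compat, Ropp_le_contravar, Rmult_le_compat_r; nra. }
      pose proof (Cpow_diff z (RtoC w) _ n Hz Hw) as HD.
      specialize (HT t ltac:(lra)).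
      assert (HD' : Cmod (Cminus (Cpow z n) (Cpow (RtoC w) n)) <= K1 * (t * exp (- (b * (t * t))))).
      { eapply Rle_trans; [exact HD|].
        rewrite exp_pow.
        apply Rle_trans with (INR n * exp (INR (pred n) * - (a * (t * t))) * (K * t ^ 3)).
        { apply Rmult_le_compat_l; [|exact HT]. apply Rmult_le_pos; [lra|left; apply exp_pos]. }
        (* The exponent n - 1 is raised to n at the price of exp (a PI^2), which is part of [K1]. *)
        replace (INR (pred n) * - (a * (t * t))) with (a * (t * t) + - (a * INR n * (t * t))).
        2:{ destruct n; [lia|]. rewrite S_INR; simpl pred. ring. }
        rewrite exp_plus.
        pose proof (cubic_exp_bound a (INR n) t ltac:(lra) ltac:(lra) ltac:(lra)) as HC.
        assert (HE : exp (a * (t * t)) <= exp (a * (PI * PI))).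
        { apply exp_le_compat, Rmult_le_compat_l; nra. }
        replace (INR n * (exp (a * (t * t)) * exp (- (a * INR n * (t * t)))) * (K * t ^ 3))
          with (K * exp (a * (t * t)) * (INR n * t ^ 3 * exp (- (a * INR n * (t * t))))) by ring.
        replace (K1 * (t * exp (- (b * (t * t)))))
          with (K * exp (a * (PI * PI)) * (2 / a * (t * exp (- (a / 2 * INR n * (t * t))))))
          by (unfold K1, b; ring).
        apply Rmult_le_compat; [| |apply Rmult_le_compat_l; lra|exact HC].
        - apply Rmult_le_pos; [lra|left; apply exp_pos].
        - apply Rmult_le_pos; [|left; apply exp_pos].
          apply Rmult_le_pos; [lra|apply pow_le; lra]. }
      rewrite <- RtoC_pow in HD'.
      set (zn := Cpow z n) in *.
      replace (cos y * fst zn + sin y * snd zn - exp (- (s2 / 2 * INR n * (t * t))))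
        with (fst (Cminus zn (RtoC (w ^ n))) + (cos y - 1) * fst zn + sin y * snd zn)
        by (rewrite Hwn; simpl; ring).
      destruct (abs_le_Cmod (Cminus zn (RtoC (w ^ n)))) as [HA _].
      destruct (abs_le_Cmod zn) as [HZ1 HZ2].
      assert (Hzn : Cmod zn <= exp (- (b * (t * t)))).
      { eapply Rle_trans; [apply HBn; lra|].
        apply exp_le_compat, Ropp_le_contravar, Rmult_le_compat_r; [nra|unfold b; nra]. }
      eapply Rle_trans; [apply Rabs_triang|].
      eapply Rle_trans; [apply Rplus_le_compat_r, Rabs_triang|].
      rewrite !Rabs_mult.
      pose proof (one_minus_cos_le y). pose proof (abs_sin_le y).
      assert (Rabs (cos y - 1) * Rabs (fst zn) <= Rabs (IZR k) * t * exp (- (b * (t * t)))).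
      { apply Rmult_le_compat; try apply Rabs_pos; lra. }
      assert (Rabs (sin y) * Rabs (snd zn) <= Rabs (IZR k) * t * exp (- (b * (t * t)))).
      { apply Rmult_le_compat; try apply Rabs_pos; lra. }
      unfold Kk. lra. }
    assert (HI1 : is_RInt (fun t => minus (integ (free_walk st n) (fun x => cos (IZR (x - k) * t)))
        (exp (- (s2 / 2 * INR n * (t * t))))) 0 PI
       (minus (PI * integ (free_walk st n) (dirac k)) (RInt (fun t => exp (- (s2 / 2 * INR n * (t * t)))) 0 PI))).
    { apply (is_RInt_minus (V := R_NormedModule)); [apply fourier_inversion|].
      apply (RInt_correct (V := R_CompleteNormedModule)), Hint. }
    assert (HI2 : is_RInt (fun t => Kk * (t * exp (- (b * (t * t))))) 0 PI
       (Kk * ((1 - exp (- (b * (PI * PI)))) / (2 * b)))).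
    { apply (is_RInt_scal (V := R_NormedModule)). now apply is_RInt_linear_gauss. }
    assert (Hfin : Kk * ((1 - exp (- (b * (PI * PI)))) / (2 * b)) <= Kk / (a * INR n)).
    { replace (Kk / (a * INR n)) with (Kk * (1 / (2 * b))) by (unfold b; field; lra).
      apply Rmult_le_compat_l; [lra|]. unfold Rdiv; apply Rmult_le_compat_r.
      - left; apply Rinv_0_lt_compat; lra.
      - pose proof (exp_pos (- (b * (PI * PI)))). lra. }
    eapply Rle_trans; [|exact Hfin].
    exact (norm_RInt_le (V := R_NormedModule) _ _ 0 PI _ _ (Rlt_le _ _ HPI) Hpt HI1 HI2).
Qed.

Lemma RInt_gauss_asymp y : 0 < y ->
  is_lim_seq (fun n => RInt (fun t => exp (- (y * INR n * (t * t)))) 0 PI * rt n)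
    (gauss_lim / sqrt y).
Proof.
  intros Hy. assert (Hsy : 0 < sqrt y) by now apply sqrt_lt_R0.
  apply is_lim_seq_ext_loc with (fun n =>
    gauss (PI * sqrt (y * INR n)) / sqrt y * sqrt (rt n ^ 2 / INR n)).
  { exists 1%nat; intros n Hn. assert (0 < INR n) by (apply lt_0_INR; lia).
    rewrite (is_RInt_unique _ _ _ _ (gauss_scale (y * INR n) ltac:(nra))).
    rewrite (sqrt_mult y) by lra. assert (0 < sqrt (INR n)) by now apply sqrt_lt_R0.
    rewrite sqrt_div_alt by lra. rewrite sqrt_pow2 by (left; apply rt_pos). field; lra. }
  replace (Finite (gauss_lim / sqrt y)) with (Finite (gauss_lim * / sqrt y * sqrt 1))
    by (rewrite sqrt_1; f_equal; unfold Rdiv; ring).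
  apply is_lim_seq_mult'; [apply is_lim_seq_mult'; [|apply is_lim_seq_const]|].
  - apply gauss_lim_seq.
    apply is_lim_seq_ext with (fun n => (PI * sqrt y) * sqrt (INR n)).
    { intros n; rewrite sqrt_mult by (try apply pos_INR; lra). ring. }
    replace p_infty with (Rbar_mult (PI * sqrt y) p_infty).
    + apply is_lim_seq_scal_l. apply is_lim_seq_spec; intros M.
      destruct (INR_unbounded (Rmax M 0 * Rmax M 0)) as [N HN]. exists N; intros n Hn.
      apply le_INR in Hn. pose proof (Rmax_l M 0). pose proof (Rmax_r M 0).
      apply Rle_lt_trans with (sqrt (Rmax M 0 * Rmax M 0)).
      * rewrite sqrt_square; auto.
      * apply sqrt_lt_1_alt; split; [nra|lra].
    + assert (0 < PI * sqrt y) by (apply Rmult_lt_0_compat; [apply PI_RGT_0|auto]).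
      simpl. destruct (Rle_dec 0 (PI * sqrt y)); [|lra].
      destruct (Rle_lt_or_eq_dec _ _ _); [reflexivity|lra].
  - apply is_lim_seq_continuous with (u := fun n => rt n ^ 2 / INR n) (f := sqrt).
    + apply continuity_pt_sqrt; lra.
    + apply lim_INR_ratio.
Qed.

Lemma local_limit k :
  is_lim_seq (fun n => integ (free_walk st n) (dirac k) * rt n)
    (gauss_lim / PI * sqrt (2 / s2)).
Proof.
  destruct local_limit_error as [a [K [Ha [HK [_ Herr]]]]]. pose proof PI_RGT_0 as HPI.
  set (J := fun n => RInt (fun t => exp (- (s2 / 2 * INR n * (t * t)))) 0 PI).
  apply is_lim_seq_ext with (fun n =>
    / PI * (J n * rt n + (PI * integ (free_walk st n) (dirac k) - J n) * rt n)).
  { intros n; field; lra. }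
  replace (Finite (gauss_lim / PI * sqrt (2 / s2)))
    with (Finite (/ PI * (gauss_lim / sqrt (s2 / 2) + 0))).
  2:{ f_equal.
      replace (2 / s2) with (/ (s2 / 2)) by (field; lra). rewrite sqrt_inv.
      unfold Rdiv; ring. }
  apply is_lim_seq_mult'; [apply is_lim_seq_const|].
  apply is_lim_seq_plus'; [apply RInt_gauss_asymp; lra|].
  apply is_lim_seq_abs_0.
  apply is_lim_seq_le_le_loc with (u := fun _ => 0)
    (w := fun n => (K + 2 * Rabs (IZR k)) / a * (rt n ^ 2 / INR n) * / rt n).
  - exists 1%nat; intros n Hn. split; [apply Rabs_pos|].
    assert (0 < INR n) by (apply lt_0_INR; lia). pose proof (rt_pos n).
    rewrite Rabs_mult, (Rabs_pos_eq (rt n)) by lra.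
    replace ((K + 2 * Rabs (IZR k)) / a * (rt n ^ 2 / INR n) * / rt n)
      with ((K + 2 * Rabs (IZR k)) / (a * INR n) * rt n) by (field; lra).
    apply Rmult_le_compat_r; [lra|]. now apply Herr.
  - apply is_lim_seq_const.
  - replace (Finite 0) with (Finite ((K + 2 * Rabs (IZR k)) / a * 1 * 0)) by (f_equal; ring).
    apply is_lim_seq_mult'; [|apply inv_rt_lim].
    apply is_lim_seq_mult'; [apply is_lim_seq_const|apply lim_INR_ratio].
Qed.

Lemma local_uniform_bound : exists K, 0 < K /\
  forall n k, integ (free_walk st n) (dirac k) <= K / rt n.
Proof.
  destruct local_limit_error as [a [K [Ha [HK [Hunif _]]]]]. pose proof PI_RGT_0 as HPI.
  destruct (lim_bounded _ _ (RInt_gauss_asymp a ltac:(lra))) as [B [HB HBn]].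
  exists (B / PI); split; [now apply Rdiv_lt_0_compat|]. intros n k.
  specialize (Hunif n k). specialize (HBn n). pose proof (rt_pos n).
  pose proof (Rle_abs (integ (free_walk st n) (dirac k))).
  pose proof (Rle_abs (RInt (fun t => exp (- (a * INR n * (t * t)))) 0 PI * rt n)).
  apply Rmult_le_reg_r with (PI * rt n); [nra|].
  replace (B / PI / rt n * (PI * rt n)) with B by (field; lra).
  apply Rle_trans with (Rabs (integ (free_walk st n) (dirac k)) * PI * rt n); [|nra].
  rewrite <- Rmult_assoc. apply Rmult_le_compat_r; [lra|]. nra.
Qed.
End LocalLimit.

(** * Meanders *)

Section MeanderAsymptotics.
Variables (st : list (Z * R)) (s2 : R) (d : nat).
Hypothesis Hmass : forall a, In a st -> 0 <= snd a.
Hypothesis Htot : integ st (fun _ => 1) = 1.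
Hypothesis Hmean : integ st IZR = 0.
Hypothesis Hvar : integ st (fun x => IZR x * IZR x) = s2.
Hypothesis Hs2 : 0 < s2.
Hypothesis Hper : forall t, 0 < t <= PI -> Cmod (char_fun st t) < 1.
Hypothesis Hd : (1 <= d)%nat.
Hypothesis Hsupp : forall a, In a st -> (fst a <= Z.of_nat d)%Z.

(** All altitudes share the same local limit, so a geometric series in v appears.
    [local_uniform_bound] dominates it, summably because v < 1. *)
Lemma pos_gf_asymp v : 0 <= v < 1 ->
  is_lim_seq (fun n => pos_gf st v n * rt n) (gauss_lim / PI * sqrt (2 / s2) / (1 - v)).
Proof.
  intros Hv. set (ks := gauss_lim / PI * sqrt (2 / s2)).
  destruct (local_uniform_bound st s2) as [K [HK HKn]]; auto.
  assert (Hs0 : forall n k, 0 <= integ (free_walk st n) (dirac k)).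
  { intros; apply integ_ge0; [now apply free_walk_mass|].
    intros; unfold dirac; destruct (_ =? _)%Z; lra. }
  apply is_lim_seq_ext_loc with (fun n =>
    sum_f_R0 (fun k => integ (free_walk st n) (dirac (Z.of_nat k)) * rt n * v ^ k) (d * n)).
  { exists 1%nat; intros [|n] Hn; [lia|]. unfold pos_gf.
    rewrite (integ_zpow _ _ (d * S n)) by (intros; now apply free_walk_le with (st := st)).
    rewrite Rmult_comm, <- sum_scal_l. apply sum_eq; intros; ring. }
  apply tannery with (N := fun n => (d * n)%nat)
    (F := fun n k => integ (free_walk st n) (dirac (Z.of_nat k)) * rt n * v ^ k)
    (f := fun k => ks * v ^ k) (G := fun k => K * v ^ k).
  - intros; nia.
  - intros k. apply is_lim_seq_mult'; [|apply is_lim_seq_const].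
    now apply local_limit.
  - intros n k. specialize (HKn n (Z.of_nat k)). specialize (Hs0 n (Z.of_nat k)).
    pose proof (rt_pos n). assert (0 <= v ^ k) by (apply pow_le; lra).
    rewrite Rabs_pos_eq by (repeat apply Rmult_le_pos; lra).
    apply Rmult_le_compat_r; [auto|].
    apply Rle_trans with (K / rt n * rt n); [apply Rmult_le_compat_r; lra|].
    apply Req_le; field; lra.
  - exists (K * / (1 - v)). apply (is_series_scal K (fun k => v ^ k) (/ (1 - v))).
    apply is_series_geom. rewrite Rabs_pos_eq; lra.
  - apply (is_series_scal ks (fun k => v ^ k) (/ (1 - v))).
    apply is_series_geom. rewrite Rabs_pos_eq; lra.
Qed.

Lemma meander_gf_range v n : 0 <= v <= 1 -> 0 <= integ (meander st n) (zpow v) <= 1.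
Proof.
  intros Hv.
  assert (Hz : forall x, 0 <= zpow v x <= 1).
  { intros x; unfold zpow, cut. destruct (0 <=? x)%Z; [|lra]. split; [apply pow_le; lra|].
    rewrite <- (pow1 (Z.to_nat x)). apply pow_incr; lra. }
  split.
  - apply integ_ge0; [now apply meander_mass|]. intros; apply Hz.
  - eapply Rle_trans; [|apply (meander_total st Hmass n Htot)].
    apply integ_le; [now apply meander_mass|]. intros; apply Hz.
Qed.

Lemma meander_gf_asymp v : 0 <= v < 1 ->
  exists S, 1 <= S /\ is_series (fun n => integ (meander st n) (zpow v)) S /\
   is_lim_seq (fun n => integ (meander st n) (zpow v) * rt n ^ 3)
     (S * (gauss_lim / PI * sqrt (2 / s2) / (1 - v))).
Proof.
  intros Hv. apply exp_closure with (b := pos_gf st v) (K := 1).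
  - intros n; apply meander_gf_range; lra.
  - intros [|n]; unfold pos_gf; [lra|]. apply integ_ge0; [now apply free_walk_mass|].
    intros; unfold zpow, cut. destruct (_ <=? _)%Z; [apply pow_le|]; lra.
  - reflexivity.
  - simpl; unfold zpow, cut; simpl; ring.
  - intros n; apply spitzer_gf.
  - now apply pos_gf_asymp.
Qed.

(** Read off from the generating functions on [0, 1/2] by [gf_continuity]. Existence of [L]
    suffices, since these coefficients enter Q only through a finite correction. *)
Lemma meander_coef_asymp (k : nat) : exists L : R,
  is_lim_seq (fun n => integ (meander st n) (dirac (Z.of_nat k)) * rt n ^ 3) L.
Proof.
  assert (Hf : forall v, 0 <= v <= 1 / 2 -> is_lim_seq (fun n =>
     sum_f_R0 (fun k => integ (meander st n) (dirac (Z.of_nat k)) * rt n ^ 3 * v ^ k) (d * n))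
     (real (Lim_seq (fun n => integ (meander st n) (zpow v) * rt n ^ 3)))).
  { intros v Hv. destruct (meander_gf_asymp v ltac:(lra)) as [S [_ [_ HS]]].
    rewrite (is_lim_seq_unique _ _ HS). eapply is_lim_seq_ext; [|exact HS].
    intros n; cbv beta. rewrite (integ_zpow _ _ (d * n)) by (intros; now apply meander_le with (st := st)).
    rewrite Rmult_comm, <- sum_scal_l. apply sum_eq; intros; ring. }
  apply gf_continuity in Hf; [|lra|intros; nia| |].
  - destruct Hf as [l [Hl _]]. now exists (l k).
  - intros n j. apply Rmult_le_pos; [|left; apply pow_lt, rt_pos].
    apply integ_ge0; [now apply meander_mass|]. intros; unfold dirac; destruct (_ =? _)%Z; lra.
  - intros n j Hj. rewrite (integ_ext_in _ _ (fun _ => 0)).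
    + rewrite integ_zero by reflexivity. ring.
    + intros a Ha. pose proof (meander_le st d n a Hsupp Ha). unfold dirac.
      destruct (Z.eqb_spec (fst a) (Z.of_nat j)); [lia|reflexivity].
Qed.
End MeanderAsymptotics.

(** * Lower bounds from runs of maximal up-steps *)

Section StepUp.
Variables (st : list (Z * R)) (d : nat) (pd : R).
Hypothesis Hmass : forall a, In a st -> 0 <= snd a.
Hypothesis Hin : In (Z.of_nat d, pd) st.

Lemma integ_ge_atom l f a : (forall a, In a l -> 0 <= snd a) ->
  (forall a, In a l -> 0 <= f (fst a)) -> In a l -> snd a * f (fst a) <= integ l f.
Proof.
  intros Hl Hf Ha. induction l as [|b l IH]; [destruct Ha|]. simpl.
  destruct Ha as [->|Ha].
  - assert (0 <= integ l f); [|lra].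
    apply integ_ge0; intros; [apply Hl|apply Hf]; now right.
  - assert (0 <= snd b * f (fst b)) by (apply Rmult_le_pos; [apply Hl|apply Hf]; now left).
    assert (snd a * f (fst a) <= integ l f); [|lra].
    apply IH; auto; intros; [apply Hl|apply Hf]; now right.
Qed.

Lemma meander_step_up n f : (forall x, (0 <= x)%Z -> 0 <= f x) ->
  pd * integ (meander st n) (fun y => f (Z.of_nat d + y)%Z) <= integ (meander st (S n)) f.
Proof.
  intros Hf. rewrite meander_S.
  assert (Hc : forall x, 0 <= cut f x).
  { intros x; unfold cut; destruct (Z.leb_spec 0 x); [auto|lra]. }
  eapply Rle_trans; [|apply (integ_ge_atom st _ (Z.of_nat d, pd)); auto].
  - simpl. apply Req_le. f_equal. apply integ_ext_in; intros a Ha.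
    apply meander_pos in Ha. unfold cut. now rewrite (proj2 (Z.leb_le _ _)) by lia.
  - intros a Ha. apply integ_ge0; [now apply meander_mass|auto].
Qed.

Lemma meander_steps_up j n f : (forall x, (0 <= x)%Z -> 0 <= f x) -> 0 <= pd ->
  pd ^ j * integ (meander st n) (fun y => f (Z.of_nat (d * j) + y)%Z)
  <= integ (meander st (n + j)) f.
Proof.
  intros Hf Hpd. revert f Hf. induction j as [|j IH]; intros f Hf.
  - rewrite Nat.add_0_r. rewrite Rmult_1_l. apply Req_le.
    apply integ_ext; intros y. f_equal. lia.
  - rewrite Nat.add_succ_r. eapply Rle_trans; [|apply meander_step_up; exact Hf].
    simpl pow. rewrite Rmult_assoc. apply Rmult_le_compat_l; [exact Hpd|].
    eapply Rle_trans; [|apply IH].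
    + apply Req_le; f_equal. apply integ_ext; intros y. f_equal. lia.
    + intros x Hx. apply Hf. lia.
Qed.
End StepUp.

(** * Weighted paths of the model as measures, and their tilting *)

Definition steps (c d : nat) (p : Z -> R) : list (Z * R) :=
  map (fun i => (i, p i)) (Zrange c d).

Lemma integ_steps c d p f :
  integ (steps c d p) f = fold_right Rplus 0 (map (fun i => p i * f i) (Zrange c d)).
Proof.
  unfold steps. induction (Zrange c d) as [|i l IH]; simpl; [reflexivity|now rewrite IH].
Qed.

Lemma in_Zrange c d i : In i (Zrange c d) <-> (- Z.of_nat c <= i <= Z.of_nat d)%Z.
Proof.
  unfold Zrange. rewrite in_map_iff. split.
  - intros [k [<- Hk]]. apply in_seq in Hk. lia.
  - intros H. exists (Z.to_nat (i + Z.of_nat c)). split; [lia|]. apply in_seq. lia.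
Qed.

Lemma in_steps c d p a : In a (steps c d p) ->
  (- Z.of_nat c <= fst a <= Z.of_nat d)%Z /\ snd a = p (fst a).
Proof.
  unfold steps. rewrite in_map_iff. intros [i [<- Hi]].
  split; [now apply in_Zrange|reflexivity].
Qed.

Lemma steps_in c d p i : (- Z.of_nat c <= i <= Z.of_nat d)%Z -> In (i, p i) (steps c d p).
Proof. intros H. apply in_map_iff. exists i; split; [auto|now apply in_Zrange]. Qed.

Lemma sum_app (A : Type) (g : A -> R) l1 l2 :
  fold_right Rplus 0 (map g (l1 ++ l2))
  = fold_right Rplus 0 (map g l1) + fold_right Rplus 0 (map g l2).
Proof. induction l1 as [|a l IH]; simpl; [ring|rewrite IH; ring]. Qed.

(** The starting altitude [h] is free because [walks] recurses on the first step, which moves it. *)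
Definition walk_sum (c d : nat) (p : Z -> R) (h : Z) (n : nat) (f : Z -> R) : R :=
  fold_right Rplus 0 (map (fun w => if stays_nonneg h w
    then weight p w * f (fold_left Z.add w h) else 0) (walks c d p n)).

Lemma walk_sum_S c d p h n f :
  walk_sum c d p h (S n) f =
  integ (steps c d p) (fun i => cut (fun x => walk_sum c d p x n f) (h + i)%Z).
Proof.
  rewrite integ_steps. unfold walk_sum at 1; simpl. unfold jumps.
  induction (Zrange c d) as [|i l IH]; simpl; [reflexivity|].
  destruct (Req_EM_T (p i) 0) as [E|E].
  - nra.
  - simpl. rewrite sum_app, IH. f_equal. rewrite map_map. unfold cut, walk_sum.
    clear IH. simpl stays_nonneg. destruct (0 <=? h + i)%Z.
    + induction (walks c d p n) as [|w ws IHw]; cbn [map fold_right]; [ring|].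
      rewrite IHw; cbn [andb fold_left]. change (weight p (i :: w)) with (p i * weight p w).
      destruct (stays_nonneg (h + i) w); ring.
    + induction (walks c d p n) as [|w ws IHw]; cbn [map fold_right]; [ring|].
      rewrite IHw; cbn [andb]; ring.
Qed.

(** Bridge between two recursions: [walks] prepends steps, whereas [meander] appends them. *)
Lemma walk_sum_last c d p h n f :
  walk_sum c d p h (S n) f
  = walk_sum c d p h n (fun x => integ (steps c d p) (fun i => cut f (x + i)%Z)).
Proof.
  revert h f; induction n as [|n IH]; intros h f.
  - rewrite walk_sum_S. unfold walk_sum; simpl. rewrite Rplus_0_r, Rmult_1_l.
    apply integ_ext; intros i. unfold cut. destruct (0 <=? h + i)%Z; ring.
  - rewrite walk_sum_S, (walk_sum_S c d p h n). apply integ_ext; intros i.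
    unfold cut at 1 2. destruct (0 <=? h + i)%Z; [apply IH|reflexivity].
Qed.

Lemma walk_sum_meander c d p n f :
  walk_sum c d p 0 n f = integ (meander (steps c d p) n) f.
Proof.
  revert f; induction n as [|n IH]; intros f.
  - auto.
  - rewrite walk_sum_last, IH, meander_S, integ_exchange. apply integ_ext; intros y.
    apply integ_ext; intros i. f_equal. ring.
Qed.

Lemma mcoef_meander c d p n k :
  mcoef c d p n k = integ (meander (steps c d p) n) (dirac (Z.of_nat k)).
Proof.
  rewrite <- walk_sum_meander. unfold mcoef, walk_sum, final_alt, dirac.
  induction (walks c d p n) as [|w ws IH]; simpl; [reflexivity|].
  rewrite <- IH. destruct (stays_nonneg 0 w); simpl; [|ring].
  destruct (Z.eqb _ _); simpl; ring.
Qed.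

Definition tilt (p : Z -> R) (t r : R) (i : Z) : R := p i * powerRZ t i * r.

Lemma integ_steps_tilt c d p t r f :
  integ (steps c d (tilt p t r)) f = r * integ (steps c d p) (fun i => powerRZ t i * f i).
Proof.
  rewrite !integ_steps. induction (Zrange c d) as [|i l IH]; simpl; [ring|].
  rewrite IH. unfold tilt; ring.
Qed.

(** Exponential change of measure: along a path from 0 the powers of t multiply to t^(final
    altitude), and each step contributes one factor r. *)
Lemma meander_tilt c d p t r n f : t <> 0 ->
  integ (meander (steps c d (tilt p t r)) n) f
  = r ^ n * integ (meander (steps c d p) n) (fun x => powerRZ t x * f x).
Proof.
  intros Ht. revert f; induction n as [|n IH]; intros f; [simpl; ring|].
  rewrite !meander_S, integ_steps_tilt. simpl pow.
  rewrite (integ_ext _ _ (fun i => r ^ n * integ (meander (steps c d p) n)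
     (fun y => cut (fun x => powerRZ t x * f x) (i + y)%Z))).
  - rewrite integ_scal; ring.
  - intros i. rewrite IH, (Rmult_comm (powerRZ t i)), Rmult_assoc, (Rmult_comm _ (powerRZ t i)).
    f_equal. rewrite <- integ_scal. apply integ_ext; intros y. unfold cut.
    rewrite powerRZ_add by auto. destruct (0 <=? i + y)%Z; ring.
Qed.

Lemma mcoef_tilt c d p t r n k : t <> 0 ->
  integ (meander (steps c d (tilt p t r)) n) (dirac (Z.of_nat k))
  = r ^ n * t ^ k * mcoef c d p n k.
Proof.
  intros Ht. rewrite meander_tilt by auto. rewrite Rmult_assoc; f_equal.
  rewrite mcoef_meander, <- integ_scal. apply integ_ext; intros x. unfold dirac.
  destruct (Z.eqb_spec x (Z.of_nat k)) as [->|]; [|ring].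
  rewrite <- pow_powerRZ; ring.
Qed.

(** * The lazy walk and aperiodicity *)

(* Lazy simple walk: [P(S_n = 0) = C(2n,n)/4^n], the coefficients of [(1-x)^(-1/2)]. *)
Definition lazy_steps : list (Z * R) := [((-1)%Z, 1/4); (0%Z, 1/2); (1%Z, 1/4)].

Definition lazy_return (n : nat) : R := integ (free_walk lazy_steps n) (dirac 0).

Lemma lazy_char t : char_fun lazy_steps t = RtoC ((1 + cos t) / 2).
Proof.
  apply injective_projections; simpl.
  - rewrite Rmult_0_l, Rmult_1_l, cos_0. replace (-1 * t) with (- t) by ring.
    rewrite cos_neg. field.
  - rewrite Rmult_0_l, Rmult_1_l, sin_0. replace (-1 * t) with (- t) by ring.
    rewrite sin_neg. field.
Qed.

Lemma lazy_return_RInt n :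
  is_RInt (fun t => ((1 + cos t) / 2) ^ n) 0 PI (PI * lazy_return n).
Proof.
  eapply is_RInt_ext; [|apply fourier_inversion].
  intros t _; cbv beta. rewrite char_fun_shift, char_fun_walk, lazy_char, <- RtoC_pow.
  simpl. rewrite Rmult_0_l, cos_0. ring.
Qed.

Lemma lazy_return_0 : lazy_return 0 = 1.
Proof. unfold lazy_return; simpl; unfold dirac; simpl; ring. Qed.

(** A Wallis recurrence: the combination of integrands is the derivative of sin t ((1 + cos t)/2)^n,
    which vanishes at 0 and at PI. *)
Lemma lazy_return_rec n :
  (2 * INR n + 2) * lazy_return (S n) = (2 * INR n + 1) * lazy_return n.
Proof.
  assert (H : is_RInt (fun t => (2 * INR n + 2) * ((1 + cos t) / 2) ^ S n
      - (2 * INR n + 1) * ((1 + cos t) / 2) ^ n) 0 PI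
    ((2 * INR n + 2) * (PI * lazy_return (S n)) - (2 * INR n + 1) * (PI * lazy_return n))).
  { apply (is_RInt_minus (V := R_NormedModule));
      apply (is_RInt_scal (V := R_NormedModule)), lazy_return_RInt. }
  assert (H0 : is_RInt (fun t => (2 * INR n + 2) * ((1 + cos t) / 2) ^ S n
      - (2 * INR n + 1) * ((1 + cos t) / 2) ^ n) 0 PI
     (minus (sin PI * ((1 + cos PI) / 2) ^ n) (sin 0 * ((1 + cos 0) / 2) ^ n))).
  { apply (is_RInt_derive (V := R_CompleteNormedModule) (fun t => sin t * ((1 + cos t) / 2) ^ n)).
    - intros t _. auto_derive; [trivial|].
      assert (Hs : sin t * sin t = (1 - cos t) * (1 + cos t)).
      { pose proof (sin2_cos2 t) as E; unfold Rsqr in E. lra. }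
      set (y := (1 + cos t) / 2). assert (Ey : (1 + cos t) * / 2 = y) by reflexivity.
      rewrite ?Ey. replace (cos t) with (2 * y - 1) in * by (unfold y; field).
      destruct n as [|n]; [simpl; field|].
      simpl pred. change (y ^ S (S n)) with (y * (y * y ^ n)). change (y ^ S n) with (y * y ^ n).
      transitivity ((2 * y - 1) * (y * y ^ n) - INR (S n) * y ^ n / 2 * (sin t * sin t)).
      + field.
      + rewrite Hs. field.
    - intros t _. apply (ex_derive_continuous (fun t => (2 * INR n + 2) * ((1 + cos t) / 2) ^ S n
      - (2 * INR n + 1) * ((1 + cos t) / 2) ^ n)). auto_derive; trivial. }
  pose proof (is_RInt_unique _ _ _ _ H) as E. rewrite (is_RInt_unique _ _ _ _ H0) in E.
  unfold minus, plus, opp in E; simpl in E. rewrite sin_PI, sin_0 in E.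
  pose proof PI_RGT_0. apply Rmult_eq_reg_l with PI; [|lra].
  lra.
Qed.

(** Coefficients of 1 - sqrt (1 - x), the primitive of (1/2) (1 - x)^(-1/2). *)
Definition sqrt_coef (n : nat) : R :=
  match n with O => 0 | S m => lazy_return m / (2 * INR (S m)) end.

Lemma sqrt_coef_1 : sqrt_coef 1 = 1 / 2.
Proof. unfold sqrt_coef. rewrite lazy_return_0. simpl; field. Qed.

Lemma sqrt_coef_rec n : (1 <= n)%nat ->
  INR (S n) * sqrt_coef (S n) = (INR n - 1 / 2) * sqrt_coef n.
Proof.
  intros Hn. destruct n as [|n]; [lia|]. unfold sqrt_coef.
  pose proof (lazy_return_rec n) as H. pose proof (pos_INR n).
  rewrite !S_INR. apply Rmult_eq_reg_l with (2 * (2 * INR n + 2)); [|lra].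
  transitivity ((2 * INR n + 2) * lazy_return (S n)); [field; lra|].
  rewrite H. field; lra.
Qed.

Lemma lazy_return_asymp : is_lim_seq (fun n => lazy_return n * rt n) (gauss_lim / PI * 2).
Proof.
  replace 2 with (sqrt (2 / (1 / 2))).
  2:{ replace (2 / (1 / 2)) with (2 * 2) by field. apply sqrt_square; lra. }
  apply local_limit with (k := 0%Z).
  - intros a [<-|[<-|[<-|[]]]]; simpl; lra.
  - simpl; field.
  - simpl; field.
  - simpl; field.
  - lra.
  - intros t Ht. rewrite lazy_char, Cmod_R.
    assert (Hc : cos t < 1).
    { replace t with (2 * (t / 2)) by field. rewrite cos_2a_sin.
      assert (0 < sin (t / 2)) by (apply sin_gt_0; lra). nra. }
    pose proof (COS_bound t). rewrite Rabs_pos_eq; lra.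
Qed.

(** The constant is [ks] without its factor sqrt (2 / s2), so in the quotient only C/tau
    survives. *)
Lemma sqrt_coef_asymp : is_lim_seq (fun n => sqrt_coef n * rt n ^ 3) (gauss_lim / PI).
Proof.
  apply is_lim_seq_ext_loc with (fun n =>
    lazy_return (n - 1) * rt n ^ 1 * (rt n ^ 2 / INR n) * / 2).
  { exists 1%nat; intros [|n] Hn; [lia|]. unfold sqrt_coef.
    replace (S n - 1)%nat with n by lia.
    assert (0 < INR (S n)) by (apply lt_0_INR; lia). field; lra. }
  replace (Finite (gauss_lim / PI)) with (Finite (gauss_lim / PI * 2 * 1 * / 2))
    by (f_equal; field; apply Rgt_not_eq, PI_RGT_0).
  apply is_lim_seq_mult'; [apply is_lim_seq_mult'|apply is_lim_seq_const].
  - apply lim_rt_shift. eapply is_lim_seq_ext; [|apply lazy_return_asymp].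
    intros; simpl; ring.
  - apply lim_INR_ratio.
Qed.

Lemma is_derive_powerRZ u i : 0 < u ->
  is_derive (fun u => powerRZ u i) u (IZR i * powerRZ u (i - 1)).
Proof.
  intros Hu. apply is_derive_ext_loc with (fun u => Rpower u (IZR i)).
  - exists (mkposreal u Hu). intros y Hy. symmetry; apply powerRZ_Rpower.
    unfold ball in Hy; simpl in Hy; unfold AbsRing_ball, abs, minus, plus, opp in Hy; simpl in Hy.
    apply Rabs_def2 in Hy. lra.
  - rewrite powerRZ_Rpower, minus_IZR by auto. apply is_derive_Reals.
    now apply derivable_pt_lim_power.
Qed.

Lemma is_derive_integ l (g g' : Z -> R -> R) u :
  (forall i, is_derive (g i) u (g' i u)) ->
  is_derive (fun u => integ l (fun i => g i u)) u (integ l (fun i => g' i u)).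
Proof.
  intros H. induction l as [|a l IH]; simpl.
  - apply (is_derive_const (V := R_NormedModule)).
  - apply (is_derive_plus (V := R_NormedModule)); [|exact IH].
    apply (is_derive_scal (fun u => g (fst a) u)); [apply H].
Qed.

Lemma Pfun_integ c d p u : Pfun c d p u = integ (steps c d p) (fun i => powerRZ u i).
Proof. now rewrite integ_steps. Qed.

Lemma Derive_Pfun c d p u : 0 < u ->
  Derive (Pfun c d p) u = integ (steps c d p) (fun i => IZR i * powerRZ u (i - 1)).
Proof.
  intros Hu. apply is_derive_unique.
  apply is_derive_ext with (fun u => integ (steps c d p) (fun i => powerRZ u i)).
  - intros; symmetry; apply Pfun_integ.
  - apply (is_derive_integ _ (fun i u => powerRZ u i) (fun i u => IZR i * powerRZ u (i - 1))).
    intros; now apply is_derive_powerRZ.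
Qed.

Lemma Derive2_Pfun c d p u : 0 < u ->
  Derive_n (Pfun c d p) 2 u
  = integ (steps c d p) (fun i => IZR i * (IZR (i - 1) * powerRZ u (i - 1 - 1))).
Proof.
  intros Hu. apply is_derive_unique.
  apply is_derive_ext_loc with (fun u => integ (steps c d p) (fun i => IZR i * powerRZ u (i - 1))).
  - exists (mkposreal u Hu). intros y Hy. symmetry; apply Derive_Pfun.
    unfold ball in Hy; simpl in Hy; unfold AbsRing_ball, abs, minus, plus, opp in Hy; simpl in Hy.
    apply Rabs_def2 in Hy. lra.
  - apply (is_derive_integ _ (fun i u => IZR i * powerRZ u (i - 1))
      (fun i u => IZR i * (IZR (i - 1) * powerRZ u (i - 1 - 1)))).
    intros i. apply (is_derive_scal (fun u => powerRZ u (i - 1))). now apply is_derive_powerRZ.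
Qed.

Lemma cos_add_mult x y n : cos x = 1 -> cos (y + INR n * x) = cos y.
Proof.
  intros H. assert (Hs : sin x = 0).
  { pose proof (sin2_cos2 x) as E; unfold Rsqr in E. nra. }
  induction n as [|n IH]; [f_equal; simpl; ring|].
  rewrite S_INR. replace (y + (INR n + 1) * x) with (y + INR n * x + x) by ring.
  rewrite cos_plus, H, Hs, IH. ring.
Qed.

(* If [e^(i (x-y) t) = 1] for all jumps x, y, then all jumps are congruent modulo the
   least k >= 1 with [e^(i k t) = 1]. *)
Lemma aperiodic_cos c d p t :
  (1 <= c)%nat -> (1 <= d)%nat -> 
  (forall i : Z, (i < - Z.of_nat c)%Z \/ (Z.of_nat d < i)%Z -> p i = 0) ->
  p (Z.of_nat d) <> 0 -> aperiodic p -> 0 < t <= PI ->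
  (forall i, p i <> 0 -> cos (IZR (i + Z.of_nat c) * t) = 1) -> False.
Proof.
  intros Hc Hd Hsupp Hpd Hap Ht Hcos.
  destruct (dec_inh_nat_subset_has_unique_least_element
    (fun k => (1 <= k)%nat /\ cos (INR k * t) = 1)) as [k [[[Hk1 Hk2] Hmin] _]].
  { intros n. destruct (le_dec 1 n) as [H|H]; [|right; tauto].
    destruct (Req_dec_T (cos (INR n * t)) 1); [left|right]; tauto. }
  { exists (d + c)%nat; split; [lia|]. specialize (Hcos _ Hpd).
    now rewrite INR_IZR_INZ, Nat2Z.inj_add. }
  assert (Hk : (2 <= k)%nat).
  { destruct (Nat.eq_dec k 1) as [->|]; [|lia].
    rewrite Rmult_1_l in Hk2.
    replace t with (2 * (t / 2)) in Hk2 by field. rewrite cos_2a_sin in Hk2.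
    assert (0 < sin (t / 2)) by (apply sin_gt_0; lra). nra. }
  assert (Hdiv : forall i, p i <> 0 -> ((i + Z.of_nat c) mod Z.of_nat k = 0)%Z).
  { intros i Hi. assert (Hm : (0 <= i + Z.of_nat c)%Z).
    { destruct (Z.lt_ge_cases i (- Z.of_nat c)); [|lia]. exfalso; apply Hi, Hsupp; auto. }
    specialize (Hcos i Hi). set (m := (i + Z.of_nat c)%Z) in *.
    pose proof (Z.mod_pos_bound m (Z.of_nat k) ltac:(lia)) as Hr.
    destruct (Z.eq_dec (m mod Z.of_nat k) 0) as [|Hr0]; [auto|exfalso].
    set (r := Z.to_nat (m mod Z.of_nat k)). set (a := Z.to_nat (m / Z.of_nat k)).
    assert (Ha : (0 <= m / Z.of_nat k)%Z) by (apply Z.div_pos; lia).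
    assert (E : IZR m = INR r + INR a * INR k).
    { rewrite !INR_IZR_INZ, <- mult_IZR, <- plus_IZR. f_equal. unfold r, a.
      pose proof (Z.div_mod m (Z.of_nat k) ltac:(lia)). lia. }
    rewrite E, Rmult_plus_distr_r, Rmult_assoc, cos_add_mult in Hcos by auto.
    assert (k <= r)%nat; [apply Hmin; split; [unfold r; lia|auto]|]. unfold r in *; lia. }
  apply Hap. exists (- Z.of_nat c)%Z, (Z.of_nat k), (fun j => p (- Z.of_nat c + Z.of_nat k * j)%Z).
  split; [lia|split].
  - exists (Z.of_nat (c + d)). intros j Hj. apply Hsupp. nia.
  - intros i. replace (i - - Z.of_nat c)%Z with (i + Z.of_nat c)%Z by ring.
    destruct (Z.eqb_spec ((i + Z.of_nat c) mod Z.of_nat k) 0) as [E|E].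
    + f_equal. pose proof (Z.div_mod (i + Z.of_nat c) (Z.of_nat k) ltac:(lia)). lia.
    + destruct (Req_dec (p i) 0); [auto|]. exfalso; auto.
Qed.

(** * Roots, tails and divergence of series *)

Lemma harmonic_unbounded M : exists N, M < sum_f_R0 (fun n => / INR (S n)) N.
Proof.
  assert (H : forall N, ln (INR (S (S N))) <= sum_f_R0 (fun n => / INR (S n)) N).
  { assert (Hstep : forall n, ln (INR (S (S n))) - ln (INR (S n)) <= / INR (S n)).
    { intros n. assert (0 < INR (S n)) by (apply lt_0_INR; lia).
      assert (0 < INR (S (S n))) by (apply lt_0_INR; lia).
      rewrite <- ln_div by auto.
      replace (INR (S (S n)) / INR (S n)) with (1 + / INR (S n))
        by (rewrite (S_INR (S n)); field; lra).
      rewrite <- (ln_exp (/ INR (S n))) at 2.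
      assert (0 < / INR (S n)) by now apply Rinv_0_lt_compat.
      destruct (exp_ge_id (/ INR (S n))) as [Hl|Hl]; [left; apply ln_increasing; lra|].
      rewrite Hl; lra. }
    induction N as [|N IH].
    - specialize (Hstep 0%nat). simpl in *. rewrite ln_1 in Hstep. lra.
    - rewrite tech5. specialize (Hstep (S N)). lra. }
  destruct (INR_unbounded (exp M)) as [N HN]. exists N.
  eapply Rlt_le_trans; [|apply H].
  rewrite <- (ln_exp M). apply ln_increasing; [apply exp_pos|].
  rewrite !S_INR. lra.
Qed.

(** With t = s^2, Bernoulli's inequality for 1/s bounds s^n (n + 1); squaring gives even the order
    n^(-2). *)
Lemma geometric_rt3 t : 0 < t < 1 -> exists K, 0 < K /\ forall n, t ^ n <= K / rt n ^ 3.
Proof.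
  intros Ht. set (s := sqrt t). assert (Hs : 0 < s) by (apply sqrt_lt_R0; lra).
  assert (Hss : s * s = t) by (apply sqrt_sqrt; lra).
  assert (Hs1 : s < 1) by nra.
  set (e := Rmin 1 (/ s - 1)).
  assert (He : 0 < e).
  { apply Rmin_glb_lt; [lra|]. assert (1 < / s); [|lra].
    rewrite <- Rinv_1. apply Rinv_lt_contravar; lra. }
  assert (Hb : forall n, s ^ n * (e * (INR n + 1)) <= 1).
  { intros n. pose proof (poly n e He) as Hp.
    assert (He1 : e <= 1) by apply Rmin_l. assert (He2 : e <= / s - 1) by apply Rmin_r.
    apply Rle_trans with (s ^ n * (1 + e) ^ n).
    - apply Rmult_le_compat_l; [apply pow_le; lra|]. lra.
    - rewrite <- Rpow_mult_distr. apply Rle_trans with (1 ^ n); [|rewrite pow1; lra].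
      apply pow_incr. split; [nra|].
      apply Rle_trans with (s * / s); [apply Rmult_le_compat_l; lra|]. rewrite Rinv_r; lra. }
  exists (/ (e * e)); split; [apply Rinv_0_lt_compat; nra|]. intros n.
  specialize (Hb n). rewrite <- rt_sqr in Hb. pose proof (rt_pos n). pose proof (rt_ge1 n).
  rewrite <- Hss, Rpow_mult_distr. pose proof (pow_lt s n Hs).
  apply Rmult_le_reg_r with (e * e * rt n ^ 3).
  { apply Rmult_lt_0_compat; [nra|now apply pow_lt]. }
  replace (/ (e * e) / rt n ^ 3 * (e * e * rt n ^ 3)) with 1 by (field; lra).
  apply Rle_trans with ((s ^ n * (e * (rt n * rt n))) * (s ^ n * (e * (rt n * rt n)))).
  - nra.
  - assert (0 <= s ^ n * (e * (rt n * rt n))) by (repeat apply Rmult_le_pos; lra). nra.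
Qed.

Lemma series_strict_mono (q : nat -> R) m r r' s :
  (forall n, 0 <= q n) -> 0 < q (S m) -> 0 <= r' < r ->
  is_series (fun n => q n * r ^ n) s -> is_series (fun n => q n * r' ^ n) s -> False.
Proof.
  intros Hq Hm Hr H1 H2.
  assert (H : is_series (fun n => q n * r ^ n - q n * r' ^ n) (s - s))
    by (apply (is_series_minus (V := R_NormedModule)); auto).
  assert (Hp : forall n, 0 <= q n * r ^ n - q n * r' ^ n).
  { intros n. assert (r' ^ n <= r ^ n) by (apply pow_incr; lra). specialize (Hq n). nra. }
  pose proof (sum_le_series _ _ (S m) Hp H).
  pose proof (sum_term_le _ (S m) (S m) Hp (le_n _)).
  assert (r' ^ S m < r ^ S m).
  { simpl. assert (r' ^ m <= r ^ m) by (apply pow_incr; lra).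
    assert (0 < r ^ m) by (apply pow_lt; lra). nra. }
  nra.
Qed.

(** [psum_near_one] moves the excess over 1 to a point x0 < 1. Bounded coefficients make the series
    continuous on [0, x0], and the intermediate value theorem applies. *)
Lemma power_series_root (a : nat -> R) K N :
  (forall n, 0 <= a n <= K) -> a O = 0 -> 1 < sum_f_R0 a N ->
  exists x, 0 < x < 1 /\ is_series (fun n => a n * x ^ n) 1.
Proof.
  intros Ha Ha0 HN.
  assert (Habs : forall n, Rabs (a n) <= K) by (intros n; rewrite Rabs_pos_eq; apply Ha).
  assert (Hin : forall y, 0 <= y < 1 -> Rbar_lt (Rabs y) (CV_radius a)).
  { intros y Hy. apply inside_CV with K; [exact Habs|]. rewrite Rabs_pos_eq; lra. }
  destruct (psum_near_one a N (fun n => proj1 (Ha n)) HN) as [x0 [Hx0 Hx1]].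
  assert (Hgt : 1 < PSeries a x0).
  { eapply Rlt_le_trans; [exact Hx1|]. apply sum_le_series; [|apply is_series_PSeries, Hin; lra].
    intros n; apply Rmult_le_pos; [apply Ha|apply pow_le; lra]. }
  destruct (IVT_interv (fun x => PSeries a x - 1) 0 x0) as [z [Hz1 Hz2]].
  - intros y Hy. apply continuity_pt_minus; [|apply continuity_pt_const; now intros u v].
    apply PSeries_continuity, Hin. lra.
  - lra.
  - rewrite PSeries_0, Ha0; lra.
  - lra.
  - exists z. assert (z <> 0).
    { intros ->. rewrite PSeries_0, Ha0 in Hz2. lra. }
    split; [lra|]. replace 1 with (PSeries a z) by lra.
    apply is_series_PSeries, Hin. lra.
Qed.

(** The difference of the two sides decreases in n and tends to 0, hence is nonnegative. *)
Lemma geometric_tail (q : nat -> R) K t :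
  0 < t < 1 -> 0 <= K -> is_series q 1 -> (forall n, 0 <= q n <= K * t ^ n) ->
  forall n, tail_mass q n <= K / (1 - t) * t ^ n.
Proof.
  intros Ht HK HQ Hq n.
  assert (HL : is_lim_seq (fun n => K / (1 - t) * t ^ n - tail_mass q n) (K / (1 - t) * 0 - 0)).
  { apply is_lim_seq_minus'.
    - apply is_lim_seq_mult'; [apply is_lim_seq_const|].
      apply is_lim_seq_geom. rewrite Rabs_pos_eq; lra.
    - now apply tail_lim. }
  assert (0 <= K / (1 - t) * t ^ n - tail_mass q n); [|lra].
  replace 0 with (K / (1 - t) * 0 - 0) by ring.
  apply (is_lim_seq_decr_compare _ _ HL). intros k.
  assert (tail_mass q (S k) = tail_mass q k - q (S k)) by (unfold tail_mass; simpl; ring).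
  specialize (Hq (S k)).
  assert (K / (1 - t) * t ^ k - K / (1 - t) * t ^ S k = K * t ^ k) by (simpl; field; lra).
  simpl in Hq. nra.
Qed.

(** * Walks with catastrophes *)

Section Model.
Variables (c d : nat) (p : Z -> R) (q : R).
Hypothesis Hc : (1 <= c)%nat.
Hypothesis Hd : (1 <= d)%nat.
Hypothesis Hpnn : forall i : Z, 0 <= p i.
Hypothesis Hpsupp : forall i : Z, (i < - Z.of_nat c)%Z \/ (Z.of_nat d < i)%Z -> p i = 0.
Hypothesis Hpc : p (- Z.of_nat c)%Z <> 0.
Hypothesis Hpd : p (Z.of_nat d) <> 0.
Hypothesis Hap : aperiodic p.
Hypothesis Hq : 0 < q.

Lemma steps_mass t r a : 0 < t -> 0 < r -> In a (steps c d (tilt p t r)) -> 0 <= snd a.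
Proof.
  intros Ht Hr Ha. apply in_steps in Ha. destruct Ha as [_ ->].
  repeat apply Rmult_le_pos; auto; [left; now apply powerRZ_lt|lra].
Qed.

Lemma untilted_mass a : In a (steps c d p) -> 0 <= snd a.
Proof. intros Ha. apply in_steps in Ha. destruct Ha as [_ ->]. auto. Qed.

Lemma steps_le w a : In a (steps c d w) -> (fst a <= Z.of_nat d)%Z.
Proof. intros Ha; apply in_steps in Ha; lia. Qed.

Lemma Pfun_pos u : 0 < u -> 0 < Pfun c d p u.
Proof.
  intros Hu. rewrite Pfun_integ.
  eapply Rlt_le_trans; [|apply (integ_ge_atom _ _ (Z.of_nat d, p (Z.of_nat d)))].
  - simpl. apply Rmult_lt_0_compat; [|now apply powerRZ_lt].
    specialize (Hpnn (Z.of_nat d)); lra.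
  - apply untilted_mass.
  - intros a _; left; now apply powerRZ_lt.
  - apply steps_in; lia.
Qed.

Lemma mcoef_nonneg n k : 0 <= mcoef c d p n k.
Proof.
  rewrite mcoef_meander. apply integ_ge0; [apply meander_mass, untilted_mass|].
  intros; unfold dirac; destruct (_ =? _)%Z; lra.
Qed.

Lemma mcoef_zero n k : (d * n < k)%nat -> mcoef c d p n k = 0.
Proof.
  intros Hk. rewrite mcoef_meander, (integ_ext_in _ _ (fun _ => 0)).
  - now apply integ_zero.
  - intros a Ha. pose proof (meander_le _ d n a (steps_le p) Ha). unfold dirac.
    destruct (Z.eqb_spec (fst a) (Z.of_nat k)); [lia|reflexivity].
Qed.

(** One indicator for both subtractions in [Qc]: the test [0 <? k] removes E, the test on [p] the
    M_j with -j a jump. *)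
Definition is_cat (k : nat) : R :=
  if (0 <? k)%nat && (if Req_EM_T (p (- Z.of_nat k)%Z) 0 then true else false) then 1 else 0.

Lemma is_cat_range k : 0 <= is_cat k <= 1.
Proof. unfold is_cat; destruct (_ && _); lra. Qed.

Lemma is_cat_large k : (c < k)%nat -> is_cat k = 1.
Proof.
  intros Hk. unfold is_cat. rewrite (proj2 (Nat.ltb_lt _ _)) by lia.
  destruct (Req_EM_T (p (- Z.of_nat k)%Z) 0) as [|E]; [reflexivity|].
  exfalso; apply E, Hpsupp; lia.
Qed.

Lemma Qc_S n k : Qc c d p q (S n) k = q * (is_cat k * mcoef c d p n k).
Proof.
  unfold Qc, is_cat. destruct k as [|k]; [simpl; ring|].
  destruct (Req_EM_T _ 0); simpl; ring.
Qed.

Lemma Qc_nonneg n k : 0 <= Qc c d p q n k.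
Proof.
  destruct n; [simpl; lra|]. rewrite Qc_S.
  apply Rmult_le_pos; [lra|]. apply Rmult_le_pos; [apply is_cat_range|apply mcoef_nonneg].
Qed.

Lemma Qc_zero n k : (d * n < k)%nat -> Qc c d p q n k = 0.
Proof.
  intros Hk. destruct n; [reflexivity|]. rewrite Qc_S, mcoef_zero by lia. ring.
Qed.

Lemma Qnu_nonneg n u : 0 <= u -> 0 <= Qnu c d p q n u.
Proof.
  intros Hu; apply cond_pos_sum; intros; apply Rmult_le_pos; [apply Qc_nonneg|now apply pow_le].
Qed.

Lemma Qnu_0 u : Qnu c d p q 0 u = 0.
Proof. unfold Qnu. rewrite Nat.mul_0_r. simpl. ring. Qed.

Lemma Q1c_S n :
  Q1c c d p q (S n) = q * sum_f_R0 (fun k => is_cat k * mcoef c d p n k) (d * S n).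
Proof.
  rewrite <- sum_scal_l. apply sum_eq; intros k Hk.
  rewrite Qc_S, pow1; ring.
Qed.

Lemma Qc_le_Q1c n k : Qc c d p q n k <= Q1c c d p q n.
Proof.
  destruct (le_lt_dec k (d * n)) as [Hk|Hk].
  - replace (Qc c d p q n k) with (Qc c d p q n k * 1 ^ k) by (rewrite pow1; ring).
    apply (sum_term_le (fun k => Qc c d p q n k * 1 ^ k)); [|exact Hk].
    intros; rewrite pow1, Rmult_1_r; apply Qc_nonneg.
  - rewrite Qc_zero by exact Hk. apply Qnu_nonneg; lra.
Qed.

(* An excursion followed by [c + 1] up-steps ends at an altitude from which a jump to 0 is
   a catastrophe. *)
Lemma Q1c_ge_excursion n :
  q * (p (Z.of_nat d) ^ (c + 1) * mcoef c d p n 0) <= Q1c c d p q (S (n + (c + 1))).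
Proof.
  set (j := (c + 1)%nat).
  apply Rle_trans with (Qc c d p q (S (n + j)) (d * j)); [|apply Qc_le_Q1c].
  rewrite Qc_S, is_cat_large by (unfold j; nia). rewrite Rmult_1_l.
  apply Rmult_le_compat_l; [lra|]. rewrite !mcoef_meander.
  eapply Rle_trans; [|apply (meander_steps_up (steps c d p) d (p (Z.of_nat d)))].
  - apply Req_le; f_equal. apply integ_ext; intros y. unfold dirac.
    destruct (Z.eqb_spec y (Z.of_nat 0)); destruct (Z.eqb_spec (Z.of_nat (d * j) + y) (Z.of_nat (d * j)));
      try reflexivity; lia.
  - apply untilted_mass.
  - apply steps_in; lia.
  - intros x _; unfold dirac; destruct (_ =? _)%Z; lra.
  - apply Hpnn.
Qed.

Lemma Qpowc_nonneg r n : 0 <= Qpowc c d p q r n.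
Proof.
  revert n; induction r as [|r IH]; intros n; simpl; [destruct (n =? 0)%nat; lra|].
  apply conv_nonneg; [intros; apply Qnu_nonneg; lra|exact IH].
Qed.

Lemma Qpowc_zero r n : (n < r)%nat -> Qpowc c d p q r n = 0.
Proof.
  revert n; induction r as [|r IH]; intros n Hn; [lia|].
  apply sum_zero; intros [|i] Hi.
  - unfold Q1c; rewrite Qnu_0; ring.
  - rewrite IH by lia; ring.
Qed.

Lemma Dc_nonneg n : 0 <= Dc c d p q n.
Proof. apply cond_pos_sum; intros; apply Qpowc_nonneg. Qed.

Lemma Dc_extend n N : (n <= N)%nat ->
  Dc c d p q n = sum_f_R0 (fun r => Qpowc c d p q r n) N.
Proof.
  intros H; symmetry; apply sum_extend_zero; [intros; now apply Qpowc_zero|exact H].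
Qed.

(** Q has no constant term, so Q^r starts at z^r and cutting the geometric series at r = n loses
    nothing. *)
Lemma Dc_rec n : Dc c d p q n = delta0 n + conv (Q1c c d p q) (Dc c d p q) n.
Proof.
  rewrite (Dc_extend n (S n)) by lia. rewrite decomp_sum by lia.
  unfold conv.
  rewrite (sum_eq (fun i => Q1c c d p q i * Dc c d p q (n - i))
    (fun i => sum_f_R0 (fun r => Q1c c d p q i * Qpowc c d p q r (n - i)) n)).
  - rewrite sum_exchange. reflexivity.
  - intros i Hi. rewrite (Dc_extend (n - i) n), sum_scal_l by lia. reflexivity.
Qed.

Lemma Ec_nonneg n : 0 <= Ec c d p n.
Proof. apply mcoef_nonneg. Qed.

Lemma Ec_0 : Ec c d p 0 = 1.
Proof.
  unfold Ec; rewrite mcoef_meander. unfold dirac; simpl. ring.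
Qed.

Section Scaled.
Variable r : R.

(** Scaling by r^n moves the point z = r to 1, where the sequence lemmas are stated; it commutes
    with [conv]. *)
Definition sE n := Ec c d p n * r ^ n.
Definition sD n := Dc c d p q n * r ^ n.
Definition sQ u n := Qnu c d p q n u * r ^ n.
Definition sQk k n := Qc c d p q n k * r ^ n.

Lemma sD_rec n : sD n = delta0 n + conv (sQ 1) sD n.
Proof.
  unfold sD at 1. rewrite Dc_rec, Rmult_plus_distr_r. unfold sQ, sD.
  rewrite conv_geom. f_equal. unfold delta0; destruct n; simpl; ring.
Qed.

Lemma sAc n k :
  Ac c d p q n k * r ^ n
  = (if Nat.eqb k 0 then sE n else 0) + conv (sQk k) (conv sD (conv sD sE)) n.
Proof.
  unfold Ac. rewrite Rmult_plus_distr_r. f_equal.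
  - destruct (k =? 0)%nat; unfold sE; ring.
  - rewrite <- conv_geom. apply conv_ext; intros i _; [reflexivity|].
    rewrite <- conv_geom. apply conv_ext; intros j _; [reflexivity|].
    now rewrite <- conv_geom.
Qed.

Lemma sAc_gf n u :
  sum_f_R0 (fun k => Ac c d p q n k * u ^ k) (d * n) * r ^ n
  = sE n + conv (sQ u) (conv sD (conv sD sE)) n.
Proof.
  rewrite Rmult_comm, <- sum_scal_l.
  rewrite (sum_eq _ (fun k => (if (k =? 0)%nat then sE n else 0)
      + sum_f_R0 (fun i => sQk k i * u ^ k * conv sD (conv sD sE) (n - i)%nat) n)).
  - rewrite plus_sum. f_equal.
    + rewrite (sum_single (fun _ => sE n) 0 (d * n)) by lia. reflexivity.
    + rewrite sum_exchange. apply sum_eq; intros i Hi.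
      rewrite Rmult_comm.
      rewrite (sum_eq _ (fun k => conv sD (conv sD sE) (n - i)%nat * (sQk k i * u ^ k)))
        by (intros; ring).
      rewrite sum_scal_l. f_equal. unfold sQ, Qnu, sQk.
      rewrite Rmult_comm, <- sum_scal_l.
      rewrite <- (sum_extend_zero (fun k => r ^ i * (Qc c d p q i k * u ^ k)) (d * i) (d * n)).
      * apply sum_eq; intros; ring.
      * intros k Hk; rewrite Qc_zero by exact Hk; ring.
      * apply Nat.mul_le_mono_l; lia.
  - intros k Hk. rewrite <- Rmult_assoc, (Rmult_comm (r ^ n)), sAc, Rmult_plus_distr_r.
    f_equal.
    + destruct k; simpl; ring.
    + unfold conv at 1; rewrite Rmult_comm, <- sum_scal_l. apply sum_eq; intros; ring.
Qed.
End Scaled.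

(** * Tilting by tau and coefficient asymptotics at rho *)

Variable tau : R.
Hypothesis Htau : 0 < tau.
Hypothesis HDtau : Derive (Pfun c d p) tau = 0.

Definition rho := rho_of c d p tau.
(* Tilting by tau makes the steps a centred probability law. *)
Definition tsteps := steps c d (tilt p tau rho).
Definition s2 := integ tsteps (fun x => IZR x * IZR x).

Lemma rho_pos : 0 < rho.
Proof. apply Rinv_0_lt_compat, Pfun_pos, Htau. Qed.

Lemma tsteps_mass a : In a tsteps -> 0 <= snd a.
Proof. apply steps_mass; [exact Htau|apply rho_pos]. Qed.

Lemma tsteps_total : integ tsteps (fun _ => 1) = 1.
Proof.
  unfold tsteps. rewrite integ_steps_tilt.
  rewrite (integ_ext _ _ (fun i => powerRZ tau i)) by (intros; ring).
  rewrite <- Pfun_integ. apply Rinv_l. apply Rgt_not_eq, Pfun_pos, Htau.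
Qed.

Lemma powerRZ_pred u i : 0 < u -> powerRZ u i = u * powerRZ u (i - 1).
Proof.
  intros Hu. replace i with (1 + (i - 1))%Z at 1 by ring.
  rewrite powerRZ_add by lra. simpl. ring.
Qed.

Lemma untilted_mean : integ (steps c d p) (fun i => IZR i * powerRZ tau i) = 0.
Proof.
  rewrite (integ_ext _ _ (fun i => tau * (IZR i * powerRZ tau (i - 1)))).
  - rewrite integ_scal, <- Derive_Pfun, HDtau by auto. ring.
  - intros i. rewrite (powerRZ_pred tau i) by auto. ring.
Qed.

Lemma tsteps_mean : integ tsteps IZR = 0.
Proof.
  unfold tsteps. rewrite integ_steps_tilt.
  rewrite (integ_ext _ _ (fun i => IZR i * powerRZ tau i)) by (intros; ring).
  rewrite untilted_mean. ring.
Qed.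

Lemma tilt_pos i : p i <> 0 -> 0 < tilt p tau rho i.
Proof.
  intros Hi. pose proof (Hpnn i). pose proof rho_pos.
  repeat apply Rmult_lt_0_compat; [lra|now apply powerRZ_lt|auto].
Qed.

Lemma s2_pos : 0 < s2.
Proof.
  eapply Rlt_le_trans; [|apply (integ_ge_atom _ _ (Z.of_nat d, tilt p tau rho (Z.of_nat d)))].
  - simpl. pose proof (tilt_pos _ Hpd). apply Rmult_lt_0_compat; [auto|].
    assert (0 < IZR (Z.of_nat d)) by (apply IZR_lt; lia). nra.
  - apply tsteps_mass.
  - intros a _; nra.
  - apply steps_in; lia.
Qed.

(** As the tilted mean vanishes, the variance is rho tau^2 P''(tau) with rho = 1/P(tau). This
    identifies C/tau with the constant of the local limit theorem. *)
Lemma s2_formula :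
  sqrt (2 * Pfun c d p tau / Derive_n (Pfun c d p) 2 tau) / tau = sqrt (2 / s2).
Proof.
  assert (E : s2 = rho * (tau * tau * Derive_n (Pfun c d p) 2 tau)).
  { unfold s2, tsteps. rewrite integ_steps_tilt, Derive2_Pfun by auto. f_equal.
    rewrite <- integ_scal.
    rewrite <- (Rplus_0_r (integ _ (fun x => tau * tau * _))), <- untilted_mean, <- integ_plus.
    apply integ_ext; intros i.
    rewrite (powerRZ_pred tau i), (powerRZ_pred tau (i - 1)), minus_IZR by auto. ring. }
  pose proof s2_pos as Hs. pose proof rho_pos as Hr. pose proof (Pfun_pos tau Htau) as HP.
  assert (HP2 : 0 < Derive_n (Pfun c d p) 2 tau).
  { apply Rmult_lt_reg_l with (rho * (tau * tau)); [apply Rmult_lt_0_compat; nra|].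
    rewrite Rmult_0_r, Rmult_assoc, <- E. exact Hs. }
  replace (2 * Pfun c d p tau / Derive_n (Pfun c d p) 2 tau) with (2 / s2 * (tau * tau)).
  - rewrite sqrt_mult, sqrt_square; [field; lra|lra| |nra].
    apply Rdiv_le_0_compat; lra.
  - rewrite E. unfold rho, rho_of. field. lra.
Qed.

(** The double sum of w_x w_y (1 - cos ((y - x) t)) equals 1 - |phi(t)|^2. If this is not positive,
    every term vanishes; the terms with x = -c form the hypothesis of [aperiodic_cos]. *)
Lemma tsteps_per t : 0 < t <= PI -> Cmod (char_fun tsteps t) < 1.
Proof.
  intros Ht. apply Rnot_le_lt; intros Hge.
  set (A := fst (char_fun tsteps t)). set (B := snd (char_fun tsteps t)).
  assert (HAB : 1 <= A * A + B * B).
  { replace (A * A + B * B) with (Cmod (char_fun tsteps t) * Cmod (char_fun tsteps t)).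
    - nra.
    - unfold Cmod. rewrite sqrt_sqrt; [unfold A, B; ring|].
      apply Rplus_le_le_0_compat; apply pow2_ge_0. }
  set (G := fun x : Z => integ tsteps (fun y => 1 - cos (IZR (y - x) * t))).
  assert (Hpos : forall x y : Z, 0 <= 1 - cos (IZR (y - x) * t))
    by (intros; pose proof (COS_bound (IZR (y - x) * t)); lra).
  assert (HGpos : forall x, 0 <= G x).
  { intros x; apply integ_ge0; [apply tsteps_mass|]. intros; apply Hpos. }
  assert (HG : integ tsteps G <= 0).
  { assert (EG : forall x, G x = 1 + -1 * (A * cos (IZR x * t) + B * sin (IZR x * t))).
    { intros x. unfold G. rewrite <- tsteps_total at 1.
      rewrite (integ_ext _ _ (fun y => 1 + -1 * cos (IZR (y - x) * t))) by (intros; ring).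
      rewrite integ_plus, integ_scal, char_fun_shift. fold A B. ring. }
    rewrite (integ_ext _ _ _ EG), integ_plus, integ_scal, integ_plus, !integ_scal, tsteps_total.
    change (integ tsteps (fun x => cos (IZR x * t))) with A.
    change (integ tsteps (fun x => sin (IZR x * t))) with B. lra. }
  apply (aperiodic_cos c d p t); auto.
  intros i Hi.
  assert (Hir : (- Z.of_nat c <= i <= Z.of_nat d)%Z).
  { destruct (Z.lt_ge_cases i (- Z.of_nat c)); [exfalso; apply Hi, Hpsupp; auto|].
    destruct (Z.lt_ge_cases (Z.of_nat d) i); [exfalso; apply Hi, Hpsupp; auto|lia]. }
  pose proof (integ_ge_atom tsteps G _ tsteps_mass (fun a _ => HGpos (fst a))
    (steps_in c d (tilt p tau rho) (- Z.of_nat c) ltac:(lia))) as H1. simpl in H1.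
  pose proof (tilt_pos _ Hpc) as Hwc.
  assert (HG0 : G (- Z.of_nat c)%Z <= 0) by nra.
  pose proof (integ_ge_atom tsteps (fun y => 1 - cos (IZR (y - - Z.of_nat c) * t)) _ tsteps_mass
    (fun a _ => Hpos _ (fst a)) (steps_in c d (tilt p tau rho) i Hir)) as H2. simpl in H2.
  pose proof (tilt_pos _ Hi) as Hwi.
  specialize (Hpos (- Z.of_nat c)%Z i). fold (G (- Z.of_nat c)%Z) in H2.
  replace (i + Z.of_nat c)%Z with (i - - Z.of_nat c)%Z by ring. nra.
Qed.

(* [P(S_n = k) ~ ks n^(-1/2)] for the tilted walk S, for every fixed k. *)
Definition ks := gauss_lim / PI * sqrt (2 / s2).

Lemma ks_pos : 0 < ks.
Proof.
  apply Rmult_lt_0_compat.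
  - apply Rdiv_lt_0_compat; [apply gauss_lim_pos|apply PI_RGT_0].
  - apply sqrt_lt_R0, Rdiv_lt_0_compat; [lra|apply s2_pos].
Qed.

Lemma tilted_dirac n k :
  integ (meander tsteps n) (dirac (Z.of_nat k)) = rho ^ n * tau ^ k * mcoef c d p n k.
Proof. apply mcoef_tilt; lra. Qed.

Lemma sE_gf n : sE rho n = integ (meander tsteps n) (zpow 0).
Proof.
  unfold sE, Ec. rewrite (integ_ext _ _ (dirac (Z.of_nat 0))).
  - rewrite tilted_dirac. ring.
  - intros x. unfold zpow, cut, dirac. simpl Z.of_nat.
    destruct (Z.leb_spec 0 x); destruct (Z.eqb_spec x 0); try lia; subst; simpl; auto.
    apply pow_i; lia.
Qed.

Lemma sE_asymp : exists Se, 1 <= Se /\ is_series (sE rho) Se /\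
  is_lim_seq (fun n => sE rho n * rt n ^ 3) (Se * ks).
Proof.
  destruct (meander_gf_asymp tsteps s2 d tsteps_mass tsteps_total tsteps_mean eq_refl s2_pos
    tsteps_per Hd (steps_le _) 0 ltac:(lra)) as [S [H1 [H2 H3]]].
  exists S; split; [exact H1|split].
  - eapply is_series_ext; [|exact H2]. intros; symmetry; apply sE_gf.
  - replace (S * ks) with (S * (gauss_lim / PI * sqrt (2 / s2) / (1 - 0))) by (unfold ks; field; apply Rgt_not_eq, PI_RGT_0).
    eapply is_lim_seq_ext; [|exact H3]. intros; now rewrite sE_gf.
Qed.

(** Above altitude c every fall to 0 is a catastrophe, so Q differs from q z M by finitely many
    altitudes, those up to c. The tilting turns u into v = u / [tau]. *)
Lemma sQ_expand v n :
  sQ rho (tau * v) (S n) = q * rho * (integ (meander tsteps n) (zpow v)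
    - sum_f_R0 (fun k => (1 - is_cat k) * integ (meander tsteps n) (dirac (Z.of_nat k)) * v ^ k) c).
Proof.
  set (m := fun k => integ (meander tsteps n) (dirac (Z.of_nat k))).
  assert (Hm : forall k, (d * n < k)%nat -> m k = 0).
  { intros k Hk. unfold m. rewrite tilted_dirac, mcoef_zero by exact Hk. ring. }
  rewrite (integ_zpow _ v (d * S n)).
  2:{ intros a Ha. pose proof (meander_le _ d n a (steps_le _) Ha). nia. }
  change (sQ rho (tau * v) (S n) = q * rho * (sum_f_R0 (fun k => m k * v ^ k) (d * S n)
    - sum_f_R0 (fun k => (1 - is_cat k) * m k * v ^ k) c)).
  rewrite <- (sum_extend_zero (fun k => (1 - is_cat k) * m k * v ^ k) c (c + d * S n)).
  2:{ intros k Hk; rewrite is_cat_large by exact Hk; ring. }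
  2:{ lia. }
  rewrite (sum_extend_zero (fun k => (1 - is_cat k) * m k * v ^ k) (d * S n) (c + d * S n)).
  2:{ intros k Hk; rewrite Hm by lia; ring. }
  2:{ lia. }
  rewrite <- minus_sum, <- sum_scal_l. unfold sQ, Qnu. rewrite Rmult_comm, <- sum_scal_l.
  apply sum_eq; intros k Hk. unfold m. rewrite tilted_dirac, Qc_S, Rpow_mult_distr.
  simpl pow. ring.
Qed.

Lemma sQ_asymp u : 0 <= u < tau ->
  exists lam : R, is_lim_seq (fun n => sQ rho u n * rt n ^ 3) lam.
Proof.
  intros Hu. set (v := u / tau).
  assert (Hv : 0 <= v < 1).
  { unfold v; split; [apply Rdiv_le_0_compat; lra|].
    apply Rmult_lt_reg_r with tau; [auto|]. unfold Rdiv; rewrite Rmult_assoc, Rinv_l; lra. }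
  replace u with (tau * v) by (unfold v; field; lra).
  destruct (meander_gf_asymp tsteps s2 d tsteps_mass tsteps_total tsteps_mean eq_refl s2_pos
    tsteps_per Hd (steps_le _) v Hv) as [S [_ [_ HS]]].
  assert (HL : forall K, exists L : R, is_lim_seq (fun n =>
     sum_f_R0 (fun k => (1 - is_cat k) * integ (meander tsteps n) (dirac (Z.of_nat k)) * v ^ k) K
       * rt n ^ 3) L).
  { assert (H1 : forall k, exists L : R, is_lim_seq (fun n =>
      (1 - is_cat k) * integ (meander tsteps n) (dirac (Z.of_nat k)) * v ^ k * rt n ^ 3) L).
    { intros k. destruct (meander_coef_asymp tsteps s2 d tsteps_mass tsteps_total tsteps_mean eq_refl s2_pos
        tsteps_per Hd (steps_le _) k) as [L HL]. exists ((1 - is_cat k) * v ^ k * L).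
      apply is_lim_seq_ext with (fun n => (1 - is_cat k) * v ^ k *
        (integ (meander tsteps n) (dirac (Z.of_nat k)) * rt n ^ 3)); [intros; ring|].
      apply is_lim_seq_mult'; [apply is_lim_seq_const|exact HL]. }
    induction K as [|K [L HL]]; [apply (H1 0%nat)|].
    destruct (H1 (Datatypes.S K)) as [L2 HL2]. exists (L + L2).
    apply is_lim_seq_ext with (2 := is_lim_seq_plus' _ _ _ _ HL HL2).
    intros n; simpl; ring. }
  destruct (HL c) as [L HLc].
  eexists. apply is_lim_seq_ext_loc with (fun n =>
    (fun m => q * rho * (integ (meander tsteps m) (zpow v)
    - sum_f_R0 (fun k => (1 - is_cat k) * integ (meander tsteps m) (dirac (Z.of_nat k)) * v ^ k) c))
     (n - 1)%nat * rt n ^ 3).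
  { exists 1%nat; intros [|n] Hn; [lia|]. rewrite sQ_expand.
    replace (Datatypes.S n - 1)%nat with n by lia. reflexivity. }
  apply (lim_rt_shift (fun m => q * rho * (integ (meander tsteps m) (zpow v)
    - sum_f_R0 (fun k => (1 - is_cat k) * integ (meander tsteps m) (dirac (Z.of_nat k)) * v ^ k) c)) _ 3 1).
  apply is_lim_seq_ext with (fun n => q * rho * (integ (meander tsteps n) (zpow v) * rt n ^ 3
    - sum_f_R0 (fun k => (1 - is_cat k) * integ (meander tsteps n) (dirac (Z.of_nat k)) * v ^ k) c * rt n ^ 3)).
  { intros; ring. }
  apply is_lim_seq_mult'; [apply is_lim_seq_const|].
  apply is_lim_seq_minus'; [exact HS|exact HLc].
Qed.

Lemma sQ_nonneg u n : 0 <= u -> 0 <= sQ rho u n.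
Proof.
  intros Hu. apply Rmult_le_pos; [now apply Qnu_nonneg|apply pow_le; left; apply rho_pos].
Qed.

Lemma sQ_summable u : 0 <= u < tau -> exists S, is_series (sQ rho u) S.
Proof.
  intros Hu. destruct (sQ_asymp u Hu) as [lam Hlam].
  destruct (lim_rt_bound _ _ _ Hlam) as [K [HK HKn]].
  apply summable_rt3 with K. intros n; split; [apply sQ_nonneg; lra|].
  eapply Rle_trans; [apply Rle_abs|apply HKn].
Qed.

(** Excursions of every large length have positive weight, because their asymptotic constant is
    positive; [Q1c_ge_excursion] carries this over to Q. *)
Lemma Q1c_eventually_pos : exists N, forall n, (N <= n)%nat -> 0 < Q1c c d p q n.
Proof.
  destruct sE_asymp as [Se [HSe [_ HE]]].
  assert (HL : 0 < Se * ks) by (pose proof ks_pos; nra).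
  destruct (proj1 (lim_eps _ _) HE _ HL) as [N HN].
  exists (S (N + (c + 1)))%nat; intros n Hn.
  destruct (Nat.le_exists_sub (S (N + (c + 1))) n Hn) as [m [-> _]].
  replace (m + S (N + (c + 1)))%nat with (S ((m + N) + (c + 1))) by lia.
  eapply Rlt_le_trans; [|apply Q1c_ge_excursion].
  specialize (HN (m + N)%nat ltac:(lia)). apply Rabs_def2 in HN.
  assert (0 < mcoef c d p (m + N) 0).
  { destruct (Rle_lt_or_eq_dec _ _ (mcoef_nonneg (m + N) 0)) as [|E]; [auto|].
    unfold sE, Ec in HN. rewrite <- E in HN. lra. }
  apply Rmult_lt_0_compat; [auto|]. apply Rmult_lt_0_compat; [|auto].
  apply pow_lt. specialize (Hpnn (Z.of_nat d)); lra.
Qed.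

Lemma sQ_lim_pos (lam : R) : is_lim_seq (fun n => sQ rho 1 n * rt n ^ 3) lam -> 0 < lam.
Proof.
  intros Hlam. destruct sE_asymp as [Se [HSe [_ HE]]].
  set (C := q * p (Z.of_nat d) ^ (c + 1) * rho ^ (c + 2)).
  assert (HC : 0 < C).
  { pose proof rho_pos.
    repeat apply Rmult_lt_0_compat; auto; apply pow_lt; auto.
    specialize (Hpnn (Z.of_nat d)); lra. }
  apply Rlt_le_trans with (C * (Se * ks)).
  { pose proof ks_pos. apply Rmult_lt_0_compat; [auto|nra]. }
  assert (HL : is_lim_seq (fun n => C * (sE rho (n - (c + 2)) * rt n ^ 3)) (C * (Se * ks))).
  { apply is_lim_seq_mult'; [apply is_lim_seq_const|]. now apply lim_rt_shift. }
  refine (is_lim_seq_le_loc _ _ (C * (Se * ks)) lam _ HL Hlam).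
  exists (c + 2)%nat; intros n Hn. rewrite <- Rmult_assoc.
  apply Rmult_le_compat_r; [apply pow_le; left; apply rt_pos|].
  set (m := (n - (c + 2))%nat). replace n with (S (m + (c + 1))) by (unfold m; lia).
  pose proof (Q1c_ge_excursion m) as H.
  pose proof rho_pos.
  replace (C * sE rho m) with (q * (p (Z.of_nat d) ^ (c + 1) * mcoef c d p m 0) * rho ^ (S (m + (c + 1)))).
  - apply Rmult_le_compat_r; [apply pow_le; lra|exact H].
  - unfold C, sE, Ec. replace (S (m + (c + 1))) with (m + (c + 2))%nat by lia.
    rewrite (pow_add rho m). ring.
Qed.

(** Used at t = 1, to place the divergence point 1/P(1) of Q at or below [rho] when [tau] <= 1. *)
Lemma rho_bound_R t : 0 < t -> / Pfun c d p t <= rho.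
Proof.
  intros Ht. apply Rinv_le_contravar; [now apply Pfun_pos|].
  pose proof rho_pos as Hr.
  apply Rmult_le_reg_l with rho; [exact Hr|].
  replace (rho * Pfun c d p tau) with 1
    by (unfold rho, rho_of; field; apply Rgt_not_eq, Pfun_pos, Htau).
  (* Jensen: (t/tau)^i >= 1 + i ln (t/tau), and the tilted steps are centred *)
  replace (rho * Pfun c d p t) with (integ tsteps (fun i => powerRZ t i * / powerRZ tau i)).
  - rewrite <- (Rplus_0_r 1), <- (Rmult_0_r (ln (t / tau))), <- tsteps_mean, <- tsteps_total.
    rewrite <- integ_scal, <- integ_plus. apply integ_le; [apply tsteps_mass|].
    intros a _. rewrite !powerRZ_Rpower by auto. unfold Rpower.
    rewrite <- exp_Ropp, <- exp_plus, ln_div by auto.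
    eapply Rle_trans; [|apply exp_ge_id]. lra.
  - unfold tsteps. rewrite integ_steps_tilt, Pfun_integ. f_equal.
    apply integ_ext; intros i. field. apply Rgt_not_eq, powerRZ_lt, Htau.
Qed.

(** * Nonnegative drift (tau <= 1): divergence of Q at 1/P(1) *)

Section Drift.
Hypothesis Htau1 : tau <= 1.

Definition usteps := steps c d (tilt p 1 (/ Pfun c d p 1)).

Lemma usteps_mass a : In a usteps -> 0 <= snd a.
Proof.
  apply steps_mass; [lra|]. apply Rinv_0_lt_compat, Pfun_pos; lra.
Qed.

Lemma usteps_total : integ usteps (fun _ => 1) = 1.
Proof.
  unfold usteps. rewrite integ_steps_tilt.
  rewrite (integ_ext _ _ (fun i => powerRZ 1 i)) by (intros; ring).
  rewrite <- Pfun_integ. apply Rinv_l. apply Rgt_not_eq, Pfun_pos; lra.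
Qed.

Lemma powerRZ_1_l i : powerRZ 1 i = 1.
Proof.
  rewrite powerRZ_Rpower by lra. unfold Rpower. rewrite ln_1, Rmult_0_r. apply exp_0.
Qed.

(** For [tau] <= 1 one has i tau^i <= i whatever the sign of i, and the sum of i p_i tau^i is 0. *)
Lemma usteps_mean : 0 <= integ usteps IZR.
Proof.
  unfold usteps. rewrite integ_steps_tilt. apply Rmult_le_pos.
  { left; apply Rinv_0_lt_compat, Pfun_pos; lra. }
  rewrite <- untilted_mean. apply integ_le; [apply untilted_mass|].
  intros a _. rewrite powerRZ_1_l, Rmult_1_l. set (i := fst a).
  assert (Hln : ln tau <= 0).
  { rewrite <- ln_1. destruct Htau1 as [H| ->]; [left; now apply ln_increasing|lra]. }
  rewrite powerRZ_Rpower by auto. unfold Rpower.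
  pose proof (exp_ge_id (IZR i * ln tau)).
  destruct (Rle_dec 0 (IZR i)) as [Hi|Hi].
  - assert (exp (IZR i * ln tau) <= exp 0).
    { apply exp_le_compat. nra. }
    rewrite exp_0 in H0. nra.
  - nra.
Qed.

(** A step adds a nonnegative mean, and killing discards only negative altitudes. *)
Lemma drift_mean_incr n :
  integ (meander usteps n) IZR <= integ (meander usteps (S n)) IZR.
Proof.
  rewrite meander_S.
  apply Rle_trans with (integ usteps (fun i => integ (meander usteps n) (fun y => IZR (i + y)))).
  - rewrite integ_exchange. apply integ_le; [apply meander_mass, usteps_mass|].
    intros a _. rewrite (integ_ext _ _ (fun i => IZR i + IZR (fst a) * 1))
      by (intros; rewrite plus_IZR; ring).
    rewrite integ_plus, integ_scal, usteps_total. pose proof usteps_mean. lra.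
  - apply integ_le; [apply usteps_mass|]. intros a _.
    apply integ_le; [apply meander_mass, usteps_mass|]. intros b _. unfold cut.
    destruct (Z.leb_spec 0 (fst a + fst b)); [lra|]. apply IZR_le; lia.
Qed.

Definition up_mass := p (Z.of_nat d) * / Pfun c d p 1.

Lemma up_mass_pos : 0 < up_mass.
Proof.
  apply Rmult_lt_0_compat; [specialize (Hpnn (Z.of_nat d)); lra|].
  apply Rinv_0_lt_compat, Pfun_pos; lra.
Qed.

Lemma up_in : In (Z.of_nat d, up_mass) usteps.
Proof.
  replace up_mass with (tilt p 1 (/ Pfun c d p 1) (Z.of_nat d)).
  - apply steps_in; lia.
  - unfold tilt, up_mass. rewrite powerRZ_1_l. ring.
Qed.

(* Optional stopping: with nonnegative drift the mean altitude of the surviving walk never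
   decreases, while the altitude is at most [d n]; so the survival mass is at least C/n. *)
Lemma drift_survival n :
  up_mass <= INR (S n) * integ (meander usteps (S n)) (fun _ => 1).
Proof.
  assert (H1 : INR d * up_mass <= integ (meander usteps (S n)) IZR).
  { induction n as [|n IH].
    - pose proof (meander_step_up usteps d up_mass usteps_mass up_in 0 IZR
        ltac:(intros; now apply IZR_le)) as H.
      eapply Rle_trans; [|exact H]. simpl integ.
      rewrite Z.add_0_r, <- INR_IZR_INZ. lra.
    - eapply Rle_trans; [exact IH|apply drift_mean_incr]. }
  assert (H2 : integ (meander usteps (S n)) IZR
    <= INR d * (INR (S n) * integ (meander usteps (S n)) (fun _ => 1))).
  { rewrite <- Rmult_assoc, <- mult_INR, <- integ_scal. apply integ_le.
    - apply meander_mass, usteps_mass.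
    - intros a Ha. pose proof (meander_le _ d _ a (steps_le _) Ha).
      rewrite Rmult_1_r, INR_IZR_INZ. now apply IZR_le. }
  assert (0 < INR d) by (apply lt_0_INR; lia).
  apply Rmult_le_reg_l with (INR d); lra.
Qed.

Lemma sQ_drift n :
  sQ (/ Pfun c d p 1) 1 (S n)
  = q * / Pfun c d p 1 * integ (meander usteps n) (fun x => is_cat (Z.to_nat x)).
Proof.
  rewrite (integ_ext_in _ _ (fun x => sum_f_R0 (fun k => is_cat k * dirac (Z.of_nat k) x) (d * S n))).
  - rewrite integ_sum. unfold sQ. fold (Q1c c d p q (S n)). rewrite Q1c_S.
    rewrite (sum_eq (fun k => integ _ _)
      (fun k => (/ Pfun c d p 1) ^ n * (is_cat k * mcoef c d p n k))).
    + rewrite sum_scal_l. simpl pow. ring.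
    + intros k Hk. rewrite integ_scal. unfold usteps. rewrite mcoef_tilt, pow1 by lra. ring.
  - intros a Ha. pose proof (meander_pos _ _ _ Ha).
    pose proof (meander_le _ d _ a (steps_le _) Ha).
    rewrite <- (sum_single (fun k => is_cat k) (Z.to_nat (fst a)) (d * S n)) by nia.
    apply sum_eq; intros k Hk. unfold dirac.
    destruct (Nat.eqb_spec k (Z.to_nat (fst a))); destruct (Z.eqb_spec (fst a) (Z.of_nat k));
      try lia; ring.
Qed.

Lemma sQ_drift_bounded n : 0 <= sQ (/ Pfun c d p 1) 1 n <= q * / Pfun c d p 1.
Proof.
  assert (HR : 0 < / Pfun c d p 1) by (apply Rinv_0_lt_compat, Pfun_pos; lra).
  assert (0 < q * / Pfun c d p 1) by now apply Rmult_lt_0_compat.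
  destruct n; [unfold sQ; rewrite Qnu_0; lra|]. rewrite sQ_drift.
  assert (Hi : 0 <= integ (meander usteps n) (fun x => is_cat (Z.to_nat x)) <= 1).
  { split.
    - apply integ_ge0; [apply meander_mass, usteps_mass|]. intros; apply is_cat_range.
    - eapply Rle_trans; [|apply (meander_total _ usteps_mass n usteps_total)].
      apply integ_le; [apply meander_mass, usteps_mass|]. intros; apply is_cat_range. }
  nra.
Qed.

(** The surviving mass is at least of order 1/n, and c + 1 further up-steps lift all of it above
    altitude c, where [is_cat] is 1. The terms thus dominate a harmonic series. *)
Lemma sQ_drift_unbounded M : exists N, M < sum_f_R0 (sQ (/ Pfun c d p 1) 1) N.
Proof.
  set (R := / Pfun c d p 1).
  assert (HR : 0 < R) by (apply Rinv_0_lt_compat, Pfun_pos; lra).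
  set (j := (c + 1)%nat). pose proof up_mass_pos as Hu.
  set (C := q * R * (up_mass ^ j * up_mass)).
  assert (HC : 0 < C).
  { pose proof (pow_lt _ j Hu).
    apply Rmult_lt_0_compat; apply Rmult_lt_0_compat; auto. }
  assert (Hterm : forall n, C * / INR (S n) <= sQ R 1 (S (S n + j))).
  { intros n. rewrite sQ_drift. fold R. unfold C. rewrite Rmult_assoc.
    apply Rmult_le_compat_l; [nra|].
    eapply Rle_trans; [|apply (meander_steps_up usteps d up_mass usteps_mass up_in)].
    - rewrite Rmult_assoc. apply Rmult_le_compat_l; [apply pow_le; lra|].
      rewrite (integ_ext_in _ _ (fun _ => 1)).
      + pose proof (drift_survival n) as Hs. assert (0 < INR (S n)) by (apply lt_0_INR; lia).
        apply Rmult_le_reg_r with (INR (S n)); [auto|].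
        rewrite Rmult_assoc, Rinv_l by lra. lra.
      + intros a Ha. pose proof (meander_pos _ _ _ Ha). apply is_cat_large.
        nia.
    - intros; apply is_cat_range.
    - lra. }
  assert (Hnn : forall n, 0 <= sQ R 1 n) by apply sQ_drift_bounded.
  assert (Hsum : forall N, C * sum_f_R0 (fun n => / INR (S n)) N
      <= sum_f_R0 (sQ R 1) (S (S N + j))).
  { induction N as [|N IH].
    - eapply Rle_trans; [apply (Hterm 0%nat)|]. now apply sum_term_le.
    - rewrite (tech5 (fun n => / INR (S n))). change (S (S (S N) + j)) with (S (S (S N + j))).
      rewrite (tech5 (sQ R 1)). specialize (Hterm (S N)).
      change (S (S (S N) + j)) with (S (S (S N + j))) in Hterm. lra. }
  destruct (harmonic_unbounded (M / C)) as [N HN].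
  exists (S (S N + j)). eapply Rlt_le_trans; [|apply Hsum].
  apply Rmult_lt_compat_l with (r := C) in HN; [|auto].
  replace (C * (M / C)) with M in HN by (field; lra). exact HN.
Qed.
End Drift.

Lemma sQ_0 r u : sQ r u 0 = 0.
Proof. unfold sQ; rewrite Qnu_0; ring. Qed.

Lemma sQ_mono r r' n : 0 <= r <= r' -> sQ r 1 n <= sQ r' 1 n.
Proof.
  intros H. apply Rmult_le_compat_l; [apply Qnu_nonneg; lra|]. apply pow_incr; lra.
Qed.

(** [B] is a radius at which the coefficients are controlled and [x] a root in the scaled variable.
    Minimality of the root is strict monotonicity of Q on the positive axis. *)
Lemma rho0_from_root r B x :
  0 < B <= rho -> 0 < x <= 1 -> r = B * x ->
  is_series (fun n => sQ B 1 n * x ^ n) 1 -> rho0_spec c d p q rho r.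
Proof.
  intros HB Hx -> Hser. assert (HBx : 0 < B * x) by (apply Rmult_lt_0_compat; lra).
  assert (H1 : is_series (fun n => Q1c c d p q n * (B * x) ^ n) 1).
  { eapply is_series_ext; [|exact Hser]. intros n; unfold sQ.
    fold (Q1c c d p q n). rewrite Rpow_mult_distr. simpl. ring. }
  split; [split; [auto|nra]|split; [exact H1|]].
  intros r' Hr' H2. destruct Q1c_eventually_pos as [N HN].
  apply (series_strict_mono (Q1c c d p q) N (B * x) r' 1); auto; [|lra].
  intros; apply Qnu_nonneg; lra.
Qed.

Lemma div_scale x y s : s <> 0 -> x * s / (y * s) = x / y.
Proof.
  intros Hs. unfold Rdiv. rewrite Rinv_mult.
  transitivity (x * / y * (s * / s)); [ring|rewrite Rinv_r by auto; ring].
Qed.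

(** * First case: rho_0 exists *)

Section FirstCase.
Variables (r Fq Fe v : R).
Hypothesis Hr : 0 < r.
Hypothesis Hser : is_series (sQ r 1) 1.
Hypothesis HFq : forall n, sQ r 1 n <= Fq / rt n ^ 3.
Hypothesis HFe : forall n, sE r n <= Fe / rt n ^ 3.
Hypothesis Hv : 0 < v.
Hypothesis Hvl : is_lim_seq (fun n => conv (fun i => INR i * sQ r 1 i) (sD r) n) v.

Lemma bound_nonneg (f : nat -> R) F : (forall n, 0 <= f n) -> (forall n, f n <= F / rt n ^ 3) -> 0 <= F.
Proof.
  intros H1 H2. specialize (H1 0%nat). specialize (H2 0%nat).
  replace (rt 0) with 1 in H2 by (unfold rt; simpl; now rewrite sqrt_1).
  lra.
Qed.

(** With h = D^2 at radius r, A is E plus the convolution of Q E with h. After division by h_n the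
    term E vanishes, the numerator tends to Q_k(r) E(r) and the denominator to Q(r) E(r) = E(r), so
    E(r) cancels. *)
Lemma PrX_first_case k :
  is_lim_seq (fun n => PrX c d p q n k) (Series (fun n => Qc c d p q n k * r ^ n)).
Proof.
  assert (Hrn : forall n, 0 <= r ^ n) by (intros; apply pow_le; lra).
  set (h := conv (sD r) (sD r)). set (qq := sQ r 1) in *.
  assert (Hdd : forall n, 0 <= sD r n) by (intros; apply Rmult_le_pos; [apply Dc_nonneg|auto]).
  assert (Hee : forall n, 0 <= sE r n) by (intros; apply Rmult_le_pos; [apply Ec_nonneg|auto]).
  assert (Hqq : forall n, 0 <= qq n) by (intros; apply Rmult_le_pos; [apply Qnu_nonneg; lra|auto]).
  assert (Hqk : forall n, 0 <= sQk r k n <= qq n).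
  { intros n; unfold sQk, qq, sQ. split; [apply Rmult_le_pos; [apply Qc_nonneg|auto]|].
    apply Rmult_le_compat_r; [auto|apply Qc_le_Q1c]. }
  pose proof (bound_nonneg _ _ Hqq HFq) as HFq0. pose proof (bound_nonneg _ _ Hee HFe) as HFe0.
  assert (Hh : forall n, 0 <= h n) by (intros; now apply conv_nonneg).
  assert (Hh0 : 0 < h 0%nat).
  { unfold h, conv; simpl. assert (sD r 0 = 1); [|rewrite H; lra].
    rewrite sD_rec. unfold conv; simpl. rewrite sQ_0. unfold delta0; simpl; ring. }
  (* From z (D^2)' = 2 D z D' and z D' = z Q' D^2, that is z h' = 2 (z Q' D) h. *)
  set (t := fun n => 2 * conv (fun i => INR i * qq i) (sD r) n).
  assert (Ht : is_lim_seq t (2 * v)).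
  { apply is_lim_seq_mult'; [apply is_lim_seq_const|exact Hvl]. }
  assert (Hth : forall n, INR n * h n = conv t h n).
  { intros n. unfold h at 1. rewrite conv_deriv, (conv_comm (sD r) (fun i => INR i * sD r i)).
    unfold t. rewrite conv_scal_l. unfold h. rewrite <- conv_assoc.
    rewrite (conv_ext (fun i => INR i * sD r i)
      (conv (conv (fun i => INR i * qq i) (sD r)) (sD r)) (sD r) (sD r)).
    - ring.
    - intros i _. apply inverse_deriv, sD_rec.
    - reflexivity. }
  destruct (summable_rt3 (sE r) Fe ltac:(auto)) as [Se HSe].
  assert (HSe1 : 1 <= Se).
  { pose proof (sum_le_series _ _ 0 Hee HSe) as H. simpl in H. unfold sE in H.
    rewrite Ec_0 in H. lra. }
  assert (Hgen : forall f S, (forall n, 0 <= f n <= qq n) -> is_series f S ->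
     is_lim_seq (fun n => conv f (conv (sD r) (conv (sD r) (sE r))) n / h n) (S * Se)).
  { intros f S Hf HS.
    assert (Hf3 : forall n, 0 <= f n <= Fq / rt n ^ 3).
    { intros n; split; [apply Hf|]. eapply Rle_trans; [apply Hf|apply HFq]. }
    assert (Hfp : forall n, 0 <= f n) by (intros; apply Hf).
    apply is_lim_seq_ext with (fun n => conv (conv f (sE r)) h n / h n).
    { intros n. f_equal. rewrite conv_assoc. apply conv_ext; intros i _; [reflexivity|].
      rewrite conv_comm. apply conv_assoc. }
    apply (rv_conv h t (2 * v) Hh Hh0 Ht ltac:(lra) Hth (conv f (sE r))
      (2 ^ 3 * (Fe * S + Fq * Se))).
    - apply conv_bound; auto; intros n; now apply sum_le_series.
    - pose proof (sum_le_series f S 0 Hfp HS) as H. specialize (Hfp 0%nat). simpl in H.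
      assert (0 <= Fe * S) by (apply Rmult_le_pos; lra).
      assert (0 <= Fq * Se) by (apply Rmult_le_pos; lra). lra.
    - now apply series_conv. }
  assert (Hez : is_lim_seq (fun n => sE r n / h n) 0).
  { apply (rv_negligible h t (2 * v) Hh Hh0 Ht ltac:(lra) Hth (sE r) Fe); auto. }
  destruct (ex_series_bounded (sQk r k) 1) as [Sk [HSk _]].
  { apply Hqk. }
  { intros n. eapply Rle_trans; [|apply (sum_le_series qq 1 n Hqq Hser)].
    apply sum_Rle; intros; apply Hqk. }
  replace (Series (fun n => Qc c d p q n k * r ^ n)) with Sk
    by (symmetry; apply is_series_unique; exact HSk).
  destruct (rv_lower h t (2 * v) Hh Hh0 Ht ltac:(lra) Hth) as [N HN].
  apply is_lim_seq_ext_loc with (fun n =>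
    ((if (k =? 0)%nat then 1 else 0) * (sE r n / h n)
      + conv (sQk r k) (conv (sD r) (conv (sD r) (sE r))) n / h n)
    / (sE r n / h n + conv qq (conv (sD r) (conv (sD r) (sE r))) n / h n)).
  { exists N; intros n Hn. destruct (HN n Hn) as [Hp _].
    assert (Hrp : 0 < r ^ n) by now apply pow_lt.
    assert (E1 : A1c c d p q n * r ^ n = sE r n + conv qq (conv (sD r) (conv (sD r) (sE r))) n).
    { unfold qq. rewrite <- sAc_gf. f_equal. apply sum_eq; intros; rewrite pow1; ring. }
    unfold PrX. rewrite <- (div_scale (Ac c d p q n k) _ (r ^ n)), E1, sAc by lra.
    rewrite <- (div_scale _ (sE r n + _) (/ h n)) by (apply Rinv_neq_0_compat; lra).
    f_equal; [|unfold Rdiv; ring]. destruct (k =? 0)%nat; unfold Rdiv; ring. }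
  replace (Finite Sk) with (Finite (((if (k =? 0)%nat then 1 else 0) * 0 + Sk * Se) / (0 + 1 * Se)))
    by (f_equal; field; lra).
  apply is_lim_seq_div'; [| |lra].
  - apply is_lim_seq_plus'; [|now apply Hgen].
    apply is_lim_seq_mult'; [apply is_lim_seq_const|exact Hez].
  - apply is_lim_seq_plus'; [exact Hez|]. apply Hgen; [intros; split; [auto|lra]|exact Hser].
Qed.
End FirstCase.

Lemma sE_bound r n Fe : 0 < r <= rho ->
  (forall n, sE rho n <= Fe / rt n ^ 3) -> sE r n <= Fe / rt n ^ 3.
Proof.
  intros Hr H. eapply Rle_trans; [|apply H]. apply Rmult_le_compat_l; [apply Ec_nonneg|].
  apply pow_incr; lra.
Qed.

Lemma sD_nonneg r n : 0 <= r -> 0 <= sD r n.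
Proof. intros Hr. apply Rmult_le_pos; [apply Dc_nonneg|now apply pow_le]. Qed.

Lemma sE_decay : exists Fe, forall n, sE rho n <= Fe / rt n ^ 3.
Proof.
  destruct sE_asymp as [Se [_ [_ HE]]].
  destruct (lim_rt_bound _ _ _ HE) as [Fe [_ HFe]]. exists Fe; intros n.
  eapply Rle_trans; [apply Rle_abs|apply HFe].
Qed.

Lemma sQ_eventually_pos r : 0 < r ->
  exists j0, forall j, (j0 <= j)%nat -> 0 < sQ r 1 j.
Proof.
  intros Hr. destruct Q1c_eventually_pos as [j0 Hj0]. exists j0; intros j Hj.
  apply Rmult_lt_0_compat; [now apply Hj0|now apply pow_lt].
Qed.

(** Bounded coefficients at a radius [B] > r become O((r/B)^n) at r, so the renewal law has
    geometric tails and a finite mean. *)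
Lemma first_case_subcritical r B K k :
  0 < r <= rho -> r < B -> (forall n, sQ B 1 n <= K) -> is_series (sQ r 1) 1 ->
  is_lim_seq (fun n => PrX c d p q n k) (Series (fun n => Qc c d p q n k * r ^ n)).
Proof.
  intros Hr HrB HK Hser.
  assert (Hq0 : forall n, 0 <= sQ r 1 n).
  { intros n; apply Rmult_le_pos; [apply Qnu_nonneg; lra|apply pow_le; lra]. }
  set (t := r / B).
  assert (Ht : 0 < t < 1).
  { unfold t; split; [apply Rdiv_lt_0_compat; lra|].
    apply Rmult_lt_reg_r with B; [lra|]. unfold Rdiv; rewrite Rmult_assoc, Rinv_l; lra. }
  assert (HK0 : 0 <= K) by (specialize (HK 0%nat); rewrite sQ_0 in HK; exact HK).
  assert (Hgeo : forall n, 0 <= sQ r 1 n <= K * t ^ n).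
  { intros n; split; [auto|].
    replace (sQ r 1 n) with (sQ B 1 n * t ^ n).
    - apply Rmult_le_compat_r; [apply pow_le; lra|auto].
    - unfold sQ. rewrite Rmult_assoc, <- Rpow_mult_distr. do 2 f_equal. unfold t; field; lra. }
  destruct (geometric_rt3 t Ht) as [G [HG HGn]]. destruct sE_decay as [Fe HFe].
  destruct (sQ_eventually_pos r ltac:(lra)) as [j0 Hj0].
  destruct (summable_rt3 (tail_mass (sQ r 1)) (K / (1 - t) * G)) as [mu Hmu].
  { intros n; split; [left; apply tail_mass_pos with j0; auto|].
    eapply Rle_trans; [apply (geometric_tail _ K t Ht HK0 Hser Hgeo)|].
    unfold Rdiv at 2; rewrite Rmult_assoc. apply Rmult_le_compat_l; [|apply HGn].
    apply Rdiv_le_0_compat; lra. }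
  destruct (renewal_finite_mean (sQ r 1) (sD r) j0 Hq0 (sQ_0 r 1) Hser Hj0
    (fun n => sD_nonneg r n ltac:(lra)) (sD_rec r) mu Hmu) as [v [Hv Hvl]].
  apply (PrX_first_case r (K * G) Fe v); auto; try lra.
  - intros n. eapply Rle_trans; [apply Hgeo|]. unfold Rdiv; rewrite Rmult_assoc.
    apply Rmult_le_compat_l; [auto|apply HGn].
  - intros n; now apply sE_bound.
Qed.

(** Three regimes. For [tau] <= 1 the divergence at 1/P(1) forces r below that point, where the
    coefficients are bounded. For [tau] > 1 either r < [rho], with coefficients bounded at [rho], or
    r = [rho], and the renewal sequence is critical. *)
Lemma first_case r k : rho0_spec c d p q rho r ->
  is_lim_seq (fun n => PrX c d p q n k) (Series (fun n => Qc c d p q n k * r ^ n)).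
Proof.
  intros [Hr [Hser _]].
  assert (HQ : is_series (sQ r 1) 1) by exact Hser.
  assert (Hq0 : forall n, 0 <= sQ r 1 n).
  { intros n; apply Rmult_le_pos; [apply Qnu_nonneg; lra|apply pow_le; lra]. }
  destruct (Rle_dec tau 1) as [Ht|Ht].
  - apply first_case_subcritical with (/ Pfun c d p 1) (q * / Pfun c d p 1); auto.
    + apply Rnot_le_lt; intros HR. destruct (sQ_drift_unbounded Ht 1) as [N HN].
      pose proof (sum_le_series _ _ N Hq0 HQ).
      assert (sum_f_R0 (sQ (/ Pfun c d p 1) 1) N <= sum_f_R0 (sQ r 1) N); [|lra].
      apply sum_Rle; intros n Hn. apply sQ_mono. split; [|exact HR].
      left; apply Rinv_0_lt_compat, Pfun_pos; lra.
    + intros n; now apply sQ_drift_bounded.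
  - destruct (sQ_asymp 1 ltac:(lra)) as [lam Hlam].
    destruct (lim_rt_bound _ _ _ Hlam) as [K [HK HKn]].
    assert (HKn' : forall n, sQ rho 1 n <= K / rt n ^ 3).
    { intros n; eapply Rle_trans; [apply Rle_abs|apply HKn]. }
    destruct (Rle_lt_or_eq_dec _ _ (proj2 Hr)) as [Hlt|Heq].
    + apply first_case_subcritical with rho K; auto.
      intros n. eapply Rle_trans; [apply HKn'|]. pose proof (rt_ge1 n).
      assert (1 <= rt n ^ 3) by (apply pow_R1_Rle; lra).
      apply Rmult_le_reg_r with (rt n ^ 3); [lra|].
      unfold Rdiv; rewrite Rmult_assoc, Rinv_l by lra. nra.
    + subst r. destruct sE_decay as [Fe HFe].
      destruct (sQ_eventually_pos rho ltac:(lra)) as [j0 Hj0].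
      apply (PrX_first_case rho K Fe (1 / 2)); auto; try lra.
      apply (renewal_critical (sQ rho 1) (sD rho) j0 Hq0 (sQ_0 rho 1) HQ Hj0
        (fun n => sD_nonneg rho n ltac:(lra)) (sD_rec rho) lam); [|exact Hlam].
      now apply sQ_lim_pos.
Qed.

(** * Second case: no rho_0, all series of order n^(-3/2) at rho *)

Section SecondCase.
Hypothesis Hno : ~ exists r, rho0_spec c d p q rho r.

(** For [tau] <= 1 the partial sums of Q at 1/P(1) <= [rho] exceed 1, and [power_series_root] would
    produce a rho_0. *)
Lemma second_case_tau : 1 < tau.
Proof.
  apply Rnot_le_lt; intros Ht. set (R := / Pfun c d p 1).
  assert (HR : 0 < R <= rho).
  { split; [apply Rinv_0_lt_compat, Pfun_pos; lra|apply rho_bound_R; lra]. }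
  destruct (sQ_drift_unbounded Ht 1) as [N HN].
  destruct (power_series_root (sQ R 1) _ N sQ_drift_bounded (sQ_0 R 1) HN) as [x [Hx Hs]].
  apply Hno. exists (R * x). apply rho0_from_root with R x; auto; lra.
Qed.

Lemma second_case_Q1 S : is_series (sQ rho 1) S -> S < 1.
Proof.
  intros HS. pose proof rho_pos as Hr.
  assert (Hq0 : forall n, 0 <= sQ rho 1 n) by (intros; apply sQ_nonneg; lra).
  apply Rnot_le_lt; intros [Hgt|Heq].
  - destruct (proj1 (lim_eps _ _) (proj1 (series_lim _ _) HS) (S - 1) ltac:(lra)) as [N HN].
    specialize (HN N (le_n N)). apply Rabs_def2 in HN.
    assert (HB : forall n, 0 <= sQ rho 1 n <= S).
    { intros n; split; [auto|]. eapply Rle_trans; [|apply (sum_le_series _ _ n Hq0 HS)].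
      now apply sum_term_le. }
    destruct (power_series_root (sQ rho 1) S N HB (sQ_0 rho 1) ltac:(lra)) as [x [Hx Hs]].
    apply Hno. exists (rho * x). apply rho0_from_root with rho x; auto; lra.
  - apply Hno. exists (rho * 1). apply rho0_from_root with rho 1; auto; try lra.
    subst S. eapply is_series_ext; [|exact HS]. intros n. rewrite pow1. simpl. ring.
Qed.

Definition lamQ (u : R) : R := real (Lim_seq (fun n => sQ rho u n * rt n ^ 3)).

Lemma lamQ_spec u : 0 <= u < tau -> is_lim_seq (fun n => sQ rho u n * rt n ^ 3) (lamQ u).
Proof. intros Hu. apply Lim_seq_correct'. destruct (sQ_asymp u Hu) as [l Hl]. now exists l. Qed.

Lemma Qval_spec u : 0 <= u < tau -> is_series (sQ rho u) (Qval c d p q rho u).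
Proof.
  intros Hu. destruct (sQ_summable u Hu) as [S HS].
  replace (Qval c d p q rho u) with S; [exact HS|].
  symmetry; apply is_series_unique, HS.
Qed.

Lemma lamQ_nonneg u : 0 <= u < tau -> 0 <= lamQ u.
Proof.
  intros Hu. refine (is_lim_seq_le (fun _ => 0) _ 0 (lamQ u) _ (is_lim_seq_const 0) (lamQ_spec u Hu)).
  intros n. apply Rmult_le_pos; [apply sQ_nonneg; lra|apply pow_le; left; apply rt_pos].
Qed.

(** Both [eta_spec] and [abelian_sqrt] expand Q(rho,u) - Q(z,u) to first order in sqrt (1 - z/rho),
    with errors O(1 - z/rho) and o(sqrt (1 - z/rho)). So the two coefficients agree. *)
Lemma eta_value eta : eta_spec c d p q rho eta ->
  forall u, 0 <= u <= 1 -> eta u = lamQ u / (gauss_lim / PI).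
Proof.
  intros Heta u Hu. pose proof second_case_tau as Ht. pose proof rho_pos as Hr.
  set (kap := gauss_lim / PI).
  assert (Hkap : 0 < kap) by (apply Rdiv_lt_0_compat; [apply gauss_lim_pos|apply PI_RGT_0]).
  destruct (Heta u Hu) as [Qr [HQr [K [delta [Hdel Hz]]]]].
  apply cond_eq. intros eps Heps.
  destruct (abelian_sqrt sqrt_coef eq_refl sqrt_coef_1 sqrt_coef_rec kap Hkap sqrt_coef_asymp
    (sQ rho u) (lamQ u) Qr (lamQ_spec u ltac:(lra)) HQr (eps / 4) ltac:(lra)) as [del [Hdp Hab]].
  set (K' := Rabs K + 1). assert (HK' : 0 < K') by (unfold K'; pose proof (Rabs_pos K); lra).
  (* A single test point x = 1 - s^2, so that sqrt (1 - x) = s. The bounds on [s] keep rho x in both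
     neighbourhoods and make the O-term at most eps/4 times s. *)
  set (s := Rmin (Rmin (1 / 2) (eps / (4 * K'))) (Rmin (del / 2) (delta / (2 * rho)))).
  assert (Hs : 0 < s).
  { repeat apply Rmin_glb_lt; try lra; apply Rdiv_lt_0_compat; lra. }
  assert (Hs1 : s <= 1 / 2) by (eapply Rle_trans; [apply Rmin_l|apply Rmin_l]).
  assert (Hs2 : s <= eps / (4 * K')) by (eapply Rle_trans; [apply Rmin_l|apply Rmin_r]).
  assert (Hs3 : s <= del / 2) by (eapply Rle_trans; [apply Rmin_r|apply Rmin_l]).
  assert (Hs4 : s <= delta / (2 * rho)) by (eapply Rle_trans; [apply Rmin_r|apply Rmin_r]).
  set (x := 1 - s * s).
  assert (Hsx : sqrt (1 - x) = s).
  { unfold x. replace (1 - (1 - s * s)) with (s * s) by ring. apply sqrt_square; lra. }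
  assert (Hrs : rho * s <= delta / 2).
  { apply Rle_trans with (rho * (delta / (2 * rho))); [apply Rmult_le_compat_l; lra|].
    apply Req_le; field; lra. }
  destruct (Hz (rho * x)) as [Qz [HQz Hb]].
  { assert (0 < rho * (s * s)) by (apply Rmult_lt_0_compat; nra).
    assert (rho * (s * s) <= rho * s) by (apply Rmult_le_compat_l; nra).
    unfold x. lra. }
  replace (rho * x / rho) with x in Hb by (field; lra). rewrite Hsx in Hb.
  assert (Hser : is_series (fun n => sQ rho u n * x ^ n) Qz).
  { eapply is_series_ext; [|exact HQz]. intros n. unfold sQ. rewrite Rpow_mult_distr.
    simpl. ring. }
  specialize (Hab x Qz ltac:(unfold x; nra) ltac:(unfold x; nra) Hser). rewrite Hsx in Hab.
  assert (HKs : K' * s <= eps / 4).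
  { apply Rle_trans with (K' * (eps / (4 * K'))); [apply Rmult_le_compat_l; lra|].
    apply Req_le; field; lra. }
  assert (HKx : K * (1 - x) <= eps / 4 * s).
  { unfold x.
    pose proof (Rle_abs K). unfold K' in HKs. nra. }
  assert (Hfin : Rabs ((eta u - lamQ u / kap) * s) <= eps / 2 * s).
  { replace ((eta u - lamQ u / kap) * s)
      with ((Qz - Qr + eta u * s) + (Qr - Qz - lamQ u / kap * s)) by ring.
    eapply Rle_trans; [apply Rabs_triang|]. lra. }
  rewrite Rabs_mult, (Rabs_pos_eq s) in Hfin by lra.
  apply Rmult_le_reg_r in Hfin; lra.
Qed.

(** The product rule of [conv_lim] applied to E + Q * (D * (D * E)), innermost product first; [Ld]
    and [Le] are the limits belonging to D and E. *)
Definition limA (u Se : R) : R :=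
  let Q1 := Qval c d p q rho 1 in
  let D := / (1 - Q1) in
  let Ld := lamQ 1 / (1 - Q1) ^ 2 in
  let Le := Se * ks in
  Le + (Qval c d p q rho u * (D * (D * Le + Se * Ld) + D * Se * Ld) + D * (D * Se) * lamQ u).

Lemma A_gf_asymp Se u :
  is_series (sE rho) Se -> is_lim_seq (fun n => sE rho n * rt n ^ 3) (Se * ks) ->
  0 <= u < tau ->
  is_lim_seq (fun n => sum_f_R0 (fun k => Ac c d p q n k * u ^ k) (d * n) * rho ^ n * rt n ^ 3)
    (limA u Se).
Proof.
  intros HSe HLe Hu. pose proof second_case_tau as Ht. pose proof rho_pos as Hr.
  pose proof (Qval_spec 1 ltac:(lra)) as HQ1. pose proof (second_case_Q1 _ HQ1) as HQlt.
  set (Q1 := Qval c d p q rho 1) in *. set (D := / (1 - Q1)).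
  assert (Hdd : forall n, 0 <= sD rho n) by (intros; apply sD_nonneg; lra).
  assert (Hee : forall n, 0 <= sE rho n) by (intros; apply Rmult_le_pos; [apply Ec_nonneg|apply pow_le; lra]).
  assert (Hqq : forall n, 0 <= sQ rho 1 n) by (intros; apply sQ_nonneg; lra).
  assert (HD : is_series (sD rho) D) by (now apply inverse_bound with (sQ rho 1); auto using sD_rec).
  assert (HLd : is_lim_seq (fun n => sD rho n * rt n ^ 3) (lamQ 1 / (1 - Q1) ^ 2)).
  { apply inverse_closure with (sQ rho 1); auto using sD_rec. apply lamQ_spec; lra. }
  assert (HDE := conv_lim _ _ 3 _ _ _ _ Hdd Hee HD HSe HLd HLe).
  assert (Hde : forall n, 0 <= conv (sD rho) (sE rho) n) by (intros; now apply conv_nonneg).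
  assert (HsDE := series_conv _ _ _ _ Hdd Hee HD HSe).
  assert (HDDE := conv_lim _ _ 3 _ _ _ _ Hdd Hde HD HsDE HLd HDE).
  assert (Hdde : forall n, 0 <= conv (sD rho) (conv (sD rho) (sE rho)) n) by (intros; now apply conv_nonneg).
  assert (HsDDE := series_conv _ _ _ _ Hdd Hde HD HsDE).
  assert (Hqu : forall n, 0 <= sQ rho u n) by (intros; apply sQ_nonneg; lra).
  assert (Hfin := conv_lim _ _ 3 _ _ _ _ Hqu Hdde (Qval_spec u Hu) HsDDE (lamQ_spec u Hu) HDDE).
  apply is_lim_seq_ext with (fun n => sE rho n * rt n ^ 3
    + conv (sQ rho u) (conv (sD rho) (conv (sD rho) (sE rho))) n * rt n ^ 3).
  { intros n. rewrite sAc_gf. ring. }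
  apply is_lim_seq_plus'; [exact HLe|exact Hfin].
Qed.

Lemma Ac_nonneg n k : 0 <= Ac c d p q n k.
Proof.
  apply Rplus_le_le_0_compat; [destruct (k =? 0)%nat; [apply Ec_nonneg|lra]|].
  apply conv_nonneg; [intros; apply Qc_nonneg|].
  intros i. apply conv_nonneg; [apply Dc_nonneg|]. intros j.
  apply conv_nonneg; [apply Dc_nonneg|apply Ec_nonneg].
Qed.

Lemma PrX_nonneg n k : 0 <= PrX c d p q n k.
Proof.
  apply Rmult_le_pos; [apply Ac_nonneg|].
  destruct (cond_pos_sum (fun k => Ac c d p q n k) (d * n) (fun k => Ac_nonneg n k)) as [H|H].
  - left; now apply Rinv_0_lt_compat.
  - unfold A1c; rewrite <- H, Rinv_0; lra.
Qed.

Lemma PrX_zero n k : (d * n < k)%nat -> PrX c d p q n k = 0.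
Proof.
  intros Hk. unfold PrX, Ac. replace (k =? 0)%nat with false by (symmetry; apply Nat.eqb_neq; lia).
  unfold conv at 1. rewrite sum_zero; [unfold Rdiv; ring|].
  intros i Hi. rewrite Qc_zero by nia. ring.
Qed.

Lemma second_case eta : eta_spec c d p q rho eta ->
  exists l : nat -> R,
    (forall k, is_lim_seq (fun n => PrX c d p q n k) (l k)) /\
    (forall u, 0 <= u <= 1 -> is_series (fun k => l k * u ^ k) (omega2 c d p q tau eta u)).
Proof.
  intros Heta. pose proof second_case_tau as Ht. pose proof rho_pos as Hr.
  destruct sE_asymp as [Se [HSe1 [HSe HLe]]].
  pose proof (Qval_spec 1 ltac:(lra)) as HQ1. pose proof (second_case_Q1 _ HQ1) as HQlt.
  pose proof (sum_le_series _ _ 0 (fun n => sQ_nonneg 1 n Rle_0_1) HQ1) as HQ0.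
  simpl in HQ0; rewrite sQ_0 in HQ0.
  set (kap := gauss_lim / PI).
  assert (Hkap : 0 < kap) by (apply Rdiv_lt_0_compat; [apply gauss_lim_pos|apply PI_RGT_0]).
  set (sg := sqrt (2 / s2)).
  assert (Hsg : 0 < sg) by (apply sqrt_lt_R0, Rdiv_lt_0_compat; [lra|apply s2_pos]).
  set (D := / (1 - Qval c d p q rho 1)).
  assert (HD : 0 < D) by (apply Rinv_0_lt_compat; lra).
  (* The numerator of [omega2], with [sg] for C/tau and [lamQ u / kap] for eta(u). [limA] is
     [Se * kap] times it, a factor independent of u that cancels in the quotient. *)
  set (num := fun u => sg + (sg * D ^ 2 + 2 * (lamQ 1 / kap) * D ^ 3) * Qval c d p q rho u
     + lamQ u / kap * D ^ 2).
  assert (Hnum : forall u, limA u Se = Se * kap * num u).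
  { intros u. unfold limA, num. fold D.
    replace (lamQ 1 / (1 - Qval c d p q rho 1) ^ 2) with (lamQ 1 * D ^ 2) by (unfold D; field; lra).
    unfold ks. fold kap sg. field; lra. }
  assert (Hl1 : 0 <= lamQ 1 / kap) by (apply Rdiv_le_0_compat; [apply lamQ_nonneg; lra|auto]).
  assert (Hn1 : 0 < num 1).
  { unfold num. assert (0 <= D ^ 2) by (apply pow_le; lra). assert (0 <= D ^ 3) by (apply pow_le; lra).
    assert (0 <= (sg * D ^ 2 + 2 * (lamQ 1 / kap) * D ^ 3) * Qval c d p q rho 1).
    { assert (0 <= sg * D ^ 2) by (apply Rmult_le_pos; lra).
      assert (0 <= lamQ 1 / kap * D ^ 3) by (apply Rmult_le_pos; lra).
      apply Rmult_le_pos; lra. }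
    assert (0 <= lamQ 1 / kap * D ^ 2) by (apply Rmult_le_pos; lra). lra. }
  (* The endpoint (1 + tau)/2 lies strictly between 1 and [tau]: [A_gf_asymp] holds up to it, and
     the series obtained below it include u = 1, so no mass escapes to infinity. *)
  destruct (gf_continuity (PrX c d p q) (fun n => (d * n)%nat) (fun u => num u / num 1)
    ((1 + tau) / 2)) as [l [Hl Hls]].
  - lra.
  - intros; nia.
  - apply PrX_nonneg.
  - apply PrX_zero.
  - intros u Hu.
    assert (Hlim : is_lim_seq (fun n =>
      (sum_f_R0 (fun k => Ac c d p q n k * u ^ k) (d * n) * rho ^ n * rt n ^ 3)
      / (sum_f_R0 (fun k => Ac c d p q n k * 1 ^ k) (d * n) * rho ^ n * rt n ^ 3))
      (limA u Se / limA 1 Se)).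
    { apply is_lim_seq_div'; [apply A_gf_asymp; auto; lra|apply A_gf_asymp; auto; lra|].
      rewrite Hnum. apply Rgt_not_eq.
      apply Rmult_lt_0_compat; [apply Rmult_lt_0_compat|]; lra. }
    rewrite !Hnum in Hlim.
    replace (num u / num 1) with (Se * kap * num u / (Se * kap * num 1)) by (field; lra).
    eapply is_lim_seq_ext; [|exact Hlim]. intros n; cbv beta.
    assert (0 < rho ^ n) by now apply pow_lt. pose proof (pow_lt _ 3 (rt_pos n)).
    rewrite div_scale, div_scale by lra.
    rewrite (sum_eq (fun k => Ac c d p q n k / A1c c d p q n * u ^ k)
      (fun k => / A1c c d p q n * (Ac c d p q n k * u ^ k))) by (intros; unfold Rdiv; ring).
    rewrite sum_scal_l. unfold A1c.
    rewrite (sum_eq (fun k => Ac c d p q n k * 1 ^ k) (fun k => Ac c d p q n k))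
      by (intros; rewrite pow1; ring).
    unfold Rdiv; ring.
  - exists l; split; [exact Hl|]. intros u Hu.
    replace (omega2 c d p q tau eta u) with (num u / num 1); [apply Hls; lra|].
    unfold omega2. rewrite s2_formula.
    rewrite (eta_value eta Heta u Hu), (eta_value eta Heta 1) by lra. reflexivity.
Qed.
End SecondCase.
End Model.

Theorem theorem4p21
  (c d : nat) (p : Z -> R) (q tau : R)
  (Hc : (1 <= c)%nat) (Hd : (1 <= d)%nat)
  (Hpnn : forall i : Z, 0 <= p i)
  (Hpsupp : forall i : Z, (i < - Z.of_nat c)%Z \/ (Z.of_nat d < i)%Z -> p i = 0)
  (Hpc : p (- Z.of_nat c)%Z <> 0) (Hpd : p (Z.of_nat d) <> 0)
  (Hap : aperiodic p)
  (Hq : 0 < q)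
  (Htau : tau_spec c d p tau) :
  (* case rho0 exists (rho0 <= rho): omega(u) = Q(rho0,u) *)
  (forall rho0 : R, rho0_spec c d p q (rho_of c d p tau) rho0 ->
     forall k : nat,
       is_lim_seq (fun n => PrX c d p q n k)
                  (Finite (Series (fun n => Qc c d p q n k * rho0 ^ n)))) /\
  (* case rho0 does not exist *)
  ((~ exists rho0 : R, rho0_spec c d p q (rho_of c d p tau) rho0) ->
     forall eta : R -> R, eta_spec c d p q (rho_of c d p tau) eta ->
     exists l : nat -> R,
       (forall k : nat, is_lim_seq (fun n => PrX c d p q n k) (Finite (l k))) /\
       (forall u : R, 0 <= u <= 1 ->
          is_series (fun k => l k * u ^ k) (omega2 c d p q tau eta u))).
Proof.
  destruct Htau as [Htau0 [HDtau _]]. split.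
  - intros rho0 Hrho0 k.
    now apply (first_case c d p q Hc Hd Hpnn Hpsupp Hpc Hpd Hap Hq tau Htau0 HDtau).
  - intros Hno eta Heta.
    now apply (second_case c d p q Hc Hd Hpnn Hpsupp Hpc Hpd Hap Hq tau Htau0 HDtau).
Qed.
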